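(* Let $x(t)=y(t)+\epsilon_t$, $t\in\mathbb{N}$, with $y(t)=\sum_{n=1}^N\alpha_n e^{-i\lambda_n t}$, where $N\in\{0,1,2,\dots\}$, the frequencies $\lambda_n\in[-\pi,\pi)$ are distinct, $\alpha_n\in\mathbb{C}\setminus\{0\}$, and $(\epsilon_t)_{t\ge1}$ are independent complex random variables on a complete probability space $(\Omega,\mathcal{A},\Pr)$. Let the matrix $A$, the sequences $(H_m),(h_m),(h'_m),(J_m)$, the families $\mathbb{A}_m=\mathbb{A}_m(x)$ and the numbers $\widehat N_m=\widehat N_m(x)$ be as described in the context. Assume that at least one of the following noise conditions is fulfilled: (N1) the $\epsilon_t$ are i.i.d. with $\mathbb{E}(\epsilon_t)=0$ and $\mathbb{E}(|\epsilon_t|\log|\epsilon_t|)<\infty$; (N2) the $\epsilon_t$ are i.i.d. symmetric and $\mathbb{E}\left(|\epsilon_t|\log\log(|\epsilon_t|+e)\right)<\infty$; (N3) the $\epsilon_t$ are independent, symmetric, with finite variances $\mathbb{E}(|\epsilon_t|^2)=O(t^\nu)$ as $t\to+\infty$ for a certain $\nu<1$; (N4) the $\epsilon_t$ are independent, symmetric, with finite variances satisfying $\sum_{k=1}^{+\infty}\tau_k<+\infty$, where $\tau_k=2^{k/2}\Big(\sum_{t=2^{2^k}}^{-1+2^{2^{(k+1)}}}\frac{\mathbb{E}(|\epsilon_{t+1}|^2)}{(t+1)^2}\Big)^{1/2}$. Consequently, the set $B_1$ of all $\omega\in\Omega$ such that $\sup_{m\in\mathbb{N}}\|S^A_{\epsilon,m}(e^{i\theta})\|_\infty<\infty$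 is an almost sure event. For every $\omega\in B_1$ the following statements hold. (i) There exists $M=M(\omega)\in\mathbb{N}$ such that for all $m\ge M$ one has $\widehat N_m=N$ and, for each $n\in\mathbb{N}$ with $1\le n\le N$, there exists a maximal $(h_m,J_m)$-arc $\mathfrak{A}_{m,n}\in\mathbb{A}_m$ satisfying $e^{i\lambda_n}\in\mathfrak{A}_{m,n}$. This means that for $m\ge M$ the family $\mathbb{A}_m$ consists exactly of $N$ maximal superlevel arcs $\mathfrak{A}_{m,1},\dots,\mathfrak{A}_{m,N}$; in the case $N=0$ the family $\mathbb{A}_m$ is empty. (ii) Suppose $N\ne0$ and $m\ge M$. For each $n=1,\dots,N$ denote by $j_{m,n}$ and $j'_{m,n}$ natural numbers such that $\mathfrak{A}_{m,n}=\operatorname{Arc}\left[2\pi\frac{j_{m,n}}{J_m},2\pi\frac{j'_{m,n}}{J_m}\right]$. Then $$\widehat z_{m,n}:=\exp\left(2\pi i\,\frac{j_{m,n}+j'_{m,n}}{2J_m}\right)\quad\text{converge to } z_n=e^{i\lambda_n}\text{ as } m\to+\infty.$$ If, additionally, the sequence $(J_m)$ satisfies $$\lim_{m\to+\infty}\frac{S^A_{\mathbf{1},m}(e^{2\pi i/J_m})}{S^A_{\mathbf{1},m}(1)}=1,$$ and $j^{\max}_{m,n}\in[j_{m,n},j'_{m,n}]\cap\mathbb{Z}$ is a maximizer in the sense that $$\left|S^A_{x,m}\left(\exp\left(2\pi i\frac{j^{\max}_{m,n}}{J_m}\right)\right)\right|=\max_{j_{m,n}\le j\le j'_{m,n}}\left|S^A_{x,m}\left(\exp\left(2\pi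 i\frac{j}{J_m}\right)\right)\right|,$$ then $$\alpha_n=\lim_{m\to+\infty}\frac{S^A_{x,m}\left(\exp\left(2\pi i\, j^{\max}_{m,n}/J_m\right)\right)}{\sum_{t=1}^m a_{m,t}/t}.$$
   Context: A complex random variable is symmetric if it has the same distribution as its negative. $\operatorname{Arc}[\theta_1,\theta_2]=\{e^{i\theta}:\theta_1\le\theta\le\theta_2\}$ for real $\theta_1\le\theta_2$. For a matrix $A=(a_{m,t})_{m,t=1}^\infty$ vanishing for $t>m$ and a complex sequence $u=(u(t))_{t\ge1}$ put $S^A_{u,m}(e^{i\theta})=\sum_{t=1}^m a_{m,t}\frac{u(t)}{t}e^{it\theta}$; $\mathbf{1}$ denotes the sequence identically equal to $1$, so $S^A_{\mathbf{1},m}(e^{i\theta})=\sum_{t=1}^m\frac{a_{m,t}}{t}e^{it\theta}$; $S^A_{\epsilon,m}$ corresponds to $u=(\epsilon_t)$. $\|\cdot\|_\infty$ is the $L^\infty$-norm in $\theta$. Assumptions on $A$: $A$ is real and: $0<a_{m,1}\le1$ and $a_{m,t}$ is non-increasing in $t$ for every $m$; $a_{m,t}\ge0$ if $t\le m$ and $a_{m,t}=0$ if $t>m$; $a_{m,t}\to1$ as $m\to+\infty$ for every $t$. Moreover, the almost decreasing property holds: for each $m\in\mathbb{N}$, $S^A_{\mathbf{1},m}(e^{i\theta})=f_m(\theta)+\mathfrak{b}(m,\theta)$, where $f_m$ is a $2\pi$-periodic even nonnegative function non-increasing on $[0,\pi]$, and $\mathfrak{b}(m,\cdot)\in L^\infty(\mathbb{R})$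 with $|\mathfrak{b}|_\infty:=\sup_{m\in\mathbb{N}}\|\mathfrak{b}(m,\theta)\|_\infty<\infty$. Sequences: $(H_m)$ are real numbers with $H_m<S^A_{\mathbf{1},m}(1)$ for all $m$ and $\lim H_m=+\infty$; $(h_m)$ are real numbers with $\lim h_m=\lim H_m/h_m=+\infty$; $(h'_m)$ are real numbers with $h_m\le h'_m$ and $\lim(h'_m-h_m)=\lim H_m/h'_m=+\infty$; $(J_m)$ are natural numbers with $|S^A_{\mathbf{1},m}(e^{i\theta})|\ge H_m$ for all $\theta\in[-2\pi/J_m,2\pi/J_m]$. Superlevel arcs: for $h\in\mathbb{R}$, $J\in\mathbb{N}$, an $(h,J)$-arc for $S^A_{u,m}$ is a closed arc $\operatorname{Arc}[2\pi j_1/J,2\pi j_2/J]$ with $j_1\le j_2$ integers such that $|S^A_{u,m}(\exp(i2\pi j/J))|\ge h$ for all $j\in\mathbb{Z}\cap[j_1,j_2]$. An $(h,J)$-arc is maximal if it is not a subset of any other $(h,J)$-arc for $S^A_{u,m}$; this means that either it contains all points $\exp(i2\pi j/J)$, $j\in\mathbb{Z}$, or it equals $\operatorname{Arc}[2\pi j_1/J,2\pi j_2/J]$ with $|S^A_{u,m}(\exp(i2\pi j/J))|\ge h$ for $j\in\mathbb{Z}\cap[j_1,j_2]$ and $|S^A_{u,m}(\exp(i2\pi j/J))|<h$ for $j=j_1-1$ and $j=j_2+1$. $\mathbb{A}_m(u)$ is the family of all maximal $(h_m,J_m)$-arcs for $S^A_{u,m}$ that contain at least one $(h'_m,J_m)$-arc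 for $S^A_{u,m}$; $\widehat N_m(u)$ is the number of arcs in $\mathbb{A}_m(u)$ ($0$ if the family is empty). For the random signal $u=x=(x(t,\omega))_t$ write $\mathbb{A}_m=\mathbb{A}_m(x)$ and $\widehat N_m=\widehat N_m(x)$ (both depend on $\omega$). *)

(* Defs.v *)
From HB Require Import structures.
From mathcomp Require Import all_boot all_order all_algebra finmap.
From mathcomp Require Import complex.
From mathcomp Require Import all_classical all_reals all_analysis.

Set Implicit Arguments.
Unset Strict Implicit.
Unset Printing Implicit Defensive.
Import Order.TTheory GRing.Theory Num.Theory.
Import numFieldNormedType.Exports.

Local Open Scope classical_set_scope.
Local Open Scope complex_scope.
Local Open Scope ring_scope.

(* The index set for m, t, J, j is {1, 2, ...}: sequences are total
   functions on nat and every assumption is restricted to positive indices, so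
   that the values at index 0 play no role. *)

(* Borel sigma-algebra of the complex plane; R[i]^o is R[i] with the topology of
   its norm. *)
HB.instance Definition _ (R : realType) :=
  Measurable.copy R[i] (g_sigma_algebraType (@open R[i]^o)).

Notation normc := ComplexField.Normc.normc.

Section TrigonometricSums.
Context {R : realType}.
Implicit Types (a : nat -> nat -> R) (u : nat -> R[i]).

Definition expi (theta : R) : R[i] := cos theta +i* sin theta.

Definition Arc (theta1 theta2 : R) : set R[i] := expi @` `[theta1, theta2].

(* Ssum a u m theta is S^A_{u,m}(e^{i theta}); in particular S^A_{u,m}(1) is
   Ssum a u m 0. *)
Definition Ssum a u (m : nat) (theta : R) : R[i] :=
  \sum_(1 <= t < m.+1) (a m t)%:C * (u t / t%:R) * expi (t%:R * theta).

Definition Sone a (m : nat) (theta : R) : R[i] := Ssum a (fun=> 1) m theta.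

Definition Linfty_norm (g : R -> R[i]) : \bar R :=
  Lnorm lebesgue_measure +oo%E (fun theta => (normc (g theta))%:E).

Definition sup_Linfty (g : nat -> R -> R[i]) : \bar R :=
  ereal_sup [set Linfty_norm (g m) | m in [set m | (0 < m)%N]].

Definition almost_decreasing a : Prop :=
  exists (f : nat -> R -> R) (b : nat -> R -> R[i]),
    [/\ forall m theta, (0 < m)%N -> Sone a m theta = (f m theta)%:C + b m theta,
        forall m, (0 < m)%N ->
          [/\ forall theta, f m (theta + 2 * pi) = f m theta,
              forall theta, f m (- theta) = f m theta,
              forall theta, 0 <= f m theta &
              forall theta1 theta2, 0 <= theta1 -> theta1 <= theta2 ->
                theta2 <= pi -> f m theta2 <= f m theta1],
        forall m, (0 < m)%N -> measurable_fun setT (b m) &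
        (sup_Linfty b < +oo)%E].

Definition admissible_matrix a : Prop :=
  [/\ forall m, (0 < m)%N -> 0 < a m 1%N <= 1,
      forall m s t, (0 < m)%N -> (0 < s)%N -> (s <= t)%N -> a m t <= a m s,
      forall m t, (0 < t)%N -> (t <= m)%N -> 0 <= a m t,
      forall m t, (0 < m)%N -> (m < t)%N -> a m t = 0 &
      forall t, (0 < t)%N -> a m t @[m --> \oo] --> (1 : R)] /\
  almost_decreasing a.

(* On R[i], x < y means Re x < Re y and Im x = Im y; Sone a m 0 is real. *)
Definition admissible_levels a (H h h' : nat -> R) (J : nat -> nat) : Prop :=
  [/\ (forall m, (0 < m)%N -> (H m)%:C < Sone a m 0) /\ H @ \oo --> +oo,
      h @ \oo --> +oo /\ H m / h m @[m --> \oo] --> +oo,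
      [/\ forall m, (0 < m)%N -> h m <= h' m,
          h' m - h m @[m --> \oo] --> +oo &
          H m / h' m @[m --> \oo] --> +oo] &
      forall m, (0 < m)%N -> (0 < J m)%N /\
        forall theta, - (2 * pi / (J m)%:R) <= theta <= 2 * pi / (J m)%:R ->
          H m <= normc (Sone a m theta)].

Definition grid_angle (J : nat) (j : int) : R := 2 * pi * j%:~R / J%:R.

Definition superlevel_arc a u m (h : R) (J : nat) (B : set R[i]) : Prop :=
  exists j1 j2 : int,
    [/\ j1 <= j2, B = Arc (grid_angle J j1) (grid_angle J j2) &
        forall j : int, j1 <= j <= j2 -> h <= normc (Ssum a u m (grid_angle J j))].

Definition maximal_superlevel_arc a u m (h : R) (J : nat) (B : set R[i]) : Prop :=
  superlevel_arc a u m h J B /\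
  forall B', superlevel_arc a u m h J B' -> B `<=` B' -> B' = B.

Definition arc_family a u (h h' : nat -> R) (J : nat -> nat) (m : nat) :
    set (set R[i]) :=
  [set B | maximal_superlevel_arc a u m (h m) (J m) B /\
           exists B', superlevel_arc a u m (h' m) (J m) B' /\ B' `<=` B].

(* fset_set returns the empty set on infinite sets; the family is always finite
   when J m > 0. *)
Definition Nhat a u h h' J m : nat := #|` fset_set (arc_family a u h h' J m)|.

Definition harmonics N (alpha : 'I_N -> R[i]) (lambda : 'I_N -> R) (t : nat) :
    R[i] :=
  \sum_(n < N) alpha n * expi (- (lambda n * t%:R)).

End TrigonometricSums.

Section Noise.
Context {R : realType} {d : measure_display} {T : measurableType d}.
Variable P : probability T R.
Implicit Types (X : {RV P >-> R[i]}) (eps : nat -> {RV P >-> R[i]}).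

Definition symmetric_rv X : Prop :=
  forall B : set R[i], measurable B ->
    distribution P X B = pushforward P (fun w => - X w : R[i]) B.

Definition mutually_independent eps : Prop :=
  forall (s : {fset nat}) (B : nat -> set R[i]),
    (forall t, t \in s -> (0 < t)%N /\ measurable (B t)) ->
    P (\bigcap_(t in [set` s]) (eps t @^-1` B t)) =
    (\prod_(t <- s) P (eps t @^-1` B t))%E.

Definition identically_distributed eps : Prop :=
  forall s t, (0 < s)%N -> (0 < t)%N -> forall B : set R[i], measurable B ->
    distribution P (eps s) B = distribution P (eps t) B.

Definition iid eps : Prop :=
  mutually_independent eps /\ identically_distributed eps.

Definition zero_mean X : Prop :=
  [/\ P.-integrable setT (fun w => (complex.Re (X w))%:E),
      P.-integrable setT (fun w => (complex.Im (X w))%:E),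
      ('E_P[fun w => complex.Re (X w)] = 0)%E &
      ('E_P[fun w => complex.Im (X w)] = 0)%E].

Definition second_moment X : \bar R := 'E_P[fun w => (normc (X w) ^+ 2)%R]%E.

Definition noise1 eps : Prop :=
  iid eps /\ forall t, (0 < t)%N ->
    zero_mean (eps t) /\
    ('E_P[fun w => (normc (eps t w) * ln (normc (eps t w)))%R] < +oo)%E.

Definition noise2 eps : Prop :=
  iid eps /\ forall t, (0 < t)%N ->
    symmetric_rv (eps t) /\
    ('E_P[fun w => (normc (eps t w) * ln (ln (normc (eps t w) + expR 1)))%R]
      < +oo)%E.

(* The variance of a symmetric square-integrable variable is its second
   moment. *)
Definition independent_symmetric_L2 eps : Prop :=
  mutually_independent eps /\ forall t, (0 < t)%N ->
    symmetric_rv (eps t) /\ (second_moment (eps t) < +oo)%E.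

Definition noise3 eps : Prop :=
  independent_symmetric_L2 eps /\
  exists2 nu : R, nu < 1 &
    (fun t => fine (second_moment (eps t))) =O_\oo
    (fun t => t%:R `^ nu).

Definition tau eps (k : nat) : R :=
  2 `^ (k%:R / 2) *
  Num.sqrt (\sum_(2 ^ (2 ^ k) <= t < 2 ^ (2 ^ k.+1))
              fine (second_moment (eps t.+1)) / t.+1%:R ^+ 2).

Definition noise4 eps : Prop :=
  independent_symmetric_L2 eps /\ (\sum_(1 <= k <oo) (tau eps k)%:E < +oo)%E.

Definition bounded_noise_event (a : nat -> nat -> R) eps : set T :=
  [set w | (sup_Linfty (Ssum a (fun t => eps t w)) < +oo)%E].

Definition signal N (alpha : 'I_N -> R[i]) (lambda : 'I_N -> R) eps (w : T)
    (t : nat) : R[i] :=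
  harmonics alpha lambda t + eps t w.

End Noise.

(* Main.v *)
Require Import Defs.
From HB Require Import structures.
From mathcomp Require Import all_boot all_order all_algebra finmap.
From mathcomp Require Import complex.
From mathcomp Require Import all_classical all_reals all_analysis.
From mathcomp Require Import ess_sup_inf measurable_realfun.
From mathcomp Require Import zify ring lra.
Set Implicit Arguments.
Unset Strict Implicit.
Unset Printing Implicit Defensive.
Import Order.TTheory GRing.Theory Num.Theory.
Import numFieldNormedType.Exports.
Local Open Scope classical_set_scope.
Local Open Scope complex_scope.
Local Open Scope ring_scope.

Import ComplexField.Normc.

(** Write G m theta for the modulus of the kernel [Sone a m theta]. By linearity
    ([SsumD], [Ssum_harmonics]) the sum of the signal is the superposition of N
    translates of the kernel, with amplitudes [alpha n] and centres [lambda n], and of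
    the sum of the noise. The theorem thus has two independent halves: the noise
    contributes a bounded error almost surely, and a bounded error does not disturb
    the superlevel arcs.

    Deterministic half ([superlevel_arcs_detect]). Away from 0 the kernel is bounded
    uniformly in m, by Abel summation against the geometric series
    ([Sone_off_zero]); hence the whole sum is bounded, so below [h m] for large m,
    away from the frequencies, whereas near [lambda n] it differs from
    [alpha n * Sone a m (theta - lambda n)] by a bounded quantity. Since G m is at
    least [H m] within one mesh of the grid and [H m / h' m] tends to infinity, the
    two grid points next to [lambda n] are above [h' m]: there is an arc around each
    frequency, and it shrinks to the frequency because an arc cannot cross a region
    where the sum is bounded ([run_localized]). The arc is the only one of the family
    near [lambda n]: on the way from a grid point above [h' m] towards [lambda n] the
    kernel decreases by at most 2 beta, by the almost decreasing property
    ([almost_decreasing_pointwise]), and [h' m - h m] tends to infinity, so all the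
    grid points on the way are above [h m]. Finally, the kernel has a bounded
    imaginary part and a real part that is bounded below, so a modulus close to its
    maximum, the value at 0, forces a value close to it ([near_one_of_modulus]); this
    yields the amplitudes ([peak_amplitude]).

    Random half ([noise_bounded_waves]). By Abel summation ([Ssum_le_waves]) the
    weights [a m t] may be dropped, and the partial sums of the series of
    [eps t / t * expi (t theta)] have to be bounded uniformly in theta and in their
    length. They are cut at the indices 2 ^ (2 ^ k). On one block, the variables being
    truncated, Chernoff's bound is applied at each point of a polynomially fine grid
    and for each partial sum; the number of these events is exponential in 2 ^ k, as
    is the gain of Chernoff's bound ([block_deviation]). The Borel-Cantelli lemma and
    the summability of the errors over the blocks give [ae_partial_sums_bounded],
    whose hypotheses are a truncation level, bounds on the mean and variance of the
    truncated variables, and the summability of the truncated parts. For the variance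
    conditions the level is chosen from [tau] ([tau_summable_bounded]); for the
    identically distributed ones it is t / 16 ^ k on the block k
    ([iid_truncated_bounded]), and the two moment conditions are what makes the parts
    above this level summable. *)

(** * Complex exponentials and summation by parts *)

Section Complex.
Context {R : realType}.
Implicit Types (z x y : R[i]) (r s t : R).

Lemma normc_ge0 z : 0 <= normc z.
Proof. by case: z => a b; rewrite sqrtr_ge0. Qed.

Lemma normr_normc z : `|z| = (normc z)%:C.
Proof. by case: z => a b; rewrite normc_def. Qed.

Lemma normc_sqrE z : normc z ^+ 2 = complex.Re z ^+ 2 + complex.Im z ^+ 2.
Proof. by case: z => a b; rewrite sqr_sqrtr ?addr_ge0 ?sqr_ge0. Qed.

Lemma normc_real r : normc r%:C = `|r|.
Proof. by rewrite /= expr0n addr0 sqrtr_sqr. Qed.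

Lemma normc_nat n : normc (n%:R : R[i]) = n%:R.
Proof. by rewrite -(rmorph_nat (real_complex R)) normc_real normr_nat. Qed.

Lemma normc_sum (I : Type) (s : seq I) (Q : pred I) (F : I -> R[i]) :
  normc (\sum_(i <- s | Q i) F i) <= \sum_(i <- s | Q i) normc (F i).
Proof.
elim/big_ind2: _ => [|x1 x2 y1 y2 h1 h2|//]; first by rewrite normc0.
by rewrite (le_trans (le_normcD _ _))// lerD.
Qed.

Lemma normc_sub_sym x y : normc (x - y) = normc (y - x).
Proof. by rewrite -normcN opprB. Qed.

Lemma normc_leB x y : normc x - normc y <= normc (x - y).
Proof. by rewrite lerBlDr -[X in normc X <= _](subrK y) le_normcD. Qed.

Lemma abs_Re_le z : `|complex.Re z| <= normc z.
Proof.
by rewrite -(ler_pXn2r (n := 2)) ?nnegrE ?normc_ge0// normc_sqrE real_normK ?num_real// lerDl sqr_ge0.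
Qed.

Lemma abs_Im_le z : `|complex.Im z| <= normc z.
Proof.
by rewrite -(ler_pXn2r (n := 2)) ?nnegrE ?normc_ge0// normc_sqrE real_normK ?num_real// lerDr sqr_ge0.
Qed.

Lemma normc_le_ReIm z : normc z <= `|complex.Re z| + `|complex.Im z|.
Proof.
rewrite -(ler_pXn2r (n := 2)) ?nnegrE ?normc_ge0 ?addr_ge0//.
rewrite normc_sqrE sqrrD !real_normK ?num_real//.
by rewrite lerD2r lerDl mulrn_wge0 ?mulr_ge0.
Qed.

Lemma ReD x y : complex.Re (x + y) = complex.Re x + complex.Re y.
Proof. by case: x; case: y. Qed.

Lemma ImD x y : complex.Im (x + y) = complex.Im x + complex.Im y.
Proof. by case: x; case: y. Qed.

Lemma Re_sum (I : Type) (s : seq I) (Q : pred I) (F : I -> R[i]) :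
  complex.Re (\sum_(i <- s | Q i) F i) = \sum_(i <- s | Q i) complex.Re (F i).
Proof. by elim/big_ind2: _ => // x1 x2 y1 y2 <- <-; rewrite ReD. Qed.

Lemma Im_sum (I : Type) (s : seq I) (Q : pred I) (F : I -> R[i]) :
  complex.Im (\sum_(i <- s | Q i) F i) = \sum_(i <- s | Q i) complex.Im (F i).
Proof. by elim/big_ind2: _ => // x1 x2 y1 y2 <- <-; rewrite ImD. Qed.

Lemma expi0 : expi (0 : R) = 1.
Proof. by rewrite /expi cos0 sin0. Qed.

Lemma expiD r s : expi (r + s) = expi r * expi s.
Proof.
rewrite /expi cosD sinD; apply/eqP; rewrite eq_complex /=.
by rewrite eqxx /= [X in _ == X]addrC eqxx.
Qed.

Lemma normc_expi r : normc (expi r) = 1.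
Proof. by rewrite /expi /= cos2Dsin2 sqrtr1. Qed.

Lemma expi_neq0 r : expi r != 0.
Proof. by apply/eqP => h; move: (normc_expi r); rewrite h normc0 => /eqP; rewrite eq_sym oner_eq0. Qed.

Lemma expiN r : expi (- r) = (expi r)^-1.
Proof. by apply: (mulIf (expi_neq0 r)); rewrite mulVf ?expi_neq0// -expiD addNr expi0. Qed.

Lemma expiMn r n : expi (n%:R * r) = expi r ^+ n.
Proof.
elim: n => [|n IH]; first by rewrite mul0r expi0 expr0.
by rewrite -addn1 natrD mulrDl mul1r expiD IH exprD expr1.
Qed.

Lemma expi2pi : expi (2 * pi : R) = 1.
Proof. by rewrite /expi mulr_natl cos2pi sin2pi. Qed.

Lemma expi_periodic r (k : int) : expi (r + 2 * pi * k%:~R) = expi r.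
Proof.
suff e1 : expi (2 * pi * k%:~R : R) = 1 by rewrite expiD e1 mulr1.
case: k => n; first by rewrite mulrC expiMn expi2pi expr1n.
by rewrite NegzE mulrNz mulrN expiN mulrC expiMn expi2pi expr1n invr1.
Qed.

Lemma angle_reduce r : exists k : int, - pi <= r - 2 * pi * k%:~R < pi.
Proof.
pose k := Num.floor ((r + pi) / (2 * pi)).
have p0 : 0 < 2 * pi :> R by rewrite mulr_gt0 ?pi_gt0.
have /andP[k1 k2] : k%:~R <= (r + pi) / (2 * pi) < (k + 1)%:~R.
  by rewrite floor_le floorD1_gt.
exists k; apply/andP; split.
  by move: k1; rewrite ler_pdivlMr//; lra.
by move: k2; rewrite ltr_pdivrMr// intrD; lra.
Qed.

(** Lifting an equality on the circle to the line: after reducing the difference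
    of the arguments to [-pi, pi], the cosine equals 1 only at 0. *)
Lemma expi_inj r s : expi r = expi s -> exists k : int, r = s + 2 * pi * k%:~R.
Proof.
move=> rs; have [k /andP[u1 u2]] := angle_reduce (r - s).
exists k; pose u := r - s - 2 * pi * k%:~R.
have : expi u = 1.
  rewrite /u -mulrN -mulrNz expi_periodic.
  by rewrite expiD rs -expiD subrr expi0.
move=> /(congr1 (@complex.Re R)) /= cu.
have /normr0_eq0 : `|u| = 0.
  apply: cos_inj; rewrite ?in_itv /= ?lexx ?pi_ge0 ?normr_ge0 ?ler_norml ?u1 ?(ltW u2)//.
  by rewrite cos_norm cu cos0.
by rewrite /u; lra.
Qed.

Lemma derivable_lipschitz1 (f f' : R -> R) r s :
  (forall u : R, is_derive u (1 : R) f (f' u)) -> (forall u, `|f' u| <= 1) ->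
  `|f r - f s| <= `|r - s|.
Proof.
move=> fd f1; wlog sr : r s / s <= r.
  by move=> h; case/orP: (le_total s r) => /h//; rewrite distrC [X in _ <= X]distrC.
have fc : {within `[s, r], continuous f}.
  apply: continuous_subspaceT => u; apply: differentiable_continuous.
  by apply/derivable1_diffP; have [] := fd u.
have [c _ ->] := MVT_segment sr (fun u _ => fd u) fc.
by rewrite normrM ler_piMl ?f1.
Qed.

Lemma expi_lipschitz r s : normc (expi r - expi s) <= 2 * `|r - s|.
Proof.
rewrite (le_trans (normc_le_ReIm _))//= mulr2n mulrDl mul1r lerD//.
  apply: (derivable_lipschitz1 (f := cos) (f' := fun u => - sin u)) => u; by rewrite normrN sin_max.
apply: (derivable_lipschitz1 (f := sin) (f' := fun u => cos u)) => u; exact: cos_max.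
Qed.

Lemma expi_conj r : expi (- r) = (expi r)^*%C.
Proof. by rewrite /expi cosN sinN. Qed.

End Complex.

Section SummationByParts.
Context {R : realType}.

(** Abel summation: the weighted sum is a combination of the partial sums with the
    nonnegative coefficients [v t - v t.+1] and [v m], whose total is [v 1]. *)
Lemma abel_bound (v : nat -> R) (e : nat -> R[i]) (K : R) m :
  (forall t, (0 < t)%N -> (t <= m)%N -> 0 <= v t) ->
  (forall s t, (0 < s)%N -> (s <= t)%N -> (t <= m)%N -> v t <= v s) ->
  (forall n, normc (\sum_(1 <= t < n.+1) e t) <= K) ->
  (0 < m)%N ->
  normc (\sum_(1 <= t < m.+1) (v t)%:C * e t) <= v 1%N * K.
Proof.
move=> v0 vd eK m0.
pose E n := \sum_(1 <= t < n.+1) e t.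
have ES n : E n.+1 = E n + e n.+1 by rewrite /E big_nat_recr.
have E0 : E 0%N = 0 by rewrite /E big_geq.
have key n : (0 < n)%N -> \sum_(1 <= t < n.+1) (v t)%:C * e t =
    (v n)%:C * E n + \sum_(1 <= t < n) (v t - v t.+1)%:C * E t.
  elim: n => // -[|n] IH _.
    by rewrite big_nat1 [in RHS]big_geq// addr0 ES E0 add0r.
  rewrite big_nat_recr//= IH// [in RHS]big_nat_recr//= [in RHS]ES.
  rewrite rmorphB /= mulrBl mulrDr; ring.
rewrite key//.
apply: (@le_trans _ _ (v m * K + \sum_(1 <= t < m) (v t - v t.+1) * K)).
  rewrite (le_trans (le_normcD _ _))// lerD//.
    have vm := v0 _ m0 (leqnn m).
    by rewrite normcM normc_real ger0_norm// ler_wpM2l//; exact: eK.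
  rewrite (le_trans (normc_sum _ _ _))// big_nat [leRHS]big_nat.
  apply: ler_sum => t /andP[t0 tm].
  have d0 : 0 <= v t - v t.+1 by rewrite subr_ge0 vd.
  by rewrite normcM normc_real ger0_norm// ler_wpM2l//; exact: eK.
rewrite -mulr_suml -mulrDl.
have -> : \sum_(1 <= t < m) (v t - v t.+1) = v 1%N - v m.
  under eq_bigr do rewrite -[v _ - _]opprB.
  by rewrite sumrN telescope_sumr// opprB.
by rewrite addrC subrK.
Qed.

End SummationByParts.

(** * Weighted trigonometric sums *)

Section Trigonometric_sums.
Context {R : realType}.
Implicit Types (a : nat -> nat -> R) (u v : nat -> R[i]) (m : nat) (theta : R).

Lemma SsumD a u v m theta :
  Ssum a (fun t => u t + v t) m theta = Ssum a u m theta + Ssum a v m theta.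
Proof.
rewrite /Ssum -big_split /=; apply: eq_bigr => t _.
by rewrite mulrDl mulrDr mulrDl.
Qed.

(** A harmonic translates the kernel: this is why the sum of the signal peaks at its
    frequencies. *)
Lemma Ssum_harmonics a N (alpha : 'I_N -> R[i]) (lambda : 'I_N -> R) m theta :
  Ssum a (harmonics alpha lambda) m theta =
  \sum_(n < N) alpha n * Sone a m (theta - lambda n).
Proof.
under [RHS]eq_bigr do rewrite /Sone /Ssum mulr_sumr.
rewrite exchange_big /=; apply: eq_bigr => t _.
rewrite /harmonics mulr_suml mulr_sumr mulr_suml; apply: eq_bigr => n _.
rewrite mulrBr expiD [lambda n * _]mulrC; ring.
Qed.

Lemma Ssum_periodic a u m theta (k : int) :
  Ssum a u m (theta + 2 * pi * k%:~R) = Ssum a u m theta.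
Proof.
apply: eq_bigr => t _; rewrite mulrDr.
have -> : t%:R * (2 * pi * k%:~R) = 2 * pi * (t%:Z * k)%:~R :> R.
  by rewrite intrM; ring.
by rewrite expi_periodic.
Qed.

Lemma Sone_opp a m theta : Sone a m (- theta) = (Sone a m theta)^*%C.
Proof.
rewrite /Sone /Ssum (big_morph _ (rmorphD (@conjc R)) (rmorph0 _)).
apply: eq_bigr => t _; rewrite mulrN expi_conj !(rmorphM (@conjc R)).
congr (_ * _ * _); first exact/esym/conjc_real.
by congr (_ * _); [exact/esym/conjc1|rewrite [RHS]conjc_inv conjc_nat].
Qed.

Lemma normc_conj (z : R[i]) : normc z^*%C = normc z.
Proof. by case: z => x y; rewrite /= sqrrN. Qed.

Lemma normc_Sone_abs a m theta : normc (Sone a m `|theta|) = normc (Sone a m theta).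
Proof. by case: ger0P => // _; rewrite Sone_opp normc_conj. Qed.

Lemma Ssum_lipschitz a u m : exists2 L : R, 0 <= L & forall theta theta',
  normc (Ssum a u m theta - Ssum a u m theta') <= L * `|theta - theta'|.
Proof.
exists (\sum_(1 <= t < m.+1) normc ((a m t)%:C * (u t / t%:R)) * (2 * t%:R)).
  by apply: sumr_ge0 => t _; rewrite !mulr_ge0 ?normc_ge0.
move=> x y; rewrite -sumrB mulr_suml (le_trans (normc_sum _ _ _))//.
apply: ler_sum => t _; rewrite -mulrBr normcM -!mulrA.
rewrite ler_wpM2l ?normc_ge0//.
rewrite (le_trans (expi_lipschitz _ _))// -mulrBr normrM normr_nat; exact: lexx.
Qed.

Lemma Sone0 a m : Sone a m 0 = (\sum_(1 <= t < m.+1) a m t / t%:R)%:C.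
Proof.
rewrite /Sone /Ssum rmorph_sum /=; apply: eq_bigr => t _.
by rewrite mulr0 expi0 mulr1 mul1r rmorphM fmorphV rmorph_nat.
Qed.

End Trigonometric_sums.

Section Essential_bounds.
Context {R : realType}.

Lemma ae_lebesgue_dense (Q : R -> Prop) (x e : R) :
  (\forall y \ae lebesgue_measure, Q y) -> 0 < e -> exists2 y, x < y < x + e & Q y.
Proof.
move=> [A [mA A0 QA]] e0; apply/not_exists2P => h.
have xA : `]x, x + e[%classic `<=` A.
  move=> y /=; rewrite in_itv /= => yx; apply: QA => /= Qy.
  by case: (h y) => // /(_ Qy).
have : (lebesgue_measure `]x, (x + e)%R[%classic <= lebesgue_measure A)%E.
  by apply: le_measure; rewrite ?inE.
rewrite lebesgue_measure_itv /= lte_fin ltrDl e0 A0 -EFinB lee_fin; lra.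
Qed.

Lemma lebesgue_setT_gt0 : (0 < @lebesgue_measure R setT)%E.
Proof.
apply: (@lt_le_trans _ _ (lebesgue_measure (`]0%R, 1%R[%classic : set R))).
  by rewrite lebesgue_measure_itv /= lte_fin ltr01 sube0 lte_fin ltr01.
by apply: le_measure; rewrite ?inE.
Qed.

Lemma sup_Linfty_bound (g : nat -> R -> R[i]) : (sup_Linfty g < +oo)%E ->
  exists2 C : R, 0 <= C & forall m, (0 < m)%N ->
    \forall theta \ae lebesgue_measure, normc (g m theta) <= C.
Proof.
move=> gf.
have g0 : (0 <= sup_Linfty g)%E.
  apply: (@le_trans _ _ (Linfty_norm (g 1%N))); first exact: Lnorm_ge0.
  by apply: ereal_sup_ubound; exists 1%N.
have gfin : sup_Linfty g \is a fin_num by rewrite ge0_fin_numE.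
exists (fine (sup_Linfty g)); first by rewrite fine_ge0.
move=> m m0.
have := @ess_sup_ge _ _ _ (@lebesgue_measure R) (abse \o (fun theta => (normc (g m theta))%:E)).
apply: filterS => x /= hx; rewrite -lee_fin fineK//.
have -> : (normc (g m x))%:E = `|(normc (g m x))%:E|%E by rewrite abse_EFin ger0_norm// normc_ge0.
rewrite (le_trans hx)//.
have -> : ess_sup lebesgue_measure (abse \o (fun theta => (normc (g m theta))%:E)) = Linfty_norm (g m).
  by rewrite /Linfty_norm unlock ifT// lebesgue_setT_gt0.
by apply: ereal_sup_ubound; exists m.
Qed.

(** Essential bounds on trigonometric sums are bounds everywhere, by
    continuity. *)
Lemma sup_Linfty_Ssum_bound (a : nat -> nat -> R) (u : nat -> R[i]) :
  (sup_Linfty (Ssum a u) < +oo)%E ->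
  exists2 C : R, 0 <= C & forall m theta, (0 < m)%N -> normc (Ssum a u m theta) <= C.
Proof.
move=> /sup_Linfty_bound[C C0 hC]; exists C => // m theta m0.
apply/ler_addgt0Pr => e e0.
have [L L0 hL] := Ssum_lipschitz a u m.
have L1 : 0 < L + 1 by lra.
have [y /andP[y1 y2] hy] := ae_lebesgue_dense theta (hC m m0) (divr_gt0 e0 L1).
rewrite -[Ssum a u m theta](subrK (Ssum a u m y)) addrC (le_trans (le_normcD _ _))// lerD//.
rewrite (le_trans (hL _ _))// distrC ger0_norm; last by lra.
apply: (@le_trans _ _ ((L + 1) * (e / (L + 1)))); last by rewrite mulrC divfK// gt_eqF.
by apply: ler_pM; lra.
Qed.

End Essential_bounds.

(** * Bounds on the kernel *)

Section Kernel.
Context {R : realType}.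
Variable a : nat -> nat -> R.
Hypothesis a_adm : admissible_matrix a.

Definition Sone0r m : R := \sum_(1 <= t < m.+1) a m t / t%:R.

Lemma Sone0E m : Sone a m 0 = (Sone0r m)%:C. Proof. exact: Sone0. Qed.

Lemma normc_Sone_le m theta : (0 < m)%N -> normc (Sone a m theta) <= Sone0r m.
Proof.
move=> m0; have [[_ _ a0 _ _] _] := a_adm.
rewrite (le_trans (normc_sum _ _ _))// /Sone0r big_nat [leRHS]big_nat.
apply: ler_sum => t /andP[t0 tm].
rewrite !normcM normc_expi mulr1 normc_real ger0_norm ?a0// normc1 mul1r normcV.
by rewrite normc_nat.
Qed.

(** Away from 0 the kernels are bounded uniformly in m: the weights a m t / t are
    nonincreasing and the partial sums of the geometric series are bounded. *)
Lemma Sone_off_zero (delta : R) : 0 < delta <= pi -> exists2 C : R, 0 <= C &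
  forall m theta, (0 < m)%N -> delta <= `|theta| <= pi -> normc (Sone a m theta) <= C.
Proof.
move=> /andP[d0 dpi]; have [[a1 ad a0 _ _] _] := a_adm.
have cd : cos delta < 1.
  by rewrite -[X in _ < X]cos0 ltr_cos ?in_itv /= ?lexx ?pi_ge0 ?dpi ?ltW.
have c0 : 0 < 1 - cos delta by lra.
exists (2 / (1 - cos delta)); first by rewrite divr_ge0// ltW.
move=> m theta m0 /andP[t1 t2]; rewrite -normc_Sone_abs.
move: t1 t2; set x := `|theta| => x1 x2.
have x0 : 0 <= x by exact: normr_ge0.
have cx : cos x <= cos delta.
  by rewrite leNgt ltr_cos ?in_itv /= ?x0 ?x2 ?dpi ?(ltW d0)// -leNgt.
have n1 : 1 - cos delta <= normc (1 - expi x).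
  apply: le_trans (abs_Re_le _); rewrite /= ger0_norm; last by rewrite subr_ge0 cos_le1.
  by rewrite lerD2l lerN2.
have n0 : 0 < normc (1 - expi x) by apply: lt_le_trans n1.
have -> : Sone a m x = \sum_(1 <= t < m.+1) (a m t / t%:R)%:C * expi (t%:R * x).
  apply: eq_bigr => t _; rewrite mul1r; congr (_ * _).
  by rewrite rmorphM fmorphV rmorph_nat.
apply: (@le_trans _ _ (a m 1%N / 1%:R * (2 / (1 - cos delta)))); last first.
  have /andP[_ a11] := a1 _ m0.
  by rewrite ler_piMl ?divr1// divr_ge0// ltW.
apply: (abel_bound (v := fun t => a m t / t%:R)) => //.
- by move=> t t0 tm; rewrite divr_ge0 ?a0.
- move=> s t s0 st tm; apply: ler_pM; rewrite ?invr_ge0 ?a0 ?ad ?(leq_trans s0 st)//.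
  by rewrite lef_pV2 ?posrE ?ltr0n ?(leq_trans s0 st)// ler_nat.
move=> n.
have geo : (1 - expi x) * (\sum_(1 <= t < n.+1) expi (t%:R * x)) = expi x - expi (n.+1%:R * x).
  elim: n => [|n IH]; first by rewrite big_geq// mulr0 mul1r subrr.
  by rewrite big_nat_recr//= mulrDr IH [in RHS](expiMn _ n.+2) !expiMn [in RHS]exprS; ring.
rewrite ler_pdivlMr// mulrC (le_trans (ler_wpM2r (normc_ge0 _) n1))// -normcM geo.
by rewrite (le_trans (le_normcD _ _))// normcN !normc_expi.
Qed.

(** The pointwise content of the almost decreasing property: outside a null set
    the kernel is within beta of a nonincreasing nonnegative function, and the
    continuity of the kernel removes the exceptional set. *)
Lemma almost_decreasing_pointwise : exists2 beta : R, 0 <= beta &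
  forall m, (0 < m)%N ->
   [/\ forall theta1 theta2, 0 <= theta1 -> theta1 <= theta2 -> theta2 <= pi ->
         normc (Sone a m theta2) <= normc (Sone a m theta1) + 2 * beta,
       forall theta, `|complex.Im (Sone a m theta)| <= beta &
       forall theta, - beta <= complex.Re (Sone a m theta)].
Proof.
have [_ [f [b [fb fP bm /sup_Linfty_bound[beta b0 hb]]]]] := a_adm.
exists beta => // m m0; have {hb} hb := hb m m0.
have [fper feven f0 fd] := fP m m0.
have [L L0 hL] := Ssum_lipschitz a (fun=> 1) m; rewrite -/(Sone a m) in hL.
have appr (x e : R) : 0 < e -> exists2 y, x < y < x + e &
    normc (Sone a m x - Sone a m y) <= L * e /\ normc (b m y) <= beta.
  move=> e0; have [y /andP[y1 y2] yb] := ae_lebesgue_dense x hb e0.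
  exists y; rewrite ?y1//; split=> //; rewrite (le_trans (hL _ _))//.
  by rewrite ler_wpM2l// distrC ger0_norm; lra.
have Lpos : 0 < L + 1 by lra.
have small e : 0 < e -> 0 < e / (L + 1) /\ L * (e / (L + 1)) <= e.
  move=> e0; split; first exact: divr_gt0.
  by rewrite mulrA ler_pdivrMr// [L * e]mulrC ler_wpM2l ?(ltW e0)// lerDl.
split.
- move=> x y x0; rewrite le_eqVlt => /predU1P[<- _|xy ypi]; first lra.
  apply/ler_addgt0Pr => e e0.
  have [eL1 eL2] := small _ (divr_gt0 e0 (@ltr0Sn R 1)).
  set e' := e / 2 / (L + 1) in eL1 eL2.
  pose eta := Num.min e' ((y - x) / 2).
  have eta0 : 0 < eta by rewrite lt_min eL1 /=; lra.
  have eta1 : eta <= e' by rewrite ge_min lexx.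
  have eta2 : eta <= (y - x) / 2 by rewrite ge_min lexx orbT.
  have Leta : L * eta <= e / 2 by apply: le_trans eL2; rewrite ler_wpM2l.
  have [x' /andP[x'1 x'2] [hx bx]] := appr x eta eta0.
  have [y' /andP[y'1 y'2] yb] := ae_lebesgue_dense (y - eta) hb eta0.
  have hy : normc (Sone a m y - Sone a m y') <= L * eta.
    rewrite (le_trans (hL _ _))// ler_wpM2l// ger0_norm; lra.
  have fxy : f m y' <= f m x' by apply: fd; lra.
  have h1 : normc (Sone a m y) <= normc (Sone a m y') + e / 2.
    by move: (normc_leB (Sone a m y) (Sone a m y')); lra.
  have h2 : normc (Sone a m x') <= normc (Sone a m x) + e / 2.
    by move: (normc_leB (Sone a m x') (Sone a m x)); rewrite normc_sub_sym; lra.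
  have h3 : normc (Sone a m y') <= f m y' + beta.
    rewrite fb// (le_trans (le_normcD _ _))// lerD//.
    by rewrite normc_real ger0_norm.
  have h4 : f m x' <= normc (Sone a m x') + beta.
    have -> : f m x' = normc (Sone a m x' - b m x').
      by rewrite fb// addrK normc_real ger0_norm.
    by rewrite (le_trans (le_normcD _ _))// normcN lerD2l.
  lra.
- move=> x; apply/ler_addgt0Pr => e /small[e1 e2].
  have [y _ [hy yb]] := appr x _ e1.
  rewrite -[Sone a m x](subrK (Sone a m y)) ImD addrC (le_trans (ler_normD _ _))// lerD//.
    by rewrite fb//= ImD /= add0r (le_trans (abs_Im_le _)).
  by rewrite (le_trans (abs_Im_le _))// (le_trans hy).
- move=> x; apply/ler_addgt0Pr => e /small[e1 e2].
  have [y _ [hy yb]] := appr x _ e1.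
  have := le_trans (abs_Re_le _) hy; rewrite ler_norml => /andP[g1 _].
  have := le_trans (abs_Re_le _) yb; rewrite ler_norml => /andP[g2 _].
  have g3 : complex.Re (Sone a m y) = f m y + complex.Re (b m y) by rewrite fb// ReD.
  have := f0 y.
  move: g1; rewrite ReD -[complex.Re (- _)]/(complex.Re (- Sone a m y)).
  have -> : complex.Re (- Sone a m y) = - complex.Re (Sone a m y) by case: (Sone a m y).
  lra.
Qed.

End Kernel.

(** * Grid indices, runs and arcs *)

Section Finite_families.
Context {R : realType}.

Lemma finite_min_gt0 (I : finType) (f : I -> R) : (forall i, 0 < f i) ->
  exists2 e, 0 < e & forall i, e <= f i.
Proof.
move=> f0; exists (\big[Order.min/1]_i f i); first exact: lt_bigmin.
by move=> i; exact: bigmin_le_cond.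
Qed.

End Finite_families.

Section Runs.

(** Runs live on the integers and not on the circle, so that the discrete
    intermediate value arguments are linear arithmetic; going around the circle is a
    shift of the index by a multiple of the size of the grid ([Arc_shift]). *)
Definition is_run (Q : int -> Prop) (p q j : int) : Prop :=
  [/\ p <= j <= q, forall i, p <= i <= q -> Q i, ~ Q (p - 1) & ~ Q (q + 1)].

Lemma run_down (Q : int -> Prop) (i j : int) : Q j -> ~ Q i -> i < j ->
  exists p, [/\ p <= j, forall l, p <= l <= j -> Q l & ~ Q (p - 1)].
Proof.
move=> Qj Qi ij.
have [n nE] : exists n : nat, j = i + n.+1%:Z by exists (absz (j - i - 1)%R); lia.
elim: n j Qj nE {ij} => [|n IH] j Qj nE.
  exists j; split; rewrite ?lexx//.
    by move=> l lj; have -> : l = j by lia.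
  by have -> : j - 1 = i by lia.
have [Qj1|Qj1] := pselect (Q (j - 1)); last first.
  exists j; split; rewrite ?lexx//.
  by move=> l lj; have -> : l = j by lia.
have [p [p1 p2 p3]] := IH (j - 1) Qj1 (ltac:(lia)).
exists p; split => //; first lia.
move=> l lj; have [->//|lj1] := eqVneq l j.
by apply: p2; lia.
Qed.

Lemma run_exists (Q : int -> Prop) (i1 i2 j : int) :
  Q j -> ~ Q i1 -> i1 < j -> ~ Q i2 -> j < i2 -> exists p q, is_run Q p q j.
Proof.
move=> Qj Q1 j1 Q2 j2.
have [p [p1 p2 p3]] := run_down Qj Q1 j1.
have [|||q [q1 q2 q3]] := @run_down (fun l => Q (- l)) (- i2) (- j).
- by rewrite opprK.
- by rewrite opprK.
- by lia.
exists p, (- q); split.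
- by lia.
- move=> l l12; have [lj|lj] := leP l j; first by apply: p2; lia.
  by have := q2 (- l); rewrite opprK; apply; lia.
- by [].
- by move: q3; rewrite opprB addrC.
Qed.

Lemma run_absorbs (Q : int -> Prop) (p q j i1 i2 i : int) : is_run Q p q j ->
  i1 <= i <= i2 -> p <= i <= q -> (forall l, i1 <= l <= i2 -> Q l) ->
  p <= i1 /\ i2 <= q.
Proof.
move=> [_ _ Qp Qq] i12 ipq hQ; split; rewrite leNgt; apply/negP => h.
  by apply: Qp; apply: hQ; lia.
by apply: Qq; apply: hQ; lia.
Qed.

Lemma run_in (Q : int -> Prop) (p q j i : int) : is_run Q p q j -> 
  (forall l, (i <= l <= j) || (j <= l <= i) -> Q l) -> p <= i <= q.
Proof.
move=> pq hQ; have [pj _ _ _] := pq.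
have [ij|ij] := leP i j.
  have [] := run_absorbs (i1 := i) (i2 := j) (i := j) pq _ pj; [lia| |lia].
  by move=> l lj; apply: hQ; rewrite lj.
have [] := run_absorbs (i1 := j) (i2 := i) (i := j) pq _ pj; [lia| |lia].
by move=> l lj; apply: hQ; rewrite lj orbT.
Qed.

Lemma run_avoids (Q : int -> Prop) (p q j i : int) : is_run Q p q j -> ~ Q i ->
  (i < j -> i < p) /\ (j < i -> q < i).
Proof.
move=> [pj hQ _ _] Qi; split=> ij; rewrite ltNge; apply/negP => h;
  by apply: Qi; apply: hQ; lia.
Qed.

End Runs.

Section Grid.
Context {R : realType}.
Variables (J : nat) (J0 : (0 < J)%N).
Local Notation eta := (2 * pi / J%:R : R).
Local Notation grid := (@grid_angle R J).

Lemma mesh_gt0 : 0 < eta.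
Proof. by rewrite divr_gt0 ?mulr_gt0 ?pi_gt0 ?ltr0n. Qed.

Lemma gridE j : grid j = eta * j%:~R.
Proof. by rewrite /grid_angle mulrAC. Qed.

Lemma grid_le i j : (grid i <= grid j) = (i <= j).
Proof. by rewrite !gridE ler_pM2l ?mesh_gt0// ler_int. Qed.

Lemma grid_shift j l : grid (j + l * J%:Z) = grid j + 2 * pi * l%:~R.
Proof.
rewrite !gridE intrD intrM mulrDr; congr (_ + _).
have JJ : J%:R != 0 :> R by rewrite pnatr_eq0 -lt0n.
by field.
Qed.

Lemma grid_floor x : exists j, grid j <= x < grid (j + 1).
Proof.
exists (Num.floor (x / eta)); rewrite !gridE mulrC -ler_pdivlMr ?mesh_gt0//.
by rewrite floor_le /= mulrC -ltr_pdivrMr ?mesh_gt0// floorD1_gt.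
Qed.

Lemma grid_cell_dist x j : grid j <= x < grid (j + 1) ->
  `|grid j - x| <= eta /\ `|grid (j + 1) - x| <= eta.
Proof.
rewrite [grid (j + 1)]gridE intrD mulrDr mulr1 -gridE => /andP[h1 h2].
rewrite ler0_norm ?subr_le0// ger0_norm; last by rewrite subr_ge0 ltW.
by split; lra.
Qed.

Lemma gridS j : grid (j + 1) = grid j + eta.
Proof. by rewrite !gridE intrD mulrDr mulr1. Qed.

Lemma Arc_sub (i1 i2 p q : int) : p <= i1 -> i2 <= q ->
  Arc (grid i1) (grid i2) `<=` Arc (grid p) (grid q).
Proof.
move=> pi qi z [x xi <-]; exists x => //; move: xi; rewrite /= !in_itv /=.
by move=> /andP[x1 x2]; rewrite (le_trans _ x1) ?(le_trans x2)// grid_le.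
Qed.

Lemma Arc_shift_sub (i1 i2 l : int) :
  Arc (grid i1) (grid i2) `<=` Arc (grid (i1 + l * J%:Z)) (grid (i2 + l * J%:Z)).
Proof.
move=> z [x xi <-]; exists (x + 2 * pi * l%:~R); last by rewrite expi_periodic.
by move: xi; rewrite /= !in_itv /= !grid_shift !lerD2r.
Qed.

Lemma Arc_shift (i1 i2 l : int) :
  Arc (grid i1) (grid i2) = Arc (grid (i1 + l * J%:Z)) (grid (i2 + l * J%:Z)).
Proof.
apply/seteqP; split; first exact: Arc_shift_sub.
apply: (subset_trans (@Arc_shift_sub _ _ (- l))).
by rewrite !mulNr !addrK.
Qed.

Lemma Arc_grid_mem (i1 i2 j : int) : i1 <= j <= i2 -> Arc (grid i1) (grid i2) (expi (grid j)).
Proof. by move=> ij; exists (grid j) => //; rewrite /= in_itv /= !grid_le. Qed.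

(** A point of the circle determines its angle, hence the index of a grid point,
    only up to whole turns. *)
Lemma Arc_grid_index (i1 i2 j : int) : Arc (grid i1) (grid i2) (expi (grid j)) ->
  exists l : int, i1 <= j + l * J%:Z <= i2.
Proof.
move=> [x xi /expi_inj[l xE]]; exists l.
by move: xi; rewrite /= in_itv /= xE -grid_shift !grid_le.
Qed.

End Grid.

Section Circle_distance.
Context {R : realType}.

Definition near_mod (delta x y : R) : Prop :=
  exists k : int, `|x - y - 2 * pi * k%:~R| < delta.

Lemma near_mod_trans d1 d2 x y z :
  near_mod d1 x y -> near_mod d2 x z -> near_mod (d1 + d2) y z.
Proof.
move=> [k hk] [l hl]; exists (l - k).
have -> : y - z - 2 * pi * (l - k)%:~R =
    (x - z - 2 * pi * l%:~R) - (x - y - 2 * pi * k%:~R) by rewrite intrB; ring.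
by rewrite (le_lt_trans (ler_normB _ _))// addrC ltrD.
Qed.

Lemma near_mod_le d1 d2 x y : d1 <= d2 -> near_mod d1 x y -> near_mod d2 x y.
Proof. by move=> d12 [k hk]; exists k; apply: lt_le_trans d12. Qed.

(** At scales at most 1 the other representatives of the angle, at distance at least
    2 pi, cannot interfere. *)
Lemma near_mod_annulus d x y : 0 < d -> d <= 1 -> d <= `|x - y| -> `|x - y| < 2 * d ->
  ~ near_mod d x y.
Proof.
move=> d0 d1 h1 h2 [k]; have p2 := pi_ge2 R.
have [->|k0] := eqVneq k 0; first by rewrite mulr0 subr0 ltNge h1.
have : 4 <= `|2 * pi * k%:~R : R|.
  rewrite normrM ger0_norm ?mulr_ge0 ?pi_ge0//.
  have k1 : 1 <= `|k%:~R : R| by rewrite -intr_norm ler1z; lia.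
  have := ler_wpM2l (mulr_ge0 (ler0n R 2) (pi_ge0 R)) k1; lra.
have := ler_normB (x - y) (x - y - 2 * pi * k%:~R); rewrite opprB addrC subrK.
lra.
Qed.

(** In [-pi, pi) two distinct frequencies differ by neither 0 nor 2 pi, and there are
    finitely many pairs. *)
Lemma separated_frequencies N (lambda : 'I_N -> R) :
  (forall n, - pi <= lambda n < pi) -> injective lambda ->
  exists2 d, 0 < d & forall n k, near_mod d (lambda n) (lambda k) -> n = k.
Proof.
move=> lr li; have pi0 := pi_gt0 R.
pose f (nk : 'I_N * 'I_N) := if nk.1 == nk.2 then 1 else
  Num.min `|lambda nk.1 - lambda nk.2| (2 * pi - `|lambda nk.1 - lambda nk.2|).
have lam2 n k : `|lambda n - lambda k| < 2 * pi.
  by move: (lr n) (lr k) => /andP[? ?] /andP[? ?]; rewrite ltr_norml; lra.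
have [[n k]|d d0 hd] := @finite_min_gt0 R _ f.
  rewrite /f /=; case: eqP => // nk; rewrite lt_min subr_gt0 lam2 andbT normr_gt0.
  by rewrite subr_eq0; apply/eqP => /li.
exists d => // n k [l hl]; apply/eqP; apply: contraT => nk.
have := hd (n, k); rewrite /f /= (negbTE nk) le_min => /andP[h1 h2].
have [l0|l0] := eqVneq l 0.
  by move: hl; rewrite l0 mulr0 subr0 ltNge h1.
have h3 : 2 * pi <= `|2 * pi * l%:~R : R|.
  rewrite normrM ger0_norm ?mulr_ge0 ?pi_ge0//.
  by rewrite ler_peMr ?mulr_ge0 ?pi_ge0// -intr_norm ler1z; lia.
have := ler_normB (lambda n - lambda k) (lambda n - lambda k - 2 * pi * l%:~R).
rewrite opprB addrC subrK; lra.
Qed.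

End Circle_distance.

(** * Superlevel arcs around the frequencies *)

Section Complex_estimates.
Context {R : realType}.

Lemma gt0_complex (e : R[i]) : 0 < e -> exists2 r : R, 0 < r & e = r%:C.
Proof.
case: e => x y; rewrite ltcE /= => /andP[/eqP -> x0]; by exists x.
Qed.

Lemma cvg_normc (f : nat -> R[i]) (l : R[i]) :
  (forall r : R, 0 < r -> \forall m \near \oo, normc (l - f m) <= r) ->
  (f m : R[i]^o) @[m --> \oo] --> (l : R[i]^o).
Proof.
move=> fl; apply/cvgrPdist_le => e /gt0_complex[r r0 ->].
by apply: filterS (fl r r0) => m; rewrite normr_normc lecR.
Qed.

Lemma normc_cvg (f : nat -> R[i]) (l : R[i]) :
  (f m : R[i]^o) @[m --> \oo] --> (l : R[i]^o) ->
  forall r : R, 0 < r -> \forall m \near \oo, normc (l - f m) <= r.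
Proof.
move=> /cvgrPdist_le fl r r0; have := fl r%:C; rewrite ltcR => /(_ r0).
by apply: filterS => m; rewrite normr_normc lecR.
Qed.

(** A number whose imaginary part is small and whose real part is hardly negative is
    close to its modulus. *)
Lemma near_one_of_modulus (z : R[i]) (k beta c : R) : 0 <= beta ->
  `|complex.Im z| <= beta -> - beta <= complex.Re z -> normc z <= k -> k - c <= normc z ->
  normc (z - k%:C) <= c + 4 * beta.
Proof.
move=> b0 hI hR zk kz.
rewrite (le_trans (normc_le_ReIm _))//.
have -> : complex.Re (z - k%:C) = complex.Re z - k by case: z {hI hR zk kz}.
have -> : complex.Im (z - k%:C) = complex.Im z by case: z {hI hR zk kz} => x y /=; rewrite subr0.
have h1 := abs_Re_le z; have h2 := normc_le_ReIm z.
have h3 : complex.Re z <= normc z by apply: le_trans h1; exact: ler_norm.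
have h4 : `|complex.Re z| - 2 * beta <= complex.Re z.
  by case: (ger0P (complex.Re z)); lra.
rewrite ler0_norm; lra.
Qed.

(** Here x is the maximizer and y a grid point next to the frequency, where the
    kernel gy is known to be close to its peak value k. As the sample is the amplitude
    times the kernel up to C, a larger sample at x forces a kernel gx that is almost as
    large, hence close to k. *)
Lemma peak_amplitude (A Sx Sy gx gy : R[i]) (k c beta C : R) : A != 0 -> 0 <= beta ->
  `|complex.Im gx| <= beta -> - beta <= complex.Re gx -> normc gx <= k ->
  k - c <= normc gy -> normc (Sx - A * gx) <= C -> normc (Sy - A * gy) <= C ->
  normc Sy <= normc Sx -> normc (A * k%:C - Sx) <= 3 * C + normc A * (c + 4 * beta).
Proof.
move=> A0 b0 Im_gx Re_gx gxk gyk hx hy yx.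
have al0 : 0 < normc A.
  by rewrite lt_neqAle normc_ge0 andbT eq_sym; apply: contraNneq A0 => /eq0_normc ->.
have gyx : normc A * (normc gy - 2 * C / normc A) <= normc A * normc gx.
  rewrite mulrBr mulrCA mulfV ?gt_eqF// mulr1.
  have := normc_leB Sx (A * gx); have := normc_leB (A * gy) Sy.
  by rewrite normc_sub_sym !normcM; lra.
rewrite ler_pM2l// in gyx.
have kgx : k - (c + 2 * C / normc A) <= normc gx by lra.
have h := ler_wpM2l (ltW al0) (near_one_of_modulus b0 Im_gx Re_gx gxk kgx).
have -> : A * k%:C - Sx = - (Sx - A * gx) - A * (gx - k%:C) by rewrite mulrBr; ring.
rewrite (le_trans (le_normcD _ _))// !normcN normcM.
have e : normc A * (c + 2 * C / normc A + 4 * beta) = 2 * C + normc A * (c + 4 * beta).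
  by field; rewrite gt_eqF.
by rewrite e in h; lra.
Qed.

End Complex_estimates.

Section Deterministic.
Context {R : realType}.
Variables (N : nat) (alpha : 'I_N -> R[i]) (lambda : 'I_N -> R).
Hypotheses (lambda_range : forall n, - pi <= lambda n < pi)
  (lambda_distinct : injective lambda) (alpha_neq0 : forall n, alpha n != 0).
Variables (a : nat -> nat -> R) (a_adm : admissible_matrix a).
Variables (H h h' : nat -> R) (J : nat -> nat).
Hypothesis levels_adm : admissible_levels a H h h' J.
Variable u : nat -> R[i].

Local Notation S m := (Ssum a u m).
Local Notation G m theta := (normc (Sone a m theta)).
Local Notation K m := (Sone0r a m).
Local Notation eta m := (2 * pi / (J m)%:R : R).

Hypothesis noise_bounded : exists2 C : R, 0 <= C & forall m theta, (0 < m)%N ->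
  normc (S m theta - \sum_(n < N) alpha n * Sone a m (theta - lambda n)) <= C.

Lemma Sone_far (delta : R) : 0 < delta -> delta <= 1 -> exists2 C : R, 0 <= C &
  forall m theta mu, (0 < m)%N -> ~ near_mod delta theta mu -> G m (theta - mu) <= C.
Proof.
move=> d0 d1; have p2 := pi_ge2 R.
have [|C C0 hC] := Sone_off_zero a_adm (delta := delta); first by rewrite d0; lra.
exists C => // m theta mu m0 nm.
have [k /andP[k1 k2]] := angle_reduce (theta - mu).
rewrite -(subrK (2 * pi * k%:~R) (theta - mu)) [Sone _ _ _]Ssum_periodic hC//.
rewrite ler_norml k1 (ltW k2) andbT /= andbT leNgt; apply/negP => hk.
by apply: nm; exists k.
Qed.

Definition amplitude_sum : R := \sum_(n < N) normc (alpha n).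

Lemma normc_alpha_le n : normc (alpha n) <= amplitude_sum.
Proof. by rewrite /amplitude_sum (bigD1 n)//= lerDl sumr_ge0// => i _; exact: normc_ge0. Qed.

Lemma amplitude_sum_ge0 : 0 <= amplitude_sum.
Proof. by rewrite sumr_ge0// => i _; exact: normc_ge0. Qed.

Lemma Ssum_far (delta : R) : 0 < delta -> delta <= 1 -> exists2 C : R, 0 <= C &
  forall m theta, (0 < m)%N -> (forall n, ~ near_mod delta theta (lambda n)) ->
  normc (S m theta) <= C.
Proof.
move=> d0 d1; have [C C0 hC] := Sone_far d0 d1; have [C1 C10 hC1] := noise_bounded.
exists (C1 + amplitude_sum * C) => [|m theta m0 far]; first by rewrite addr_ge0 ?mulr_ge0 ?amplitude_sum_ge0.
rewrite -[S m theta](subrK (\sum_(n < N) alpha n * Sone a m (theta - lambda n))).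
rewrite (le_trans (le_normcD _ _))// lerD ?hC1// (le_trans (normc_sum _ _ _))//.
rewrite mulr_suml ler_sum// => n _; rewrite normcM ler_wpM2l ?normc_ge0//.
exact: hC.
Qed.

(** The frequencies being separated, near one of them all the kernels but one are
    evaluated away from 0. *)
Lemma Ssum_near : exists2 delta0 : R, 0 < delta0 & delta0 <= 1 /\
  (forall n k, near_mod (3 * delta0) (lambda n) (lambda k) -> n = k) /\
  exists2 C : R, 0 <= C & forall m theta n, (0 < m)%N ->
    near_mod delta0 theta (lambda n) ->
    normc (S m theta - alpha n * Sone a m (theta - lambda n)) <= C.
Proof.
have [d d0 hd] := separated_frequencies lambda_range lambda_distinct.
(* a third: in [run_localized] a point within 2 * delta0 of one frequency must not be
   within delta0 of another *)
pose delta0 := Num.min 1 (d / 3).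
have e0 : 0 < delta0 by rewrite lt_min; apply/andP; split; lra.
have e1 : delta0 <= 1 by rewrite ge_min lexx.
have e3 : 3 * delta0 <= d.
  by have : delta0 <= d / 3; [rewrite ge_min lexx orbT|lra].
exists delta0 => //; split=> //; split.
  by move=> n k nk; apply: hd; apply: near_mod_le nk.
have [C C0 hC] := Sone_far e0 e1; have [C1 C10 hC1] := noise_bounded.
exists (C1 + amplitude_sum * C) => [|m theta n m0 nn]; first by rewrite addr_ge0 ?mulr_ge0 ?amplitude_sum_ge0.
have -> : S m theta - alpha n * Sone a m (theta - lambda n) =
   (S m theta - \sum_(n < N) alpha n * Sone a m (theta - lambda n)) +
   \sum_(k < N | k != n) alpha k * Sone a m (theta - lambda k).
  by rewrite (bigD1 n)//= opprD addrA subrK.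
rewrite (le_trans (le_normcD _ _))// lerD ?hC1// (le_trans (normc_sum _ _ _))//.
apply: (@le_trans _ _ (\sum_(k < N | k != n) normc (alpha k) * C)).
  apply: ler_sum => k kn; rewrite normcM ler_wpM2l ?normc_ge0//.
  apply: hC => // nk; move/eqP: kn; apply; apply/esym/hd.
  have := near_mod_trans nn nk; apply: near_mod_le; lra.
rewrite -mulr_suml ler_wpM2r// /amplitude_sum [leRHS](bigD1 n)//= lerDr normc_ge0//.
Qed.

(** The kernel is bounded off 0 and at least H m within one mesh of 0, so the
    mesh tends to 0. *)
Lemma mesh_small (delta : R) : 0 < delta -> delta <= 1 ->
  \forall m \near \oo, eta m < delta.
Proof.
move=> d0 d1; have p2 := pi_ge2 R.
have [|C C0 hC] := Sone_off_zero a_adm (delta := delta); first by rewrite d0; lra.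
have [[_ /cvgryPgt Hoo] _ _ HJ] := levels_adm.
near=> m; rewrite ltNge; apply/negP => he.
have m0 : (0 < m)%N by near: m; exists 1%N.
have [J0 hJ] := HJ _ m0.
have : H m <= C.
  rewrite (le_trans (hJ delta _))//; first by apply/andP; split; lra.
  by apply: hC => //; apply/andP; rewrite ger0_norm; [split; lra|lra].
by rewrite leNgt; apply/negP; rewrite negbK; near: m; apply: Hoo.
Unshelve. all: by end_near. Qed.

Definition above_level_index (m : nat) (i : int) : Prop := h m <= normc (S m (grid_angle (J m) i)).

Lemma above_level_index_periodic m i l : (0 < J m)%N ->
  above_level_index m (i + l * (J m)%:Z) <-> above_level_index m i.
Proof. by move=> J0; rewrite /above_level_index grid_shift// Ssum_periodic. Qed.

(** A run around lambda n cannot leave a small neighbourhood: it would cross an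
    annulus where all the kernels are bounded. *)
Lemma run_localized (delta0 delta C : R) m n (j : int) : (0 < m)%N ->
  0 < delta -> delta <= delta0 -> delta0 <= 1 ->
  (forall n k, near_mod (3 * delta0) (lambda n) (lambda k) -> n = k) ->
  (forall theta, (forall n, ~ near_mod delta theta (lambda n)) ->
     normc (S m theta) <= C) ->
  eta m < delta -> C < h m ->
  grid_angle (J m) j <= lambda n < grid_angle (J m) (j + 1) ->
  (exists2 i : int, ~ above_level_index m i & i < j /\ lambda n - delta <= grid_angle (J m) (i + 1)) /\
  (exists2 i : int, ~ above_level_index m i & j + 1 < i /\ grid_angle (J m) (i - 1) <= lambda n + delta).
Proof.
move=> m0 d0 dd0 d01 sep far ed Ch /andP[j1 j2].
have [_ _ _ HJ] := levels_adm; have [J0 _] := HJ _ m0.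
have e0 := mesh_gt0 J0 : 0 < eta m.
have out theta : delta <= `|theta - lambda n| -> `|theta - lambda n| < 2 * delta ->
    normc (S m theta) < h m.
  move=> t1 t2; apply: le_lt_trans Ch; apply: far => k nk.
  have nn : near_mod (2 * delta) theta (lambda n).
    by exists 0; rewrite mulr0 subr0.
  have nkE : n = k by apply: sep; apply: near_mod_le (near_mod_trans nn nk); lra.
  by move: nk; rewrite -nkE; apply: near_mod_annulus => //; lra.
split.
  have [i /andP[i1 i2]] := grid_floor J0 (lambda n - delta).
  exists i; last first.
    split; last exact: ltW.
    by rewrite ltNge -(@grid_le R _ J0); apply/negP => ij; move: j2; rewrite gridS//; lra.
  apply/negP; rewrite -ltNge; move: i2; rewrite gridS// => i2.
  by apply: out; rewrite ler0_norm; lra.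
have [i /andP[i1 i2]] := grid_floor J0 (lambda n + delta).
exists (i + 1); last first.
  rewrite addrK; split => //.
  rewrite ltNge -(@grid_le R _ J0); apply/negP => ij; move: i2; rewrite ltNge.
  by rewrite (le_trans ij)// gridS//; lra.
apply/negP; rewrite -ltNge; move: i2; rewrite gridS// => i2.
by apply: out; rewrite ger0_norm; lra.
Qed.

(** The index i of [run_localized] on either side stops the run, and the grid point
    before it is still within delta. *)
Lemma run_within (delta0 delta C : R) m n (p q j : int) : (0 < m)%N ->
  0 < delta -> delta <= delta0 -> delta0 <= 1 ->
  (forall n k, near_mod (3 * delta0) (lambda n) (lambda k) -> n = k) ->
  (forall theta, (forall n, ~ near_mod delta theta (lambda n)) ->
     normc (S m theta) <= C) ->
  eta m < delta -> C < h m ->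
  grid_angle (J m) j <= lambda n < grid_angle (J m) (j + 1) ->
  is_run (above_level_index m) p q j -> j + 1 <= q ->
  lambda n - delta <= grid_angle (J m) p /\ grid_angle (J m) q <= lambda n + delta.
Proof.
move=> m0 d0 dd0 d01 sep far ed Ch jn pq jq.
have [_ _ _ HJ] := levels_adm; have [J0 _] := HJ _ m0.
have [[i Qi [ij il]] [k Qk [jk kl]]] :=
  run_localized m0 d0 dd0 d01 sep far ed Ch jn.
have [/(_ ij) ip _] := run_avoids pq Qi.
have [_ kq] := run_avoids pq Qk.
split.
  by rewrite (le_trans il)// grid_le//; clear -ip; lia.
rewrite (le_trans _ kl)// grid_le//.
by have := kq (ltac:(clear -jk jq; lia)); clear; lia.
Qed.

(** The arc found around [lambda n], together with the two grid neighbours j and j + 1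
    of [lambda n] through which the run passes. *)
Definition run_arc (m : nat) (n : 'I_N) (A : set R[i]) : Prop :=
  exists p q j : int, [/\ A = Arc (grid_angle (J m) p) (grid_angle (J m) q),
    is_run (above_level_index m) p q j,
    grid_angle (J m) j <= lambda n < grid_angle (J m) (j + 1) & j + 1 <= q].

Section Large_index.
Variables (delta0 C beta : R) (m : nat).
Hypotheses (m0 : (0 < m)%N) (d0 : 0 < delta0) (d01 : delta0 <= 1).
Hypothesis sep : forall n k, near_mod (3 * delta0) (lambda n) (lambda k) -> n = k.
Hypothesis far : forall theta, (forall n, ~ near_mod delta0 theta (lambda n)) ->
  normc (S m theta) <= C.
Hypothesis near : forall theta n, near_mod delta0 theta (lambda n) ->
  normc (S m theta - alpha n * Sone a m (theta - lambda n)) <= C.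
Hypothesis mono : forall theta1 theta2, 0 <= theta1 -> theta1 <= theta2 ->
  theta2 <= pi -> G m theta2 <= G m theta1 + 2 * beta.
Hypotheses (beta0 : 0 <= beta) (C0 : 0 <= C) (mesh : eta m < delta0) (Ch : C < h m).
Hypothesis hH : forall n, h' m + C <= normc (alpha n) * H m.
Hypothesis hh' : h m + 2 * C + 2 * beta * amplitude_sum <= h' m.

Let J0 : (0 < J m)%N. Proof. by have [_ _ _ /(_ _ m0)[]] := levels_adm. Qed.
Local Notation grid := (@grid_angle R (J m)).
Local Notation Q := (above_level_index m).

Let near_lower theta n : near_mod delta0 theta (lambda n) ->
  normc (alpha n) * G m (theta - lambda n) - C <= normc (S m theta).
Proof.
move=> /near; rewrite normc_sub_sym => hn.
have := normc_leB (alpha n * Sone a m (theta - lambda n)) (S m theta).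
rewrite normcM; lra.
Qed.

Let near_upper theta n : near_mod delta0 theta (lambda n) ->
  normc (S m theta) <= normc (alpha n) * G m (theta - lambda n) + C.
Proof.
move=> /near hn.
have := normc_leB (S m theta) (alpha n * Sone a m (theta - lambda n)).
rewrite normcM; lra.
Qed.

Let near_mod0 theta n : `|theta - lambda n| < delta0 -> near_mod delta0 theta (lambda n).
Proof. by move=> hn; exists 0; rewrite mulr0 subr0. Qed.

Let central theta n : `|theta - lambda n| <= eta m -> h' m <= normc (S m theta).
Proof.
move=> hn; have hn0 : `|theta - lambda n| < delta0 by apply: le_lt_trans mesh.
apply: le_trans (near_lower (near_mod0 hn0)).
have [_ _ _ /(_ _ m0)[_ HJ]] := levels_adm.
rewrite lerBrDr (le_trans (hH n))// ler_wpM2l ?normc_ge0// HJ//.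
by rewrite -ler_norml.
Qed.

Let hle : h m <= h' m.
Proof. by have [_ _ [hle _ _] _] := levels_adm; exact: hle. Qed.

Let run_near n : exists pqj : int * int * int,
  let: (p, q, j) := pqj in
  [/\ is_run Q p q j, grid j <= lambda n < grid (j + 1) & j + 1 <= q].
Proof.
have [j jn] := grid_floor J0 (lambda n).
have [dj dj1] := grid_cell_dist jn.
have Q0 : Q j by apply: le_trans hle _; exact: central dj.
have Q1 : Q (j + 1) by apply: le_trans hle _; exact: central dj1.
have [[i Qi [ij il]] [k Qk [jk kl]]] :=
  run_localized m0 d0 (lexx _) d01 sep far mesh Ch jn.
have [p [q pq]] := run_exists Q0 Qi ij Qk (ltac:(clear -jk; lia)).
exists (p, q, j); split=> //.
have [pj _ _ Qq] := pq.
have [qE|qj] := eqVneq q j; last by clear -pj qj; lia.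
by case: Qq; rewrite qE.
Qed.

(** Climbing towards lambda n, the kernel decreases by at most 2 beta; the gap
    between h' and h absorbs this, so every grid point above the level h' that is
    close to lambda n is in the run around lambda n. *)
Let climb n i j : grid j <= lambda n < grid (j + 1) ->
  `|grid i - lambda n| < delta0 -> h' m <= normc (S m (grid i)) ->
  forall l, (i <= l <= j) || (j + 1 <= l <= i) -> Q l.
Proof.
move=> /andP[j1 j2] hi Si l hl.
have dist : `|grid l - lambda n| <= `|grid i - lambda n|.
  case/orP: hl => /andP[]; rewrite -!(@grid_le R _ J0) => l1 l2.
    by rewrite !ler0_norm; lra.
  by rewrite !ger0_norm; lra.
have hl0 : `|grid l - lambda n| < delta0 by apply: le_lt_trans hi.
apply: le_trans (near_lower (near_mod0 hl0)).
have p2 := pi_ge2 R.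
have hp : `|grid i - lambda n| <= pi by rewrite (le_trans (ltW hi))//; move: d01; lra.
have := mono (normr_ge0 _) dist hp.
rewrite !normc_Sone_abs => hG.
have hu := near_upper (near_mod0 hi).
have := ler_wpM2l (normc_ge0 (alpha n)) hG; rewrite mulrDr.
have := ler_wpM2r beta0 (normc_alpha_le n).
move: hh'; lra.
Qed.

Let absorb p q j (i1 i2 i : int) : is_run Q p q j ->
  i1 <= i2 -> (forall l, i1 <= l <= i2 -> Q l) -> p <= i <= q ->
  Arc (grid i1) (grid i2) (expi (grid i)) ->
  Arc (grid i1) (grid i2) `<=` Arc (grid p) (grid q).
Proof.
move=> pq i12 hQ ipq /(Arc_grid_index J0)[l il].
have [||] := @run_absorbs Q p q j (i1 - l * (J m)%:Z) (i2 - l * (J m)%:Z) i pq _ ipq.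
- by clear -il; lia.
- by move=> k kl; apply: (above_level_index_periodic k l J0).1; apply: hQ; clear -kl; lia.
move=> pi iq; rewrite (Arc_shift J0 i1 i2 (- l)) mulNr.
exact: Arc_sub.
Qed.

(** Every maximal arc that contains a point above [h'] starts near some frequency and,
    by [climb], shares a grid point with the run around it; two runs that meet are
    equal, up to the shift by whole turns that [absorb] deals with. *)
Lemma arcs_at_large_index : exists A : 'I_N -> set R[i],
  [/\ Nhat a u h h' J m = N, injective A, range A = arc_family a u h h' J m,
      forall n, A n (expi (lambda n)) & forall n, run_arc m n (A n)].
Proof.
have [pqj pqjP] := choice run_near.
pose A n := Arc (grid (pqj n).1.1) (grid (pqj n).1.2).
have Amem n : A n (expi (lambda n)).
  have := pqjP n; rewrite /A; case: (pqj n) => -[p q] j /= [[pj _ _ _] /andP[j1 j2] jq].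
  exists (lambda n) => //; rewrite /= in_itv /= (le_trans _ j1) ?grid_le//; last by clear -pj; lia.
  by rewrite (le_trans (ltW j2))// grid_le.
have Arun n : run_arc m n (A n).
  have := pqjP n; rewrite /A; case: (pqj n) => -[p q] j /= [? ? ?].
  by exists p, q, j.
have Anear n x : A n (expi x) -> near_mod (3 * delta0) x (lambda n).
  have [p [q [j [-> pq jn jq]]]] := Arun n.
  have [r1 r2] := run_within m0 d0 (lexx _) d01 sep far mesh Ch jn pq jq.
  move=> [y]; rewrite /= in_itv /= => /andP[y1 y2] /expi_inj[k yE].
  exists (- k); rewrite mulrNz mulrN opprK.
  by rewrite ltr_norml; move: d0; lra.
have Ainj : injective A.
  move=> n k nk; apply/esym/sep; apply: Anear; rewrite nk; exact: Amem.
have Asup n : superlevel_arc a u m (h m) (J m) (A n).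
  have [p [q [j [-> [pj hQ _ _] jn jq]]]] := Arun n.
  by exists p, q; split => //; clear -pj; lia.
have Amax n : maximal_superlevel_arc a u m (h m) (J m) (A n).
  split=> // B [i1 [i2 [i12 -> hQ]]]; have [p [q [j [-> pq jn jq]]]] := Arun n.
  have [pj _ _ _] := pq.
  move=> AB; apply/seteqP; split => //.
  apply: (absorb (i := p) pq) => //; first by clear -pj; lia.
  by apply: AB; apply: Arc_grid_mem => //; clear -pj; lia.
have rangeA : range A = arc_family a u h h' J m.
  apply/seteqP; split => [_ [n _ <-]|B].
    split; first exact: Amax.
    have [p [q [j [-> pq jn jq]]]] := Arun n; have [pj _ _ _] := pq.
    exists (Arc (grid j) (grid (j + 1))); split; last by apply: Arc_sub => //; clear -pj jq; lia.
    exists j, (j + 1); split => //; first by clear; lia.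
    move=> l lj; apply: (central (n := n)); have [dj dj1] := grid_cell_dist jn.
    by have [->|->] : l = j \/ l = j + 1 by clear -lj; lia.
  move=> [Bmax [B' [[j1 [j2 [j12 -> hQ']]] B'B]]].
  have [[i1 [i2 [i12 BE hQ]]] Bmax'] := Bmax.
  have Sj1 : h' m <= normc (S m (grid j1)) by apply: hQ'; rewrite lexx.
  have [n [k hk]] : exists n, near_mod delta0 (grid j1) (lambda n).
    apply: contrapT => /forallNP nn.
    by move: (far nn) hle Ch Sj1; lra.
  pose i := j1 + (- k) * (J m)%:Z.
  have gi : grid i = grid j1 - 2 * pi * k%:~R by rewrite /i grid_shift// mulrNz mulrN.
  have Si : h' m <= normc (S m (grid i)).
    by rewrite gi -mulrN -mulrNz Ssum_periodic.
  have near_i : `|grid i - lambda n| < delta0 by rewrite gi addrAC.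
  exists n => //; have [p [q [j [AE pq jn jq]]]] := Arun n.
  have [pj hpq _ _] := pq.
  have ipq : p <= i <= q.
    apply: (run_in pq) => l hl; have [->|lj] := eqVneq l j; first exact: hpq.
    by apply: (climb jn near_i Si); clear -hl lj; lia.
  apply: Bmax'; first exact: Asup.
  rewrite BE AE; apply: (absorb (i := i) pq) => //.
  rewrite -BE gi -mulrN -mulrNz expi_periodic; apply: B'B.
  by apply: Arc_grid_mem => //; rewrite lexx.
exists A; split => //.
rewrite /Nhat -rangeA.
have -> : range A = [set` [fset A n | n in 'I_N]%fset].
  apply/seteqP; split => [_ [n _ <-]|B] /=; first by apply/imfsetP; exists n.
  by move=> /imfsetP[n _ ->]; exists n.
rewrite set_fsetK card_imfset//= .
by rewrite -[RHS]card_ord cardE.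
Qed.

End Large_index.

(** The radius delta is arbitrary: for m large the sum is below [h m] outside the
    delta-neighbourhoods of the frequencies. *)
Lemma arcs_shrink (delta0 delta : R) : 0 < delta -> delta <= delta0 -> delta0 <= 1 ->
  (forall n k, near_mod (3 * delta0) (lambda n) (lambda k) -> n = k) ->
  \forall m \near \oo, forall n A z, run_arc m n A -> A z ->
    exists2 x, z = expi x & `|x - lambda n| <= delta.
Proof.
move=> d0 dd0 d01 sep; have d1 : delta <= 1 by lra.
have [C C0 far] := Ssum_far d0 d1.
have [_ [/cvgryPgt hoo _] _ _] := levels_adm.
near=> m => n A z [p [q [j [-> pq jn jq]]]] [x].
have m0 : (0 < m)%N by near: m; exists 1%N.
have Ch : C < h m by near: m; apply: hoo.
have ed : eta m < delta by near: m; apply: mesh_small.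
have [r1 r2] := run_within m0 d0 dd0 d01 sep (fun theta => far m theta m0) ed Ch jn pq jq.
rewrite /= in_itv /= => /andP[x1 x2] <-; exists x => //.
by rewrite ler_norml; lra.
Unshelve. all: by end_near. Qed.

Lemma levels_lt_Sone0r m : (0 < m)%N -> H m < K m.
Proof.
move=> m0; have [[/(_ _ m0) hS _] _ _ _] := levels_adm.
by move: hS; rewrite Sone0E ltcR.
Qed.

(** The growth conditions on the levels enter the argument only through these
    inequalities. *)
Lemma large_index_near (C beta delta0 : R) : 0 <= C -> 0 < delta0 -> delta0 <= 1 ->
  \forall m \near \oo, [/\ (0 < m)%N, eta m < delta0, C < h m,
    forall n, h' m + C <= normc (alpha n) * H m &
    h m + 2 * C + 2 * beta * amplitude_sum <= h' m].
Proof.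
move=> C0 d0 d01.
have [|e e0 he] := @finite_min_gt0 R _ (fun n => normc (alpha n)).
  move=> n; rewrite lt_neqAle normc_ge0 andbT eq_sym.
  by apply: contraNneq (alpha_neq0 n) => /eq0_normc ->.
have [_ [/cvgryPgt hoo _] [hh' /cvgryPge hd /cvgryPge Hh'] _] := levels_adm.
near=> m.
have m0 : (0 < m)%N by near: m; exists 1%N.
have Ch : C < h m by near: m; apply: hoo.
have hle := hh' _ m0.
have h'0 : 0 < h' m by lra.
split => //.
- by near: m; apply: mesh_small.
- move=> n; have : 2 / e <= H m / h' m by near: m; apply: Hh'.
  rewrite ler_pdivlMr// mulrAC ler_pdivrMr// mulrC => hH.
  apply: (@le_trans _ _ (e * H m)); first by lra.
  rewrite ler_wpM2r//.
  have : 0 <= e * H m by lra.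
  by rewrite pmulr_rge0.
- have : 2 * C + 2 * beta * amplitude_sum <= h' m - h m by near: m; apply: hd.
  lra.
Unshelve. all: by end_near. Qed.

(** Any sequence u whose sums stay within a bounded distance of those of the harmonics
    has the required superlevel arcs; no randomness is involved. *)
Theorem superlevel_arcs_detect : exists (M : nat) (arc : nat -> 'I_N -> set R[i]),
  [/\ (0 < M)%N,
      (forall m, (M <= m)%N ->
        [/\ Nhat a u h h' J m = N, injective (arc m),
            range (arc m) = arc_family a u h h' J m &
            forall n, arc m n (expi (lambda n))]) &
      forall (n : 'I_N) (j j' : nat -> nat),
        (forall m, (M <= m)%N ->
          [/\ (0 < j m)%N, (j m <= j' m)%N &
              arc m n = Arc (grid_angle (J m) (j m)) (grid_angle (J m) (j' m))]) ->
        ((expi (2 * pi * ((j m + j' m)%:R / (2 * (J m)%:R))) : R[i]^o) @[m --> \oo]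
           --> (expi (lambda n) : R[i]^o)) /\
        ((Sone a m (2 * pi / (J m)%:R) / Sone a m 0 : R[i]^o) @[m --> \oo]
           --> (1 : R[i]^o) ->
         forall jmax : nat -> int,
         (forall m, (M <= m)%N ->
            (j m)%:Z <= jmax m <= (j' m)%:Z /\
            forall k : int, (j m)%:Z <= k <= (j' m)%:Z ->
              normc (S m (grid_angle (J m) k))
              <= normc (S m (grid_angle (J m) (jmax m)))) ->
         (S m (grid_angle (J m) (jmax m)) / (K m)%:C : R[i]^o) @[m --> \oo]
           --> (alpha n : R[i]^o))].
Proof.
have [delta0 d0 [d01 [sep [C1 C10 hC1]]]] := Ssum_near.
have [C2 C20 hC2] := Ssum_far d0 d01.
have [beta b0 hbeta] := almost_decreasing_pointwise a_adm.
pose C := C1 + C2; have C0 : 0 <= C by rewrite addr_ge0.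
have nearC m theta n : (0 < m)%N -> near_mod delta0 theta (lambda n) ->
    normc (S m theta - alpha n * Sone a m (theta - lambda n)) <= C.
  by move=> m0 nn; rewrite (le_trans (hC1 _ _ _ m0 nn))// lerDl.
have [M _ hM] := large_index_near beta C0 d0 d01.
have {}hM m : (M <= m)%N -> exists A : 'I_N -> set R[i],
  [/\ Nhat a u h h' J m = N, injective A, range A = arc_family a u h h' J m,
      forall n, A n (expi (lambda n)) & forall n, run_arc m n (A n)].
  move=> /hM[m0 me Ch hH hh]; have [mono _ _] := hbeta _ m0.
  apply: (arcs_at_large_index (delta0 := delta0) (C := C) (beta := beta)) => //.
    by move=> theta /(hC2 _ _ m0) hS; rewrite (le_trans hS)// lerDr.
  by move=> theta n; exact: nearC.
have /choice[arc arcP] : forall m, exists A : 'I_N -> set R[i], (M.+1 <= m)%N ->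
  [/\ Nhat a u h h' J m = N, injective A, range A = arc_family a u h h' J m,
      forall n, A n (expi (lambda n)) & forall n, run_arc m n (A n)].
  move=> m; case: (leqP M.+1 m) => [/ltnW/hM[A AP]|_]; first by exists A.
  by exists (fun=> set0).
have arc_shrink delta : 0 < delta -> delta <= delta0 -> \forall m \near \oo,
    (M.+1 <= m)%N /\ forall n z, arc m n z ->
    exists2 x, z = expi x & `|x - lambda n| <= delta.
  move=> e0 e1; have shrink := arcs_shrink e0 e1 d01 sep.
  near=> m.
  have Mm : (M.+1 <= m)%N by near: m; exists M.+1.
  split=> // n z; have [_ _ _ _ /(_ n)] := arcP _ Mm.
  by move: n (arc m n) z; near: m.
exists M.+1, arc; split; first by [].
  by move=> m /arcP[].
move=> n j j' jP; split.
  apply: cvg_normc => r r0.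
  pose delta := Num.min delta0 (r / 2).
  have e0 : 0 < delta by rewrite lt_min d0 divr_gt0.
  have e1 : delta <= delta0 by rewrite ge_min lexx.
  have e2 : delta <= r / 2 by rewrite ge_min lexx orbT.
  near=> m.
  have [Mm shrink] : (M.+1 <= m)%N /\ forall n z, arc m n z ->
      exists2 x, z = expi x & `|x - lambda n| <= delta.
    by near: m; apply: arc_shrink.
  have m0 : (0 < m)%N by apply: leq_trans Mm.
  have [_ _ _ /(_ _ m0)[J0 _]] := levels_adm.
  have [j0 jj' AE] := jP _ Mm.
  have JJ : (J m)%:R != 0 :> R by rewrite pnatr_eq0 -lt0n.
  (* the midpoint of the parameter interval parametrizes a point of the arc *)
  have [x -> hx] : exists2 x, expi (2 * pi * ((j m + j' m)%:R / (2 * (J m)%:R))) = expi x &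
      `|x - lambda n| <= delta.
    apply: shrink; rewrite AE; eexists; last reflexivity.
    have : grid_angle (J m) (j m) <= grid_angle (J m) (j' m) :> R by rewrite grid_le//; lia.
    have -> : 2 * pi * ((j m + j' m)%:R / (2 * (J m)%:R)) =
        (grid_angle (J m) (j m) + grid_angle (J m) (j' m)) / 2 :> R.
      by rewrite /grid_angle natrD -!pmulrn; field.
    by rewrite /= in_itv /= => jg; apply/andP; split; lra.
  by rewrite (le_trans (expi_lipschitz _ _))// distrC; lra.
move=> /normc_cvg hone jmax jmaxP.
apply: cvg_normc => r r0.
set al := normc (alpha n).
have al0 : 0 < al.
  rewrite lt_neqAle normc_ge0 andbT eq_sym.
  by apply: contraNneq (alpha_neq0 n) => /eq0_normc ->.
(* the part of the error in [peak_amplitude] that does not grow with m *)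
pose c2 := 3 * C + al * (6 * beta).
pose r' := r / 2 / al.
have r'0 : 0 < r' by rewrite !divr_gt0.
have [[_ /cvgryPge Hoo] _ _ _] := levels_adm.
near=> m.
have [Mm shrink] : (M.+1 <= m)%N /\ forall n z, arc m n z ->
    exists2 x, z = expi x & `|x - lambda n| <= delta0 / 2.
  by near: m; apply: arc_shrink; lra.
have m0 : (0 < m)%N by apply: leq_trans Mm.
have [_ _ _ /(_ _ m0)[J0 _]] := levels_adm.
have [j0 jj' AE] := jP _ Mm.
have [/andP[jm1 jm2] jmaxle] := jmaxP _ Mm.
have [mono Imb Reb] := hbeta _ m0.
have p2 := pi_ge2 R.
have mesh : eta m < delta0 / 2 by near: m; apply: mesh_small; lra.
have Kbig : Num.max 1 (c2 / (r / 2)) <= K m.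
  apply: ltW; apply: le_lt_trans (levels_lt_Sone0r m0).
  by near: m; apply: Hoo.
have K0 : 0 < K m by rewrite (lt_le_trans _ Kbig)// lt_max ltr01.
have Kc2 : c2 <= r / 2 * K m.
  rewrite mulrC -ler_pdivrMr ?divr_gt0//.
  by rewrite (le_trans _ Kbig)// le_max lexx orbT.
have [_ _ _ _ /(_ n)[p [q [i [AE' [pqi _ _ _] inn iq]]]]] := arcP _ Mm.
have half_delta : delta0 / 2 < delta0 by rewrite ltr_pdivrMr// ltr_pMr// ltr1n.
have nearE x : `|x - lambda n| <= delta0 / 2 -> near_mod delta0 x (lambda n).
  by move=> hx; exists 0; rewrite mulr0 subr0 (le_lt_trans hx).
(* the maximizer, lifted next to lambda n *)
have [x xE hx] : exists2 x, expi (grid_angle (J m) (jmax m)) = expi x &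
    `|x - lambda n| <= delta0 / 2.
  by apply: shrink; rewrite AE; apply: Arc_grid_mem => //; rewrite jm1 jm2.
have Sx : S m (grid_angle (J m) (jmax m)) = S m x.
  by have [k ->] := expi_inj xE; rewrite Ssum_periodic.
(* a grid point of the arc within one mesh of lambda n *)
have [l il] : exists l : int, (j m)%:Z <= i + l * (J m)%:Z <= (j' m)%:Z.
  apply: (@Arc_grid_index R _ J0); rewrite -AE AE'.
  by apply: Arc_grid_mem => //; lia.
have Si : normc (S m (grid_angle (J m) i)) <= normc (S m x).
  by rewrite -Sx -(Ssum_periodic _ _ _ _ l) -grid_shift// jmaxle.
have [hi _] := grid_cell_dist inn.
have hi0 : `|grid_angle (J m) i - lambda n| <= delta0 / 2 by apply: le_trans hi (ltW mesh).
have mesh_pi : eta m <= pi.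
  rewrite (le_trans (ltW mesh))// (le_trans (ltW half_delta))// (le_trans d01)//.
  by rewrite (le_trans _ p2)// ler1n.
(* the grid point is within one mesh of lambda n, where the kernel is close to its
   value at 0 by the additional assumption on J *)
have Gi : K m - (r' * K m + 2 * beta) <= G m (grid_angle (J m) i - lambda n).
  have := mono _ _ (normr_ge0 _) hi mesh_pi; rewrite normc_Sone_abs => Gmono.
  rewrite opprD addrA -{1}[K m]mul1r -mulrBl lerBlDr (le_trans _ Gmono)//.
  have hr : normc (1 - Sone a m (eta m) / Sone a m 0) <= r' by near: m; exact: hone.
  have := le_trans (normc_leB 1 (Sone a m (eta m) / Sone a m 0)) hr.
  rewrite normc1 normcM normcV Sone0E normc_real (ger0_norm (ltW K0)).
  by rewrite -ler_pdivlMr// lerBlDr -lerBlDl.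
have h1 := nearC _ _ _ m0 (nearE _ hx).
have h2 := nearC _ (grid_angle (J m) i) n m0 (nearE _ hi0).
have := peak_amplitude (alpha_neq0 n) b0 (Imb _) (Reb _) (normc_Sone_le a_adm _ m0) Gi h1 h2 Si.
rewrite Sx -/al => peak.
have Kc0 : (K m)%:C != 0 by rewrite fmorph_eq0 gt_eqF.
have -> : alpha n - S m x / (K m)%:C = (alpha n * (K m)%:C - S m x) / (K m)%:C.
  by rewrite mulrBl mulfK.
rewrite normcM normcV normc_real (ger0_norm (ltW K0)) ler_pdivrMr//.
rewrite (le_trans peak)//.
have -> : 3 * C + al * (r' * K m + 2 * beta + 4 * beta) = r / 2 * K m + c2.
  by rewrite /r' /c2; field; rewrite gt_eqF.
by rewrite [r in leRHS]splitr mulrDl lerD2l.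
Unshelve. all: by end_near. Qed.

End Deterministic.

(** * Measurability and independence *)

Section Measurability.
Context {R : realType}.

(** The preimage of an open half-line is open; the modulus, the real part and the
    imaginary part are instances. *)
Lemma measurable_contraction (f : R[i] -> R) :
  (forall x y, `|f x - f y| <= normc (x - y)) -> measurable_fun [set: R[i]] f.
Proof.
move=> fL; apply: (measurability _ (RGenOInfty.measurableE R)).
move=> _ [_ [r ->] <-]; rewrite setTI.
apply: sub_sigma_algebra => /=; rewrite openE => z /=.
rewrite in_itv /= andbT => rz.
apply/nbhs_ballP; exists (f z - r)%:C; first by rewrite /= ltcR subr_gt0.
move=> w; rewrite -ball_normE /= normr_normc ltcR => zw.
have := le_lt_trans (fL z w) zw; rewrite in_itv /= andbT ltr_norml; lra.
Qed.

Lemma measurable_normc : measurable_fun [set: R[i]] (@normc R).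
Proof.
apply: measurable_contraction => x y; rewrite ler_norml normc_leB andbT.
have := normc_leB y x; rewrite normc_sub_sym; lra.
Qed.

Lemma measurable_Re : measurable_fun [set: R[i]] (@complex.Re R).
Proof. by apply: measurable_contraction => -[x x'] [y y']; exact: (abs_Re_le ((x - y) +i* (x' - y'))). Qed.

Lemma measurable_Im : measurable_fun [set: R[i]] (@complex.Im R).
Proof. by apply: measurable_contraction => -[x x'] [y y']; exact: (abs_Im_le ((x - y) +i* (x' - y'))). Qed.

End Measurability.

Section Independence.
Context {R : realType} {d : measure_display} {T : measurableType d}.
Variable P : probability T R.
Local Open Scope ereal_scope.

Import HBNNSimple.

(** By linearity for simple functions, then by monotone convergence. In the use made of
    it, W is the product of the factors that depend on the other variables. *)
Lemma integral_factor_of_indic (X : {RV P >-> R[i]}) (W : T -> R) (c : R)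
  (f : R[i] -> R) : measurable_fun setT W -> (forall w, (0 <= W w)%R) -> (0 <= c)%R ->
  measurable_fun setT f -> (forall z, (0 <= f z)%R) ->
  (forall B, measurable B -> \int[P]_w (W w * \1_B (X w))%:E = c%:E * P (X @^-1` B)) ->
  \int[P]_w (W w * f (X w))%:E = c%:E * \int[P]_w (f (X w))%:E.
Proof.
move=> mW W0 c0 mf f0 h.
have mX : measurable_fun setT X by exact: measurable_funPT.
have mEf : measurable_fun [set: R[i]] (EFin \o f) by exact/measurable_EFinP.
pose f_ := nnsfun_approx measurableT mEf.
have simple (g : {nnsfun R[i] >-> R}) :
    \int[P]_w (W w * g (X w))%:E = c%:E * \int[P]_w (g (X w))%:E.
  have mi y : measurable_fun setT (fun w => \1_(g @^-1` [set y]) (X w) : R).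
    exact: measurableT_comp.
  have mpre y : measurable (X @^-1` (g @^-1` [set y])).
    by rewrite -[_ @^-1` _]setTI; exact: mX.
  have g0 y w : (0 <= y * \1_(g @^-1` [set y]) (X w))%R.
    by have := nnfun_muleindic_ge0 g y (X w); rewrite lee_fin.
  under eq_integral do rewrite fimfunE mulr_fsumr ?finite_support// -fsumEFin//.
  rewrite ge0_integral_fsum//; last 2 first.
  - move=> y; apply/measurable_EFinP/measurable_funM => //.
    exact: measurable_funM.
  - by move=> y w _; rewrite lee_fin mulr_ge0.
  under [in RHS]eq_integral do rewrite fimfunE -fsumEFin//.
  rewrite [in RHS]ge0_integral_fsum//; last 2 first.
  - move=> y; apply/measurable_EFinP; exact: measurable_funM.
  - by move=> y w _; rewrite lee_fin.
  rewrite ge0_mule_fsumr; last first.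
    by move=> y; apply: integral_ge0 => w _; rewrite lee_fin.
  apply: eq_fsbigr => y _.
  have [y0|y0] := ltP y 0%R.
    have e0 w : (\1_(g @^-1` [set y]) (X w) = 0 :> R)%R.
      rewrite indicE memNset// => /= gy.
      by have : (0 <= g (X w))%R by []; rewrite gy leNgt y0.
    by rewrite !integral0_eq ?mule0// => w _; rewrite e0 !mulr0.
  transitivity (y%:E * \int[P]_w (W w * \1_(g @^-1` [set y]) (X w))%:E).
    rewrite -ge0_integralZl_EFin//; last 2 first.
    - by move=> w _; rewrite lee_fin mulr_ge0// indicE.
    - exact/measurable_EFinP/measurable_funM.
    by apply: eq_integral => w _; rewrite -EFinM mulrCA.
  rewrite h; last by rewrite -[_ @^-1` _]setTI; exact: measurable_funPT.
  transitivity (c%:E * (y%:E * \int[P]_w (\1_(g @^-1` [set y]) (X w))%:E)).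
    rewrite (_ : \int[P]_w _ = P (X @^-1` (g @^-1` [set y]))); first by rewrite muleCA.
    by have := integral_indic P measurableT (mpre y); rewrite setIT => <-.
  congr (_ * _); rewrite -ge0_integralZl_EFin//.
  exact/measurable_EFinP.
have cvgf z : EFin \o f_ ^~ z @ \oo --> (f z)%:E.
  by apply: (cvg_nnsfun_approx measurableT mEf) => // z' _; rewrite lee_fin.
have f_nd z m n : (m <= n)%N -> (f_ m z <= f_ n z)%R.
  by move=> mn; exact/lefP/nd_nnsfun_approx.
have limW : \int[P]_w (W w * f_ n (X w))%:E @[n --> \oo] -->
    \int[P]_w (W w * f (X w))%:E.
  rewrite (_ : \int[P]_w (W w * f (X w))%:E =
      \int[P]_w (limn (fun n => (W w * f_ n (X w))%:E))); last first.
    apply: eq_integral => w _; apply/esym/cvg_lim => //.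
    under eq_fun do rewrite EFinM.
    by rewrite EFinM; apply: cvgeZl => //; exact: cvgf.
  apply: cvg_monotone_convergence => //.
  - move=> n; apply/measurable_EFinP/measurable_funM => //.
    exact: measurableT_comp.
  - by move=> n w _; rewrite lee_fin mulr_ge0.
  - by move=> w _ m n mn; rewrite lee_fin ler_wpM2l// f_nd.
have limc : c%:E * \int[P]_w (f_ n (X w))%:E @[n --> \oo] -->
    c%:E * \int[P]_w (f (X w))%:E.
  apply: cvgeZl => //.
  rewrite (_ : \int[P]_w (f (X w))%:E =
      \int[P]_w (limn (fun n => (f_ n (X w))%:E))); last first.
    by apply: eq_integral => w _; apply/esym/cvg_lim => //; exact: cvgf.
  apply: cvg_monotone_convergence => //.
  - by move=> n; apply/measurable_EFinP; exact: measurableT_comp.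
  - by move=> n w _; rewrite lee_fin.
  - by move=> w _ m n mn; rewrite lee_fin f_nd.
have limc' : \int[P]_w (W w * f_ n (X w))%:E @[n --> \oo] -->
    c%:E * \int[P]_w (f (X w))%:E.
  by under eq_fun do rewrite simple.
exact: cvg_unique limW limc'.
Qed.

Variable eps : nat -> {RV P >-> R[i]}.
Hypothesis eps_indep : mutually_independent eps.

Let measurable_eps t : measurable_fun setT (eps t). Proof. exact: measurable_funPT. Qed.

Let measurable_preimage_eps t (B : set R[i]) : measurable B -> measurable (eps t @^-1` B).
Proof. by move=> mB; rewrite -[_ @^-1` _]setTI; exact: measurable_funPT. Qed.

Lemma indep_indic (s : seq nat) (B : nat -> set R[i]) : uniq s ->
  (forall t, t \in s -> (0 < t)%N) -> (forall t, measurable (B t)) ->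
  \int[P]_w (\prod_(t <- s) \1_(B t) (eps t w))%:E =
  \prod_(t <- s) P (eps t @^-1` B t).
Proof.
move=> us s0 mB; pose A := [fset t in s]%fset.
have sA : perm_eq s A.
  by apply: uniq_perm => [//||t]; [exact: fset_uniq|rewrite inE].
have hA : forall t, t \in A -> (0 < t)%N /\ measurable (B t).
  by move=> t; rewrite inE /= => /s0.
rewrite [RHS](perm_big _ sA) -eps_indep//.
have mcap : measurable (\bigcap_(t in [set` A]) (eps t @^-1` B t)).
  by apply: bigcap_measurableType => t _; exact: measurable_preimage_eps.
have := integral_indic P measurableT mcap; rewrite setIT => <-.
apply: eq_integral => w _; congr EFin.
rewrite (perm_big _ sA) /=.
have [wA|wA] := pselect ((\bigcap_(t in [set` A]) (eps t @^-1` B t)) w).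
  rewrite [RHS]indicE mem_set// big_seq big1// => t tA.
  by rewrite indicE mem_set//; exact: wA.
rewrite [RHS]indicE memNset//.
have [t tA tB] : exists2 t, t \in A & ~ B t (eps t w).
  by apply/not_exists2P => h; apply: wA => t tA; have [//|/contrapT] := h t.
apply/eqP; rewrite prodf_seq_eq0; apply/hasP; exists t => //=.
by rewrite indicE memNset.
Qed.

(** Functions replace indicators one variable at a time: the induction hypothesis
    with one more indicator is what [integral_factor_of_indic] asks for. *)
Lemma indep_prod_indic (s s' : seq nat) (f : nat -> R[i] -> R) (B : nat -> set R[i])
  (c : nat -> R) :
  uniq (s ++ s') -> (forall t, t \in s ++ s' -> (0 < t)%N) ->
  (forall t, measurable (B t)) -> (forall t, measurable_fun setT (f t)) ->
  (forall t z, (0 <= f t z)%R) ->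
  (forall t, \int[P]_w (f t (eps t w))%:E = (c t)%:E) ->
  \int[P]_w (\prod_(t <- s) f t (eps t w) * \prod_(t <- s') \1_(B t) (eps t w))%:E =
  (\prod_(t <- s) c t)%:E * \prod_(t <- s') P (eps t @^-1` B t).
Proof.
move=> us s0 mB mf f0 fc.
have c0 t : (0 <= c t)%R.
  by rewrite -lee_fin -fc; apply: integral_ge0 => w _; rewrite lee_fin.
elim: s s' us s0 B mB => [|r s IH] s' us s0 B mB.
  rewrite big_nil mul1e; under eq_integral do rewrite big_nil mul1r.
  by rewrite indep_indic.
have /andP[rs us'] := us.
pose W w := (\prod_(t <- s) f t (eps t w) * \prod_(t <- s') \1_(B t) (eps t w))%R.
have us2 : uniq (s ++ s') by [].
have s02 t : t \in s ++ s' -> (0 < t)%N by move=> ts; apply: s0; rewrite inE ts orbT.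
have hW := IH s' us2 s02 B mB.
pose k := (\prod_(t <- s) c t * \prod_(t <- s') fine (P (eps t @^-1` B t)))%R.
have kE : (\prod_(t <- s) c t)%:E * \prod_(t <- s') P (eps t @^-1` B t) = k%:E.
  rewrite /k EFinM; congr (_ * _).
  rewrite -prodEFin; apply: eq_bigr => t _; rewrite fineK//.
  by apply: fin_num_measure; exact: measurable_preimage_eps.
under eq_integral do rewrite big_cons -mulrA mulrC.
rewrite (@integral_factor_of_indic (eps r) W k (f r))//.
- by rewrite fc big_cons muleC -kE muleA -EFinM.
- apply: measurable_funM.
    by apply: measurable_prod => t _; exact: measurableT_comp.
  apply: measurable_prod => t _; apply: measurableT_comp => //.
- move=> w; apply: mulr_ge0; apply: prodr_ge0 => t _ //; rewrite indicE//.
- apply: mulr_ge0; apply: prodr_ge0 => t _ //; exact: fine_ge0.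
move=> D mD.
pose B' t := if t == r then D else B t.
have rs' : r \notin s' by move: rs; rewrite mem_cat negb_or => /andP[].
have us3 : uniq (s ++ r :: s') by rewrite (perm_uniq (permEl (perm_catCA s [:: r] s'))).
have s03 t : t \in s ++ r :: s' -> (0 < t)%N.
  by move=> ts; apply: s0; rewrite (perm_mem (permEl (perm_catCA [:: r] s s'))).
have mB' t : measurable (B' t) by rewrite /B'; case: eqP.
have B'r : B' r = D by rewrite /B' eqxx.
have := IH (r :: s') us3 s03 B' mB'.
rewrite big_cons B'r muleCA => hD.
transitivity (P (eps r @^-1` D) * ((\prod_(t <- s) c t)%:E *
    \prod_(j <- s') P (eps j @^-1` B' j))); last first.
  rewrite muleC; congr (_ * _); rewrite -kE; congr (_ * _).
  apply: eq_big_seq => t ts'; rewrite /B'; case: eqP => // tr.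
  by move: rs'; rewrite -tr ts'.
rewrite -hD; apply: eq_integral => w _; congr EFin.
rewrite big_cons B'r /W -!mulrA; congr (_ * _)%R; rewrite mulrC; congr (_ * _)%R.
apply: eq_big_seq => t ts'; rewrite /B'; case: eqP => // tr.
by move: rs'; rewrite -tr ts'.
Qed.

Lemma indep_prod (s : seq nat) (f : nat -> R[i] -> R) (c : nat -> R) :
  uniq s -> (forall t, t \in s -> (0 < t)%N) ->
  (forall t, measurable_fun setT (f t)) -> (forall t z, (0 <= f t z)%R) ->
  (forall t, \int[P]_w (f t (eps t w))%:E = (c t)%:E) ->
  \int[P]_w (\prod_(t <- s) f t (eps t w))%:E = (\prod_(t <- s) c t)%:E.
Proof.
move=> us s0 mf f0 fc.
have := @indep_prod_indic s [::] f (fun=> setT) c.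
rewrite cats0 => /(_ us s0 (fun=> measurableT) mf f0 fc).
rewrite big_nil mule1 => <-.
by apply: eq_integral => w _; rewrite big_nil mulr1.
Qed.

End Independence.

(** * Almost sure bounds and exponential moments *)

Section Almost_sure_sums.
Context {R : realType} {d : measure_display} {T : measurableType d}.
Variable P : probability T R.
Local Open Scope ereal_scope.

Lemma nneseries_le (u : nat -> \bar R) (C : \bar R) : (forall n, 0 <= u n) ->
  (forall n, \sum_(0 <= k < n) u k <= C) -> \sum_(0 <= k <oo) u k <= C.
Proof.
move=> u0 uC; apply: lime_le; first exact: is_cvg_nneseries.
exact: nearW.
Qed.

(** The sum of the series has a finite integral, hence is finite almost everywhere. *)
Lemma ae_bounded_sums (g : nat -> T -> R) (C : R) :
  (forall n, measurable_fun setT (g n)) -> (forall n w, (0 <= g n w)%R) ->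
  (forall n, \sum_(0 <= t < n) \int[P]_w (g t w)%:E <= C%:E) ->
  {ae P, forall w, exists B : R, forall n, (\sum_(0 <= t < n) g t w <= B)%R}.
Proof.
move=> mg g0 gC.
pose G w := \sum_(0 <= t <oo) (g t w)%:E.
have G0 w : 0 <= G w by apply: nneseries_ge0 => n _ _; rewrite lee_fin.
have mG : measurable_fun setT G.
  by apply: ge0_emeasurable_sum => // n; [move=> w _ _; rewrite lee_fin|move=> _; exact/measurable_EFinP].
have intG : P.-integrable setT G.
  apply/integrableP; split => //.
  under eq_integral do rewrite gee0_abs//.
  rewrite /G integral_nneseries//; last 2 first.
  - by move=> n; exact/measurable_EFinP.
  - by move=> n w _; rewrite lee_fin.
  apply: (@le_lt_trans _ _ C%:E); last exact: ltry.
  apply: nneseries_le => // n; apply: integral_ge0 => w _; by rewrite lee_fin.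
have := integrable_ae measurableT intG.
apply: filterS => w /(_ I) Gfin; exists (fine (G w)) => n.
rewrite -lee_fin fineK// -sumEFin; apply: nneseries_lim_ge => t _ _.
by rewrite lee_fin.
Qed.

(** The first Borel-Cantelli lemma. *)
Lemma borel_cantelli (F : nat -> set T) (C : R) :
  (forall n, measurable (F n)) -> (forall n, \sum_(0 <= t < n) P (F t) <= C%:E) ->
  {ae P, forall w, exists K, forall k, (K <= k)%N -> ~ F k w}.
Proof.
move=> mF FC; have F0 := lim_sup_set_cvg0 (mu := P) mF.
exists (lim_sup_set F); split.
- apply: bigcapT_measurable => n; apply: bigcup_measurable => k _; exact: mF.
- apply: F0; apply: (@le_lt_trans _ _ C%:E); last exact: ltry.
  by apply: nneseries_le => // n; exact: measure_ge0.
- move=> w /= h n _; apply: contrapT => hn; apply: h; exists n => k nk Fk.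
  by apply: hn; exists k.
Qed.

End Almost_sure_sums.

Section Chernoff.
Context {R : realType} {d : measure_display} {T : measurableType d}.
Variable P : probability T R.

(** From [1 - x <= exp (- x)]. *)
Lemma expR_quad (x : R) : x <= 1 / 2 -> expR x <= 1 + x + 2 * x ^+ 2.
Proof.
move=> x2; have h := expR_ge1Dx (- x).
have e0 := expR_gt0 x.
have y1 : expR x * (1 - x) <= 1.
  by rewrite -[X in _ <= X](mulfV (lt0r_neq0 e0)) -expRN ler_wpM2l// ltW.
have x0 : 0 < 1 - x by lra.
rewrite -(ler_pM2r x0) (le_trans y1)//.
have -> : (1 + x + 2 * x ^+ 2) * (1 - x) = 1 + x ^+ 2 * (1 - 2 * x) by ring.
by rewrite lerDl mulr_ge0 ?sqr_ge0//; lra.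
Qed.

Local Open Scope ereal_scope.

Lemma integral_one : \int[P]_w 1 = 1 :> \bar R.
Proof.
rewrite -[RHS](probability_setT P) -[RHS]mul1e.
exact: (integral_cst P measurableT 1).
Qed.

Lemma bounded_integrable (f : T -> R) (C : R) : measurable_fun setT f ->
  (forall w, (`|f w| <= C)%R) -> P.-integrable setT (EFin \o f).
Proof.
move=> mf fC; apply: measurable_bounded_integrable => //.
  by rewrite (le_lt_trans (probability_le1 P measurableT))// ltry.
by exists C; split; [exact: num_real|move=> x Cx w _; rewrite /= (le_trans (fC w))// ltW].
Qed.

(** Integrate [expR_quad] and use [1 + x <= exp x]. *)
Lemma mgf_le (X : T -> R) (l m v : R) : measurable_fun setT X -> (0 < l)%R ->
  (forall w, (l * `|X w| <= 1 / 2)%R) ->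
  \int[P]_w (X w)%:E <= m%:E -> \int[P]_w (X w ^+ 2)%:E <= v%:E ->
  \int[P]_w (expR (l * X w))%:E <= (expR (l * m + 2 * l ^+ 2 * v))%:E.
Proof.
move=> mX l0 Xb Xm Xv.
have bX w : (`|X w| <= 1 / 2 / l)%R by rewrite ler_pdivlMr// mulrC.
have iX := bounded_integrable mX bX.
have mX2 : measurable_fun setT (fun w => X w ^+ 2)%R by exact: measurable_funX.
have bX2 w : (`|X w ^+ 2| <= (1 / 2 / l) ^+ 2)%R.
  by rewrite normrX ler_pXn2r// nnegrE// (le_trans _ (bX w)).
have iX2 := bounded_integrable mX2 bX2.
have i1 : P.-integrable setT (cst 1%:E) by exact: finite_measure_integrable_cst.
apply: (@le_trans _ _ (\int[P]_w (1%:E + (l%:E * (X w)%:E + (2 * l ^+ 2)%:E * (X w ^+ 2)%:E)))).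
  apply: ge0_le_integral => //.
  - apply/measurable_EFinP; apply: measurableT_comp => //; exact: measurable_funM.
  - under eq_fun do rewrite -!EFinM -!EFinD.
    apply/measurable_EFinP; apply: measurable_funD => //; apply: measurable_funD; exact: measurable_funM.
  - move=> w _; rewrite -!EFinM -!EFinD lee_fin.
    have lX : (l * X w <= 1 / 2)%R by rewrite (le_trans _ (Xb w))// (ler_wpM2l (ltW l0))// ler_norm.
    rewrite (le_trans (expR_quad lX))// exprMn; lra.
rewrite integralD//; last first.
  by apply: integrableD => //; exact: integrableZl.
rewrite integralD//; [|exact: integrableZl|exact: integrableZl].
rewrite integral_one !integralZl//.
apply: (@le_trans _ _ (1%:E + (l%:E * m%:E + (2 * l ^+ 2)%:E * v%:E))).
  have l1 := ltW l0.
  rewrite leeD2l// leeD// lee_wpmul2l// lee_fin.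
  by rewrite mulr_ge0// exprn_ge0.
by rewrite -!EFinM -!EFinD lee_fin expR_ge1Dx.
Qed.

Variable eps : nat -> {RV P >-> R[i]}.
Hypothesis eps_indep : mutually_independent eps.

(** Markov's inequality for the exponential of the sum, whose mean is a product by
    independence. *)
Lemma chernoff_sum (s : seq nat) (phi : nat -> R[i] -> R) (m v : nat -> R) (l x : R) :
  uniq s -> (forall t, t \in s -> (0 < t)%N) -> (0 < l)%R ->
  (forall t, measurable_fun setT (phi t)) ->
  (forall t, t \in s -> forall z, (l * `|phi t z| <= 1 / 2)%R) ->
  (forall t, t \in s -> \int[P]_w (phi t (eps t w))%:E <= (m t)%:E) ->
  (forall t, t \in s -> \int[P]_w (phi t (eps t w) ^+ 2)%:E <= (v t)%:E) ->
  P [set w | (x <= \sum_(t <- s) phi t (eps t w))%R] <=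
    (expR (l * \sum_(t <- s) m t + 2 * l ^+ 2 * \sum_(t <- s) v t - l * x))%:E.
Proof.
move=> us s0 l0 mphi bphi hm hv.
have meps t : measurable_fun setT (eps t) by exact: measurable_funPT.
set A := [set w | _].
have mS : measurable_fun setT (fun w => \sum_(t <- s) phi t (eps t w))%R.
  by apply: measurable_sum => t; exact: measurableT_comp.
have mA : measurable A.
  rewrite /A -[X in measurable X]setTI.
  rewrite (_ : [set w | _] = (fun w => \sum_(t <- s) phi t (eps t w))%R @^-1` `[x, +oo[%classic).
    by apply: mS => //; exact: measurable_itv.
  by apply/seteqP; split => w /=; rewrite in_itv /= andbT.
pose f t z := (if t \in s then expR (l * phi t z) else 1)%R.
have mf t : measurable_fun setT (f t).
  rewrite /f; case: (t \in s); last exact: measurable_cst.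
  apply: measurableT_comp => //; exact: measurable_funM.
have f0 t z : (0 <= f t z)%R by rewrite /f; case: ifP; rewrite ?expR_ge0.
have fle t : t \in s -> \int[P]_w (f t (eps t w))%:E <=
    (expR (l * m t + 2 * l ^+ 2 * v t))%:E.
  move=> ts; rewrite /f ts; apply: mgf_le => //.
  - exact: measurableT_comp.
  - by move=> w; exact: bphi.
  - exact: hm.
  - exact: hv.
have ffin t : \int[P]_w (f t (eps t w))%:E = (fine (\int[P]_w (f t (eps t w))%:E))%:E.
  rewrite fineK// ge0_fin_numE; last by apply: integral_ge0 => w _; rewrite lee_fin.
  have [ts|ts] := boolP (t \in s); first by rewrite (le_lt_trans (fle _ ts))// ltry.
  rewrite /f (negbTE ts) integral_one; exact: ltry.
have hprod := indep_prod eps_indep us s0 mf f0 ffin.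
apply: (@le_trans _ _ (\int[P]_w ((expR (- (l * x)))%:E * (\prod_(t <- s) f t (eps t w))%:E))).
  have := integral_indic P measurableT mA; rewrite setIT => <-.
  apply: ge0_le_integral => //.
  - by apply/measurable_EFinP; exact: measurable_indic.
  - apply/measurable_EFinP/measurable_funM => //.
    by apply: measurable_prod => t _; exact: measurableT_comp.
  move=> w _; rewrite -EFinM lee_fin indicE.
  have [wA|wA] := boolP (w \in A); last first.
    by rewrite mulr_ge0 ?expR_ge0// prodr_ge0.
  move: wA; rewrite inE /A /= => xS.
  have -> : (\prod_(t <- s) f t (eps t w) = expR (l * \sum_(t <- s) phi t (eps t w)))%R.
    rewrite mulr_sumr expR_sum; apply: eq_big_seq => t ts; by rewrite /f ts.
  by rewrite -expRD -[X in (X <= _)%R]expR0 ler_expR addrC subr_ge0 (ler_wpM2l (ltW l0)).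
rewrite ge0_integralZl_EFin ?expR_ge0//; last 2 first.
- by move=> w _; rewrite lee_fin prodr_ge0.
- by apply/measurable_EFinP; apply: measurable_prod => t _; exact: measurableT_comp.
rewrite hprod -EFinM lee_fin addrC expRD ler_wpM2l ?expR_ge0//.
rewrite !mulr_sumr -big_split /= expR_sum.
rewrite big_seq [leRHS]big_seq; apply: ler_prod => t ts; apply/andP; split.
  by rewrite fine_ge0// integral_ge0// => w _; rewrite lee_fin.
by rewrite -lee_fin -ffin fle.
Qed.

End Chernoff.

(** * Random waves over blocks of doubly exponential length *)

Section Truncation.
Context {R : realType}.

Definition trunc (u : R) (z : R[i]) : R[i] := if normc z <= u then z else 0.

Lemma normc_trunc_le u z : 0 <= u -> normc (trunc u z) <= u.
Proof. by move=> u0; rewrite /trunc; case: ifP => //; rewrite normc0. Qed.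

Lemma measurable_normc_le (u : R) : measurable_fun [set: R[i]] (fun z => normc z <= u).
Proof. by apply: measurable_fun_ler => //; exact: measurable_normc. Qed.

Lemma measurable_Re_trunc u : measurable_fun setT (fun z => complex.Re (trunc u z)).
Proof.
have -> : (fun z => complex.Re (trunc u z)) =
    (fun z => if normc z <= u then complex.Re z else 0).
  by apply/funext => z; rewrite /trunc; case: ifP.
apply: measurable_fun_ifT => //; [exact: measurable_normc_le|exact: measurable_Re].
Qed.

Lemma measurable_Im_trunc u : measurable_fun setT (fun z => complex.Im (trunc u z)).
Proof.
have -> : (fun z => complex.Im (trunc u z)) =
    (fun z => if normc z <= u then complex.Im z else 0).
  by apply/funext => z; rewrite /trunc; case: ifP.
apply: measurable_fun_ifT => //; [exact: measurable_normc_le|exact: measurable_Im].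
Qed.

Lemma measurable_normc_trunc u : measurable_fun setT (fun z => normc (trunc u z)).
Proof.
have -> : (fun z => normc (trunc u z)) = (fun z => if normc z <= u then normc z else 0).
  by apply/funext => z; rewrite /trunc; case: ifP => // _; rewrite normc0.
apply: measurable_fun_ifT => //; [exact: measurable_normc_le|exact: measurable_normc].
Qed.

(** The four real linear forms [Re], [- Re], [Im], [- Im]: together they control
    the modulus. *)
Definition axis (b : bool * bool) (z : R[i]) : R :=
  (if b.2 then 1 else -1) * (if b.1 then complex.Re z else complex.Im z).

Lemma axis_sum b (s : seq nat) (F : nat -> R[i]) :
  axis b (\sum_(t <- s) F t) = \sum_(t <- s) axis b (F t).
Proof. by rewrite /axis -mulr_sumr; case: b.1; rewrite ?Re_sum ?Im_sum. Qed.

Lemma axis_le b z : `|axis b z| <= normc z.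
Proof.
rewrite /axis normrM; have -> : `|if b.2 then 1 else -1 : R| = 1.
  by case: b.2; rewrite ?normrN normr1.
by rewrite mul1r; case: b.1; [exact: abs_Re_le|exact: abs_Im_le].
Qed.

Lemma normc_le_axis z x : (forall b, axis b z <= x) -> normc z <= 2 * x.
Proof.
move=> h; rewrite (le_trans (normc_le_ReIm z))// mulr2n mulrDl mul1r lerD// ler_norml.
  by have := h (true, true); have := h (true, false); rewrite /axis /=; lra.
by have := h (false, true); have := h (false, false); rewrite /axis /=; lra.
Qed.

Lemma axis_expi b x : exists p q : R, [/\ `|p| <= 1, `|q| <= 1 &
  forall z, axis b (expi x * z) = p * complex.Re z + q * complex.Im z].
Proof.
have s1 := sin_max x; have c1 := cos_max x.
case: b => -[] [].
- exists (cos x), (- sin x); rewrite normrN; split => // -[y y']; rewrite /axis /=; ring.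
- exists (- cos x), (sin x); rewrite normrN; split => // -[y y']; rewrite /axis /=; ring.
- exists (sin x), (cos x); split => // -[y y']; rewrite /axis /=; ring.
- exists (- sin x), (- cos x); rewrite !normrN; split => // -[y y']; rewrite /axis /=; ring.
Qed.

End Truncation.

Section Dyadic_blocks.
Context {R : realType}.

(** The blocks (D k, D k.+1] square their end points, so that the logarithm of
    the length of a block doubles from each block to the next. *)
Definition D (k : nat) : nat := 2 ^ (2 ^ k).

Lemma D_gt0 k : (0 < D k)%N. Proof. by rewrite expn_gt0. Qed.

Lemma D_mono k l : (k <= l)%N -> (D k <= D l)%N.
Proof. by move=> kl; rewrite leq_pexp2l// leq_pexp2l. Qed.

Lemma D_unbounded n : exists2 k, (0 < k)%N & (n <= D k)%N.
Proof.
exists n.+1 => //; apply: (leq_trans (ltnW (ltn_expl n (ltnSn 1)))).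
by rewrite leq_pexp2l// (leq_trans (leqnSn n))// ltnW// ltn_expl.
Qed.

Definition wave (Y : nat -> R[i]) (m n : nat) (theta : R) : R[i] :=
  \sum_(m.+1 <= t < n.+1) (Y t / t%:R) * expi (t%:R * theta).

Lemma wave_cat Y m n p theta : (m <= n)%N -> (n <= p)%N ->
  wave Y m p theta = wave Y m n theta + wave Y n p theta.
Proof. by move=> mn np; rewrite /wave -big_cat_nat. Qed.

Lemma wave_periodic Y m n theta (k : int) :
  wave Y m n (theta + 2 * pi * k%:~R) = wave Y m n theta.
Proof.
apply: eq_bigr => t _; rewrite mulrDr.
have -> : t%:R * (2 * pi * k%:~R) = 2 * pi * (t%:Z * k)%:~R :> R.
  by rewrite intrM; ring.
by rewrite expi_periodic.
Qed.

Lemma normc_wave_le Y m n theta :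
  normc (wave Y m n theta) <= \sum_(m.+1 <= t < n.+1) normc (Y t) / t%:R.
Proof.
rewrite (le_trans (normc_sum _ _ _))//; apply: ler_sum => t _.
by rewrite !normcM normc_expi mulr1 normcV normc_nat.
Qed.

(** The first K blocks contribute a finite quantity, independent of theta, and the
    partial sums over the later ones add up. *)
Lemma blocks_bounded (Y : nat -> R[i]) (b : nat -> R) (K : nat) (B : R) :
  (forall k n theta, (K <= k)%N -> (D k < n)%N -> (n <= D k.+1)%N ->
     normc (wave Y (D k) n theta) <= b k) ->
  (forall k, 0 <= b k) ->
  (forall n, \sum_(0 <= k < n) b k <= B) ->
  exists B' : R, forall n theta, normc (wave Y 0 n theta) <= B'.
Proof.
move=> hb b0 hB.
pose B0 := \sum_(1 <= t < (D K).+1) normc (Y t) / t%:R.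
have t0 t : 0 <= normc (Y t) / t%:R by rewrite divr_ge0 ?normc_ge0.
have small n theta : (n <= D K)%N -> normc (wave Y 0 n theta) <= B0.
  move=> nK; rewrite (le_trans (normc_wave_le _ _ _ _))//.
  by rewrite /B0 (@big_cat_nat _ _ _ n.+1 1 (D K).+1)//= lerDl sumr_ge0.
have step l n theta : (n <= D (K + l))%N ->
    normc (wave Y 0 n theta) <= B0 + \sum_(K <= k < K + l) b k.
  elim: l n => [|l IH] n.
    by rewrite addn0 big_geq// addr0; exact: small.
  rewrite addnS => nl; rewrite big_nat_recr /= ?leq_addr// addrA.
  have [nl'|nl'] := leqP n (D (K + l)); first by rewrite (le_trans (IH _ nl'))// lerDl.
  rewrite (@wave_cat _ 0 (D (K + l)) n)// ?(ltnW nl')//.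
  by rewrite (le_trans (le_normcD _ _))// lerD ?IH// hb ?leq_addr.
exists (B0 + B) => n theta; have [k _ nk] := D_unbounded n.
have nk' : (n <= D (K + k))%N by rewrite (leq_trans nk)// D_mono// leq_addl.
rewrite (le_trans (step _ _ _ nk'))// lerD2l (le_trans _ (hB (K + k)%N))//.
by rewrite (@big_cat_nat _ _ _ K 0 (K + k))//= ?leq_addr// lerDr sumr_ge0.
Qed.

(** Between neighbouring points of a grid of mesh 2 pi / n ^ 2 a sum of n waves of
    frequency at most n changes little; here Mt bounds the amplitudes. *)
Lemma wave_lipschitz Y m n Mt theta theta' :
  (forall t, (m < t)%N -> (t <= n)%N -> normc (Y t) / t%:R <= Mt) -> 0 <= Mt ->
  normc (wave Y m n theta - wave Y m n theta') <=
    2 * Mt * n%:R ^+ 2 * `|theta - theta'|.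
Proof.
move=> hM M0; rewrite /wave -sumrB (le_trans (normc_sum _ _ _))//.
apply: (@le_trans _ _ (\sum_(m.+1 <= t < n.+1) Mt * (2 * (n%:R * `|theta - theta'|)))).
  rewrite big_nat [leRHS]big_nat; apply: ler_sum => t /andP[mt tn].
  rewrite -mulrBr normcM normcM normcV normc_nat; apply: ler_pM; rewrite ?normc_ge0//.
    by rewrite divr_ge0 ?normc_ge0.
    exact: hM.
  rewrite (le_trans (expi_lipschitz _ _))// ler_wpM2l// -mulrBr normrM normr_nat.
  by rewrite ler_wpM2r// ler_nat.
rewrite sumr_const_nat -[_ *+ (_ - _)]mulr_natr.
have -> : 2 * Mt * n%:R ^+ 2 * `|theta - theta'| = Mt * (2 * (n%:R * `|theta - theta'|)) * n%:R by ring.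
by rewrite ler_wpM2l ?mulr_ge0// ler_nat leq_subLR addSn addnC; lia.
Qed.

End Dyadic_blocks.

Section Random_blocks.
Context {R : realType} {d : measure_display} {T : measurableType d}.
Variable P : probability T R.
Variable eps : nat -> {RV P >-> R[i]}.
Hypothesis eps_indep : mutually_independent eps.
Local Open Scope ereal_scope.

Lemma measure_finite_union (I : finType) (A : I -> set T) (c : R) :
  (forall i, measurable (A i)) -> (forall i, P (A i) <= c%:E) ->
  measurable (\big[setU/set0]_i A i) /\ P (\big[setU/set0]_i A i) <= (#|I|%:R * c)%:E.
Proof.
move=> mA hA; split; first exact: bigsetU_measurable.
have -> : #|I| = size (index_enum I) by rewrite cardT enumT [index_enum _]unlock.
elim: (index_enum I) => [|i s IH].
  by rewrite big_nil measure0 mul0r.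
rewrite big_cons /= -addn1 natrD mulrDl mul1r addrC EFinD.
rewrite (le_trans (measureU2 _ (mA i) _))//; first exact: bigsetU_measurable.
exact: (leeD (hA i) IH).
Qed.

(** The bounded real random variables to which Chernoff's bound is applied. *)
Definition axis_wave (u : nat -> R) (b : bool * bool) (theta : R) (t : nat) (z : R[i]) : R :=
  axis b (expi (t%:R * theta) * (trunc (u t) z / t%:R))%R.

Lemma axis_wave_le u b theta t z : (0 <= u t)%R -> (`|axis_wave u b theta t z| <= u t / t%:R)%R.
Proof.
move=> u0; rewrite (le_trans (axis_le _ _))// !normcM normc_expi mul1r normcV normc_nat.
by rewrite ler_wpM2r ?invr_ge0// normc_trunc_le.
Qed.

Lemma axis_waveE u b theta t : exists p q : R, [/\ (`|p| <= 1)%R, (`|q| <= 1)%R &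
  forall z, axis_wave u b theta t z =
    (p / t%:R * complex.Re (trunc (u t) z) + q / t%:R * complex.Im (trunc (u t) z))%R].
Proof.
have [p [q [p1 q1 pq]]] := axis_expi b (t%:R * theta)%R.
exists p, q; split=> // z; rewrite /axis_wave pq.
have -> : (trunc (u t) z / t%:R = (t%:R^-1)%:C * trunc (u t) z)%R.
  by rewrite mulrC fmorphV rmorph_nat.
by case: (trunc (u t) z) => y y' /=; rewrite !mul0r subr0 addr0; ring.
Qed.

Lemma measurable_axis_wave u b theta t : measurable_fun setT (axis_wave u b theta t).
Proof.
have [p [q [_ _ pq]]] := axis_waveE u b theta t; rewrite (funext pq).
apply: measurable_funD; apply: measurable_funM => //;
  [exact: measurable_Re_trunc|exact: measurable_Im_trunc].
Qed.

Lemma axis_wave_mean u b theta t (m : R) : (0 < t)%N -> (0 <= u t)%R ->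
  `|\int[P]_w (complex.Re (trunc (u t) (eps t w)))%:E| <= (t%:R * m)%:E ->
  `|\int[P]_w (complex.Im (trunc (u t) (eps t w)))%:E| <= (t%:R * m)%:E ->
  \int[P]_w (axis_wave u b theta t (eps t w))%:E <= (2 * m)%:E.
Proof.
move=> t0 u0; set I1 := \int[P]_w _; set I2 := \int[P]_w _ => h1 h2.
have meps : measurable_fun setT (eps t) by exact: measurable_funPT.
have i1 : P.-integrable setT (fun w => (complex.Re (trunc (u t) (eps t w)))%:E).
  apply: (@bounded_integrable _ _ _ _ (fun w => complex.Re (trunc (u t) (eps t w))) (u t)).
    exact: (measurableT_comp (measurable_Re_trunc _) meps).
  by move=> w; rewrite (le_trans (abs_Re_le _))// normc_trunc_le.
have i2 : P.-integrable setT (fun w => (complex.Im (trunc (u t) (eps t w)))%:E).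
  apply: (@bounded_integrable _ _ _ _ (fun w => complex.Im (trunc (u t) (eps t w))) (u t)).
    exact: (measurableT_comp (measurable_Im_trunc _) meps).
  by move=> w; rewrite (le_trans (abs_Im_le _))// normc_trunc_le.
have [p [q [p1 q1 pq]]] := axis_waveE u b theta t.
under eq_integral do rewrite pq EFinD !(EFinM (_ / _)).
rewrite integralD//; [|exact: integrableZl|exact: integrableZl].
rewrite !integralZl// -/I1 -/I2.
have tr : (0 < t%:R :> R)%R by rewrite ltr0n.
have bound (r : R) I : (`|r| <= 1)%R -> `|I| <= (t%:R * m)%:E -> (r / t%:R)%:E * I <= m%:E.
  case: I => [x| |] //= r1; rewrite ?leye_eq// lee_fin => xm.
  rewrite -EFinM lee_fin mulrAC ler_pdivrMr// (le_trans (ler_norm _))// normrM [leRHS]mulrC.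
  by rewrite (le_trans _ xm)// ler_piMl.
by rewrite mulr2n mulrDl mul1r EFinD leeD// bound.
Qed.

Lemma axis_wave_var u b theta t (v : R) : (0 < t)%N -> (0 <= u t)%R ->
  \int[P]_w (normc (trunc (u t) (eps t w)) ^+ 2)%:E <= (t%:R ^+ 2 * v)%:E ->
  \int[P]_w (axis_wave u b theta t (eps t w) ^+ 2)%:E <= v%:E.
Proof.
move=> t0 u0 hv; have meps : measurable_fun setT (eps t) by exact: measurable_funPT.
have tr : (0 < t%:R :> R)%R by rewrite ltr0n.
have mn : measurable_fun setT (fun w => normc (trunc (u t) (eps t w)) ^+ 2)%R.
  by apply: measurable_funX; exact: (measurableT_comp (measurable_normc_trunc _) meps).
apply: (@le_trans _ _ (\int[P]_w ((t%:R ^- 2)%:E * (normc (trunc (u t) (eps t w)) ^+ 2)%:E))).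
  apply: ge0_le_integral => //.
  - by move=> w _; rewrite lee_fin sqr_ge0.
  - apply/measurable_EFinP/measurable_funX.
    exact: (measurableT_comp (measurable_axis_wave _ _ _ _) meps).
  - by apply/measurable_EFinP; exact: measurable_funM.
  - move=> w _; rewrite -EFinM lee_fin -[X in (X <= _)%R]real_normK ?num_real//.
    have -> : (t%:R ^- 2 * normc (trunc (u t) (eps t w)) ^+ 2 = (normc (trunc (u t) (eps t w)) / t%:R) ^+ 2)%R.
      by rewrite exprMn exprVn mulrC.
    rewrite ler_pXn2r ?nnegrE ?divr_ge0 ?normc_ge0// (le_trans (axis_le _ _))//.
    by rewrite !normcM normc_expi mul1r normcV normc_nat.
rewrite ge0_integralZl_EFin//; last 2 first.
- by move=> w _; rewrite lee_fin sqr_ge0.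
- exact/measurable_EFinP.
apply: (@le_trans _ _ ((t%:R ^- 2)%:E * (t%:R ^+ 2 * v)%:E)).
  by rewrite lee_wpmul2l// lee_fin invr_ge0 exprn_ge0.
by rewrite -EFinM lee_fin mulKf// expf_neq0// gt_eqF.
Qed.

(** A union bound over the partial sums of a block, a fine grid and the four axes:
    the number of events is at most (2 ^ 9) ^ (2 ^ k), which Chernoff's bound beats. *)
Lemma block_deviation (u : nat -> R) (m v : nat -> R) (l C : R) (k : nat) :
  (0 < l)%R -> (0 <= C)%R ->
  (forall t, (0 <= m t)%R) -> (forall t, (0 <= v t)%R) ->
  (forall t, (D k < t)%N -> (t <= D k.+1)%N ->
    [/\ (0 <= u t)%R, (l * (u t / t%:R) <= 1 / 2)%R,
        `|\int[P]_w (complex.Re (trunc (u t) (eps t w)))%:E| <= (t%:R * m t)%:E,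
        `|\int[P]_w (complex.Im (trunc (u t) (eps t w)))%:E| <= (t%:R * m t)%:E &
        \int[P]_w (normc (trunc (u t) (eps t w)) ^+ 2)%:E <= (t%:R ^+ 2 * v t)%:E]) ->
  (l ^+ 2 * \sum_((D k).+1 <= t < (D k.+1).+1) v t <= C * 2 ^+ k)%R ->
  exists E : set T, [/\ measurable E, P E <= ((1 / 2) ^+ k.+1)%:E &
    forall w, ~ E w -> forall n theta, (D k < n)%N -> (n <= D k.+1)%N ->
      (normc (wave (fun t => trunc (u t) (eps t w)) (D k) n theta) <=
        2 * (2 * (\sum_((D k).+1 <= t < (D k.+1).+1) m t) +
          (2 * C + ln (2 ^+ 10)) * 2 ^+ k / l) + 4 * pi / l)%R].
Proof.
move=> l0 C0 m0 v0 hyp hv.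
pose DD := D k.+1; pose M := (\sum_((D k).+1 <= t < DD.+1) m t)%R.
(* the deviation at which Chernoff's bound is exp (- 2 ^ k ln 2 ^ 10), which leaves
   the factor 2 ^ (- 2 ^ k) after the union over (2 ^ 9) ^ (2 ^ k) events *)
pose x := (2 * M + (2 * C + ln (2 ^+ 10)) * 2 ^+ k / l)%R.
pose angle (j : nat) : R := (- pi + 2 * pi * j%:R / DD%:R ^+ 2)%R.
pose I : finType := ('I_DD.+1 * 'I_(DD ^ 2) * (bool * bool))%type.
pose A (i : I) := if (D k < i.1.1)%N then
  [set w | (x <= \sum_((D k).+1 <= t < i.1.1.+1) axis_wave u i.2 (angle i.1.2) t (eps t w))%R]
  else set0.
pose c : R := (expR (- (ln (2 ^+ 10) * 2 ^+ k)))%R.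
have meps t : measurable_fun setT (eps t) by exact: measurable_funPT.
have mA i : measurable (A i).
  rewrite /A; case: ifP => // _.
  rewrite -[X in measurable X]setTI.
  rewrite (_ : [set w | _] = (fun w => \sum_((D k).+1 <= t < i.1.1.+1)
      axis_wave u i.2 (angle i.1.2) t (eps t w))%R @^-1` `[x, +oo[%classic).
    have mS : measurable_fun setT (fun w => \sum_((D k).+1 <= t < i.1.1.+1)
        axis_wave u i.2 (angle i.1.2) t (eps t w))%R.
      by apply: measurable_sum => t; exact: (measurableT_comp (measurable_axis_wave _ _ _ _) (meps t)).
    by apply: mS => //; exact: measurable_itv.
  by apply/seteqP; split => w /=; rewrite in_itv /= andbT.
have sub_le (g : nat -> R) n : (forall t, 0 <= g t)%R -> (D k < n)%N -> (n <= DD)%N ->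
    (\sum_((D k).+1 <= t < n.+1) g t <= \sum_((D k).+1 <= t < DD.+1) g t)%R.
  move=> g0 kn nD; rewrite [leRHS](@big_cat_nat _ _ _ n.+1)//=; last by rewrite ltnS ltnW.
  by rewrite lerDl sumr_ge0.
have PA i : P (A i) <= c%:E.
  rewrite /A; case: ifP => [kn|_]; last by rewrite measure0 lee_fin expR_ge0.
  have nD : (i.1.1 <= DD)%N by rewrite -ltnS.
  have hyp' t : t \in index_iota (D k).+1 i.1.1.+1 -> (D k < t)%N /\ (t <= DD)%N.
    by rewrite mem_index_iota => /andP[t1 t2]; split => //; rewrite -ltnS (leq_trans t2)// ltnS.
  apply: (le_trans (@chernoff_sum _ _ _ _ _ eps_indep (index_iota (D k).+1 i.1.1.+1)
    (axis_wave u i.2 (angle i.1.2)) (fun t => 2 * m t)%R v l x _ _ l0 _ _ _ _)).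
  - exact: iota_uniq.
  - by move=> t /hyp'[t1 _]; apply: leq_ltn_trans t1.
  - by move=> t; exact: measurable_axis_wave.
  - move=> t /hyp'[t1 t2] z; have [u0 lu _ _ _] := hyp _ t1 t2.
    by rewrite (le_trans _ lu)// ler_wpM2l ?(ltW l0)// axis_wave_le.
  - move=> t /hyp'[t1 t2]; have [u0 _ h1 h2 _] := hyp _ t1 t2.
    by apply: axis_wave_mean => //; apply: leq_ltn_trans t1.
  - move=> t /hyp'[t1 t2]; have [u0 _ _ _ h3] := hyp _ t1 t2.
    by apply: axis_wave_var => //; apply: leq_ltn_trans t1.
  rewrite lee_fin ler_expR -mulr_sumr /x.
  have h1 := sub_le m _ m0 kn nD; have h2 := sub_le v _ v0 kn nD.
  have h3 := ler_wpM2l (ltW l0) h1; rewrite -/M in h3.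
  have h4 := ler_wpM2l (sqr_ge0 l) h2.
  have -> : (l * (2 * M + (2 * C + ln (2 ^+ 10)) * 2 ^+ k / l) = 2 * (l * M) + (2 * C + ln (2 ^+ 10)) * 2 ^+ k)%R.
    by field; rewrite gt_eqF.
  have h5 := le_trans h4 hv; lra.
have [mE PE] := measure_finite_union mA PA.
exists (\big[setU/set0]_i A i); split => //.
  rewrite (le_trans PE)// lee_fin /c expRN -[(2 ^+ k)%R](natrX _ 2 k) expRM_natr lnK ?posrE ?exprn_gt0//.
  have card_le : (#|I| <= (2 ^ 9) ^ (2 ^ k))%N.
    rewrite !card_prod !card_ord card_bool /DD /D (expnS 2 k) (expnM 2 2) -[(2 ^ 2)%N]/4%N.
    set y := (2 ^ k)%N; have y0 : (0 < y)%N by rewrite expn_gt0.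
    have -> : ((2 ^ 9) ^ y = 8 ^ y * (4 ^ y * 4 ^ y * 4 ^ y))%N.
      by rewrite -!expnMn; congr (_ ^ _)%N.
    have h8 : (8 <= 8 ^ y)%N by rewrite -[X in (X <= _)%N](expn1 8) leq_pexp2l.
    have h4 : (1 <= 4 ^ y)%N by rewrite expn_gt0.
    move: (8 ^ y)%N (4 ^ y)%N h8 h4 => p q; clear => p8 q1.
    apply: (@leq_trans (8 * (q * q * q))%N); last by rewrite leq_mul2r p8 orbT.
    by rewrite (_ : (2 * 2 = 4)%N)//; nia.
  have pos : (0 < (2 ^+ 10) ^+ (2 ^ k) :> R)%R by rewrite !exprn_gt0.
  rewrite ler_pdivrMr//.
  apply: (@le_trans _ _ (((2 ^ 9) ^ (2 ^ k))%:R)%R); first by rewrite ler_nat.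
  have -> : (((2 ^ 9) ^ (2 ^ k))%:R = (1 / 2) ^+ (2 ^ k) * (2 ^+ 10) ^+ (2 ^ k) :> R)%R.
    rewrite (natrX _ (2 ^ 9)) natrX -exprMn; congr (_ ^+ _)%R.
    by rewrite (exprS _ 9) mulrA mul1r mulVf ?mul1r// pnatr_eq0.
  have half0 : (0 <= 1 / 2 :> R)%R by lra.
  have half1 : (1 / 2 <= 1 :> R)%R by lra.
  by rewrite (ler_wpM2r (ltW pos))// (ler_wiXn2l half0 half1)// ltn_expl.
have subE i : A i `<=` \big[setU/set0]_i A i.
  by rewrite (bigD1 i)//=; exact: subsetUl.
move=> w notE n theta kn nD.
have [z /andP[z1 z2]] := angle_reduce theta.
rewrite -(subrK (2 * pi * z%:~R)%R theta) wave_periodic.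
set th := (theta - _)%R in z1 z2 *.
have p0 : (0 < pi :> R)%R := pi_gt0 R.
have DD0 : (0 < DD%:R ^+ 2 :> R)%R by rewrite exprn_gt0// ltr0n D_gt0.
pose y := ((th + pi) * DD%:R ^+ 2 / (2 * pi))%R.
have p2 : (0 < 2 * pi :> R)%R by lra.
have z3 : (0 <= th + pi)%R by lra.
have y0 : (0 <= y)%R by rewrite /y (divr_ge0 _ (ltW p2))// (mulr_ge0 z3)// ltW.
have /andP[j1 j2] := truncn_itv y0.
set j := Num.trunc y in j1 j2.
have jD : (j < DD ^ 2)%N.
  rewrite -(ltr_nat R) (le_lt_trans j1)// natrX /y ltr_pdivrMr//.
  by rewrite mulrC ltr_pM2l//; lra.
have angle_near : (`|th - angle j| <= 2 * pi / DD%:R ^+ 2)%R.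
  have thE : (th = - pi + y * (2 * pi) / DD%:R ^+ 2)%R.
    by rewrite /y divfK ?gt_eqF// mulfK ?gt_eqF//; ring.
  rewrite {1}thE /angle.
  have -> : (- pi + y * (2 * pi) / DD%:R ^+ 2 - (- pi + 2 * pi * j%:R / DD%:R ^+ 2) =
      (y - j%:R) * (2 * pi / DD%:R ^+ 2))%R by ring.
  have q0 : (0 <= 2 * pi / DD%:R ^+ 2 :> R)%R by exact: (divr_ge0 (ltW p2) (ltW DD0)).
  rewrite normrM (ger0_norm q0) ler_piMl// ger0_norm ?subr_ge0//.
  by rewrite lerBlDl natr1 ltW.
set Y := (fun t => trunc (u t) (eps t w)).
have at_grid : (normc (wave Y (D k) n (angle j)) <= 2 * x)%R.
  apply: normc_le_axis => b.
  have := notE; apply: contra_notP => /negP; rewrite -ltNge => hx.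
  apply: (subE ((Ordinal (nD : (n < DD.+1)%N), Ordinal jD), b)).
  rewrite /A /= kn /= (le_trans (ltW hx))// /wave axis_sum ler_sum// => t _.
  by rewrite /axis_wave mulrC.
have amp t : (D k < t)%N -> (t <= n)%N -> (normc (Y t) / t%:R <= 1 / (2 * l))%R.
  move=> t1 t2; have [u0 lu _ _ _] := hyp _ t1 (leq_trans t2 nD).
  have h : (normc (Y t) / t%:R <= u t / t%:R)%R.
    by rewrite ler_wpM2r ?invr_ge0// normc_trunc_le.
  by rewrite (le_trans h)// ler_pdivlMr; lra.
have L := wave_lipschitz th (angle j) amp (ltac:(by rewrite divr_ge0// mulr_ge0// ltW)).
rewrite -[wave Y (D k) n th](subrK (wave Y (D k) n (angle j))) addrC (le_trans (le_normcD _ _))//.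
rewrite lerD// (le_trans L)//.
have n2 : (n%:R ^+ 2 <= DD%:R ^+ 2 :> R)%R by rewrite ler_pXn2r ?nnegrE// ler_nat.
have l10 : (0 <= 2 * (1 / (2 * l)))%R by rewrite !mulr_ge0// invr_ge0 mulr_ge0// ltW.
apply: (@le_trans _ _ (2 * (1 / (2 * l)) * DD%:R ^+ 2 * (2 * pi / DD%:R ^+ 2))%R).
  apply: ler_pM => //; first by rewrite mulr_ge0// exprn_ge0.
  by rewrite ler_wpM2l.
have -> : (2 * (1 / (2 * l)) * DD%:R ^+ 2 * (2 * pi / DD%:R ^+ 2) = 2 * pi / l)%R.
  have Dn0 : (DD%:R != 0 :> R)%R by rewrite pnatr_eq0 -lt0n D_gt0.
  have ln0 : (l != 0)%R by rewrite gt_eqF.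
  by field; rewrite Dn0 ln0.
by rewrite ler_wpM2r ?invr_ge0 ?(ltW l0)//; lra.
Qed.

Lemma sum_blocks (g : nat -> R) n :
  (\sum_(0 <= k < n) \sum_((D k).+1 <= t < (D k.+1).+1) g t =
   \sum_((D 0).+1 <= t < (D n).+1) g t)%R.
Proof.
elim: n => [|n IH]; first by rewrite !big_geq.
by rewrite big_nat_recr//= IH -big_cat_nat//= ltnS D_mono.
Qed.

Lemma sum_block_head (g : nat -> R) (B : R) : (forall t, 0 <= g t)%R ->
  (forall n, \sum_(1 <= t < n) g t <= B)%R ->
  forall n, (\sum_(0 <= k < n) \sum_((D k).+1 <= t < (D k.+1).+1) g t <= B)%R.
Proof.
move=> g0 gB n; rewrite sum_blocks (le_trans _ (gB (D n).+1))//.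
rewrite [leRHS](@big_cat_nat _ _ _ (D 0).+1)//= ?lerDr ?sumr_ge0//.
by rewrite ltnS D_mono.
Qed.

Lemma sum_half_powers n : (\sum_(0 <= k < n) (1 / 2 : R) ^+ k.+1 <= 1)%R.
Proof.
have -> : (\sum_(0 <= k < n) (1 / 2 : R) ^+ k.+1 = 1 - (1 / 2) ^+ n)%R.
  elim: n => [|n IH]; first by rewrite big_geq// expr0 subrr.
  by rewrite big_nat_recr//= IH exprS; lra.
by rewrite gerBl exprn_ge0//; lra.
Qed.

(** By Borel-Cantelli all but finitely many blocks obey [block_deviation], and the
    deviations it allows, of order 2 ^ k / l k and the sum of the means, are summable
    over the blocks. The remainder of the truncation is summable in absolute value,
    hence bounded uniformly in theta. *)
Theorem ae_partial_sums_bounded (u m v l : nat -> R) (C : R) : (0 <= C)%R ->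
  (forall k, 0 < l k)%R -> (forall t, 0 <= m t)%R -> (forall t, 0 <= v t)%R ->
  (forall k t, (0 < k)%N -> (D k < t)%N -> (t <= D k.+1)%N ->
    [/\ (0 <= u t)%R, (l k * (u t / t%:R) <= 1 / 2)%R,
        `|\int[P]_w (complex.Re (trunc (u t) (eps t w)))%:E| <= (t%:R * m t)%:E,
        `|\int[P]_w (complex.Im (trunc (u t) (eps t w)))%:E| <= (t%:R * m t)%:E &
        \int[P]_w (normc (trunc (u t) (eps t w)) ^+ 2)%:E <= (t%:R ^+ 2 * v t)%:E]) ->
  (forall k, (0 < k)%N ->
    (l k ^+ 2 * \sum_((D k).+1 <= t < (D k.+1).+1) v t <= C * 2 ^+ k)%R) ->
  (exists B : R, forall n, \sum_(0 <= k < n) 2 ^+ k / l k <= B)%R ->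
  (exists B : R, forall n, \sum_(1 <= t < n) m t <= B)%R ->
  {ae P, forall w, exists B : R, forall n,
    (\sum_(1 <= t < n) normc (eps t w - trunc (u t) (eps t w)) / t%:R <= B)%R} ->
  {ae P, forall w, exists B : R, forall n theta,
    (normc (wave (fun t => eps t w) 0 n theta) <= B)%R}.
Proof.
move=> C0 l0 m0 v0 hyp hv [Bl hBl] [Bm hBm] rest.
have /choice[E hE] k := block_deviation (l0 k.+1) C0 m0 v0 (hyp k.+1 ^~ erefl) (hv k.+1 erefl).
have evt : {ae P, forall w, exists K, forall k, (K <= k)%N -> ~ E k w}.
  apply: (borel_cantelli (C := 1)); first by move=> k; have [] := hE k.
  move=> n; apply: (@le_trans _ _ (\sum_(0 <= k < n) ((1 / 2) ^+ k.+1)%:E)).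
    apply: lee_sum => k _; have [_ Ek _] := hE k; rewrite (le_trans Ek)// lee_fin.
    by rewrite ler_wiXn2l//; lra.
  by rewrite sumEFin lee_fin sum_half_powers.
apply: filterS2 rest evt => w [B hB] [K hK].
pose Y t := trunc (u t) (eps t w).
pose q : R := (2 * (2 * C + ln (2 ^+ 10)) + 4 * pi)%R.
pose M k : R := (\sum_((D k).+1 <= t < (D k.+1).+1) m t)%R.
have M0 k : (0 <= M k)%R by exact: sumr_ge0.
have a0 : (0 <= ln (2 ^+ 10) :> R)%R by rewrite ln_ge0// exprn_ege1// ler1n.
have q0 : (0 <= q)%R by rewrite addr_ge0// mulr_ge0 ?pi_ge0// addr_ge0// mulr_ge0.
pose b k : R := (4 * M k + q * (2 ^+ k / l k))%R.
have p0 k : (0 <= 2 ^+ k / l k)%R by rewrite divr_ge0 ?exprn_ge0 ?(ltW (l0 k)).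
have [] := @blocks_bounded R Y b K.+1 (4 * Bm + q * Bl)%R.
- move=> [//|k] n theta Kk kn nD; have [_ _ /(_ w (hK k Kk) n theta kn nD)] := hE k.
  move=> h; apply: (le_trans h); rewrite -/(M k.+1) /q.
  have : (4 * pi / l k.+1 <= 4 * pi * (2 ^+ k.+1 / l k.+1))%R.
    rewrite ler_wpM2l ?mulr_ge0 ?pi_ge0//.
    by rewrite -[X in (X <= _)%R]mul1r ler_wpM2r ?invr_ge0 ?(ltW (l0 _))// exprn_ege1// ler1n.
  rewrite -(mulrA (2 * C + ln (2 ^+ 10))%R) /b /q.
  move: (2 ^+ k.+1 / l k.+1)%R (ln (2 ^+ 10) : R)%R (4 * pi / l k.+1)%R => y z y'; lra.
- by move=> k; rewrite addr_ge0// mulr_ge0.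
- move=> n; rewrite big_split /= -!mulr_sumr lerD// ler_wpM2l//.
  exact: sum_block_head.
move=> B' hB'; exists (B' + B)%R => n theta.
have -> : wave (fun t => eps t w) 0 n theta =
    (wave Y 0 n theta + wave (fun t => eps t w - Y t) 0 n theta)%R.
  rewrite /wave -big_split /=; apply: eq_bigr => t _.
  by rewrite -mulrDl -mulrDl addrC subrK.
by rewrite (le_trans (le_normcD _ _))// lerD// (le_trans (normc_wave_le _ _ _ _)).
Qed.

End Random_blocks.

(** * Estimates of sums over windows and blocks *)

Section Real_estimates.
Context {R : realType}.

Lemma sum_le_telescope (g Phi : nat -> R) (a b : nat) :
  (forall t, (a <= t)%N -> g t <= Phi t.+1 - Phi t) -> (a <= b)%N ->
  \sum_(a <= t < b) g t <= Phi b - Phi a.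
Proof.
move=> gP ab; rewrite -telescope_sumr// big_nat [leRHS]big_nat.
by apply: ler_sum => t /andP[at' _]; exact: gP.
Qed.

(** Compare [y / t ^ 2] with the decrement of [2 y / t] and stop at the level 1. *)
Lemma sum_inv_square_tail (y : R) (a b : nat) : 0 <= y -> (0 < a)%N ->
  \sum_(a <= t < b) (if y <= t%:R then y / t%:R ^+ 2 else 0) <= 2.
Proof.
move=> y0 a0; have [ab|/ltnW ba] := leqP a b; last by rewrite big_geq.
pose Phi t : R := - (2 * Num.min 1 (y / t%:R)).
have m0 t : 0 <= Num.min 1 (y / t%:R) by rewrite le_min ler01 divr_ge0.
apply: (@le_trans _ _ (Phi b - Phi a)); last first.
  rewrite /Phi; have := m0 b; have : Num.min 1 (y / a%:R) <= 1 by rewrite ge_min lexx.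
  lra.
apply: sum_le_telescope => // t ta.
have t0 : 0 < t%:R :> R by rewrite ltr0n (leq_trans a0).
have t1 : 0 < t.+1%:R :> R by rewrite ltr0n.
have dec : y / t.+1%:R <= y / t%:R by rewrite ler_wpM2l// lef_pV2 ?posrE// ler_nat.
rewrite /Phi opprK; case: ifPn => [yt|yt].
  have h1 : y / t%:R <= 1 by rewrite ler_pdivrMr ?mul1r.
  have h2 : y / t.+1%:R <= 1 by rewrite (le_trans dec).
  rewrite (min_idPr h1) (min_idPr h2).
  have -> : - (2 * (y / t.+1%:R)) + 2 * (y / t%:R) = 2 * y / (t%:R * t.+1%:R).
    have t1' := t1; rewrite -natr1 in t1' *; field; rewrite !gt_eqF//.
  rewrite expr2 ler_pdivrMr ?mulr_gt0// mulrAC ler_pdivlMr ?mulr_gt0//.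
  have tt : t.+1%:R <= 2 * t%:R :> R.
    by rewrite -natrM ler_nat mul2n -addnn -addn1 leq_add2l (leq_trans a0).
  have -> : y * (t%:R * t.+1%:R) = y * t%:R * t.+1%:R by ring.
  have -> : 2 * y * (t%:R * t%:R) = y * t%:R * (2 * t%:R) by ring.
  by rewrite ler_wpM2l// mulr_ge0// ltW.
have : Num.min 1 (y / t.+1%:R) <= Num.min 1 (y / t%:R).
  by rewrite le_min ge_min lexx /= ge_min dec orbT.
lra.
Qed.

Lemma ln_nat_step (t : nat) : (0 < t)%N -> ln t%:R <= ln t.+1%:R - t.+1%:R^-1 :> R.
Proof.
move=> t0; have tr : 0 < t%:R :> R by rewrite ltr0n.
have t1 : 0 < t.+1%:R :> R by rewrite ltr0n.
have := @le_ln1Dx R (- t.+1%:R^-1); rewrite ltrNl opprK invf_lt1// ltr1n ltnS t0 => /(_ erefl).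
have -> : 1 - t.+1%:R^-1 = t%:R / t.+1%:R :> R.
  have e : t%:R = t.+1%:R - 1 :> R by rewrite -natr1 addrK.
  by rewrite e mulrBl mulfV ?lt0r_neq0// mul1r.
by rewrite ln_div ?posrE// lerBlDr addrC.
Qed.

Lemma inv_le_ln (t : nat) : (0 < t)%N ->
  t%:R^-1 <= 2 * (ln t.+1%:R - ln t%:R) :> R.
Proof.
move=> t0; have h := ln_nat_step t0.
have : t%:R^-1 <= 2 * t.+1%:R^-1 :> R.
  rewrite -[2]invrK -invfM lef_pV2 ?posrE ?mulr_gt0 ?invr_gt0 ?ltr0n//.
  rewrite mulrC ler_pdivrMr// -natrM ler_nat; lia.
move: h; move: (t.+1%:R^-1) (ln t.+1%:R) (ln t%:R) (t%:R^-1) => p q r s; lra.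
Qed.

Lemma ler_ln_pos (p q : R) : 0 < p -> p <= q -> ln p <= ln q.
Proof. by move=> p0 pq; rewrite ler_ln ?posrE// (lt_le_trans p0). Qed.

(** Comparison with the increments of the logarithm, frozen outside the window. *)
Lemma sum_inv_window (y1 y2 : R) (n : nat) : 0 < y1 -> y1 <= y2 + 1 ->
  \sum_(1 <= t < n) (if (y1 <= t%:R) && (t%:R <= y2) then t%:R^-1 else 0) <=
    2 * (ln (y2 + 1) - ln y1).
Proof.
move=> y10 y12; have y20 : 0 < y2 + 1 by lra.
pose cl (t : nat) : R := Num.max y1 (Num.min t%:R (y2 + 1)).
have cl1 t : y1 <= cl t by rewrite le_max lexx.
have cl0 t : 0 < cl t by apply: lt_le_trans (cl1 t).
have cl2 t : cl t <= y2 + 1 by rewrite ge_max y12 /= ge_min lexx orbT.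
have [n1|n1] := leqP 1 n; last first.
  rewrite big_geq; last by rewrite ltnW.
  by have := ler_ln_pos y10 y12; lra.
apply: (@le_trans _ _ (2 * ln (cl n) - 2 * ln (cl 1%N))); last first.
  have := ler_ln_pos (cl0 n) (cl2 n); have := ler_ln_pos y10 (cl1 1%N); lra.
apply: (sum_le_telescope (Phi := fun t => 2 * ln (cl t))) => // t t0.
case: ifPn => [/andP[h1 h2]|_].
  have -> : cl t = t%:R.
    by rewrite /cl (min_idPl _) ?(max_idPr _)//; lra.
  have -> : cl t.+1 = t.+1%:R.
    have e : t.+1%:R = t%:R + 1 :> R by rewrite natr1.
    by rewrite /cl (min_idPl _) ?(max_idPr _)//; lra.
  by rewrite -mulrBr inv_le_ln.
have : cl t <= cl t.+1.
  rewrite /cl ge_max le_max lexx /= le_max; apply/orP; right.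
  rewrite le_min; apply/andP; split; last by rewrite ge_min lexx orbT.
  by rewrite ge_min ler_nat leqnSn.
by move=> /(ler_ln_pos (cl0 t)); lra.
Qed.

Lemma count_below (x : R) (n : nat) : 0 <= x ->
  \sum_(1 <= t < n) (if t%:R < x then 1 else 0) <= x.
Proof.
move=> x0; have [n1|n1] := leqP 1 n; last by rewrite big_geq// ltnW.
elim: n n1 => // n IH _; case: n IH => [|n] IH; first by rewrite big_geq.
rewrite big_nat_recr//=; have {}IH := IH erefl.
case: ifPn => [nx|_]; last by rewrite addr0.
apply: le_trans (ltW nx); rewrite -natr1 lerD2r.
apply: (@le_trans _ _ (\sum_(1 <= t < n.+1) 1)).
  by apply: ler_sum => t _; case: ifP.
by rewrite sumr_const_nat subSS subn0.
Qed.

Definition block_index (t : nat) : nat := trunc_log 2 (trunc_log 2 t.-1).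

Lemma block_indexE k t : (D k < t)%N -> (t <= D k.+1)%N -> block_index t = k.
Proof.
case: t => // t kt tk; rewrite /block_index /=.
have t0 : (0 < t)%N by rewrite (leq_trans (D_gt0 k))// -ltnS.
have /andP[b1 b2] := trunc_log_bounds (ltnSn 1) t0.
apply: trunc_log_eq => //; apply/andP; split.
  by rewrite -ltnS -(ltn_exp2l _ _ (ltnSn 1)) (leq_ltn_trans _ b2).
by rewrite -(ltn_exp2l _ _ (ltnSn 1)) (leq_ltn_trans b1).
Qed.

Lemma block_index_bounds t : (D 0 < t)%N -> (D (block_index t) < t)%N /\ (t <= D (block_index t).+1)%N.
Proof.
case: t => // t; rewrite ltnS => t2; rewrite /block_index /=.
have t0 : (0 < t)%N by apply: leq_trans t2.
have /andP[b1 b2] := trunc_log_bounds (ltnSn 1) t0.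
have l0 : (0 < trunc_log 2 t)%N by rewrite trunc_log_gt0.
have /andP[c1 c2] := trunc_log_bounds (ltnSn 1) l0.
split; first by rewrite ltnS (leq_trans _ b1)// leq_pexp2l.
by rewrite (leq_trans b2)// leq_pexp2l.
Qed.

(** [8 k <= 2 ^ k + 16], whence the truncation levels are at least of order
    [sqrt t]. *)
Lemma expn_block_index_le t : (D 0 < t)%N -> ((2 ^ 8) ^ block_index t <= 2 ^ 16 * t)%N.
Proof.
move=> /block_index_bounds[kt _]; set k := block_index t in kt *.
have h : (8 * k <= 2 ^ k + 16)%N.
  elim: {kt} (k) => // j IH; rewrite expnS mul2n -addnn.
  have [j3|j3] := leqP 3 j; last by move: j j3 {IH} => [|[|[|]]].
  have : (2 ^ 3 <= 2 ^ j)%N by rewrite leq_pexp2l.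
  by rewrite -[(2 ^ 3)%N]/8%N; lia.
rewrite -expnM; apply: (@leq_trans (2 ^ (2 ^ k + 16))%N).
  by rewrite leq_pexp2l.
rewrite expnD mulnC leq_mul2l; apply/orP; right; exact: ltnW.
Qed.

End Real_estimates.

(** * Laws and symmetry *)

Section Laws.
Context {R : realType} {d : measure_display} {T : measurableType d}.
Variable P : probability T R.
Local Open Scope ereal_scope.

Lemma integral_same_law (X Y : {RV P >-> R[i]}) (g : R[i] -> R) :
  (forall B, measurable B -> distribution P X B = distribution P Y B) ->
  measurable_fun setT g -> (forall z, (0 <= g z)%R) ->
  \int[P]_w (g (X w))%:E = \int[P]_w (g (Y w))%:E.
Proof.
move=> XY mg g0.
have mEg : measurable_fun setT (EFin \o g) by exact/measurable_EFinP.
have Eg0 z : 0 <= (EFin \o g) z by rewrite lee_fin.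
have hX := ge0_integral_distribution X mEg Eg0.
have hY := ge0_integral_distribution Y mEg Eg0.
transitivity (\int[distribution P X]_y (EFin \o g) y); first by rewrite hX.
transitivity (\int[distribution P Y]_y (EFin \o g) y); last by rewrite hY.
by apply: eq_measure_integral => B mB _; exact: XY.
Qed.

Lemma measurable_opp : measurable_fun [set: R[i]] (fun z : R[i] => - z)%R.
Proof.
apply: (measurability (@open R[i]^o) erefl) => _ [B oB <-]; rewrite setTI.
apply: sub_sigma_algebra.
have /continuousP h := @opp_continuous R[i]^o.
exact: h.
Qed.

Lemma integral_symmetric (X : {RV P >-> R[i]}) (g : R[i] -> R) :
  symmetric_rv X -> measurable_fun setT g -> (forall z, (0 <= g z)%R) ->
  \int[P]_w (g (X w))%:E = \int[P]_w (g (- X w))%:E.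
Proof.
move=> symX mg g0.
have mY : measurable_fun setT (fun w => - X w : R[i])%R.
  by apply: measurableT_comp; [exact: measurable_opp|exact: measurable_funPT].
pose Ymix := isMeasurableFun.Build _ _ _ _ _ mY.
pose Y : {RV P >-> R[i]} := HB.pack (fun w => - X w : R[i])%R Ymix.
by apply: (@integral_same_law X Y).
Qed.

(** By symmetry of the law the nonnegative functions C + g and C - g have the same
    mean. *)
Lemma integral_symmetric_odd (X : {RV P >-> R[i]}) (g : R[i] -> R) (C : R) :
  symmetric_rv X -> measurable_fun setT g -> (forall z, (`|g z| <= C)%R) ->
  (forall z, g (- z) = - g z)%R -> \int[P]_w (g (X w))%:E = 0.
Proof.
move=> symX mg gC godd.
have mX : measurable_fun setT X by exact: measurable_funPT.
have mgX : measurable_fun setT (fun w => g (X w)) by exact: measurableT_comp.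
have ig := bounded_integrable P mgX (fun w => gC (X w)).
have ign : P.-integrable setT (EFin \o (fun w => C + g (X w))%R).
  apply: (@bounded_integrable _ _ _ _ _ (C + C)%R).
    by apply: measurable_funD.
  by move=> w; rewrite (le_trans (ler_normD _ _))// lerD// ger0_norm// (le_trans _ (gC (X w))).
have h : \int[P]_w (C + g (X w))%:E = \int[P]_w (C + g (- X w))%:E.
  apply: (integral_symmetric (g := fun z => C + g z)%R) => //.
    exact: measurable_funD.
  by move=> z; have := gC z; rewrite ler_norml; lra.
have iC : P.-integrable setT (cst C%:E) by exact: finite_measure_integrable_cst.
have e1 : \int[P]_w (C + g (X w))%:E = \int[P]_w C%:E + \int[P]_w (g (X w))%:E.
  by under eq_integral do rewrite EFinD; rewrite integralD.
have e2 : \int[P]_w (C + g (- X w))%:E = \int[P]_w C%:E - \int[P]_w (g (X w))%:E.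
  under eq_integral do rewrite godd EFinB.
  by rewrite integralB.
have f1 : \int[P]_w C%:E \is a fin_num by exact: integrable_fin_num.
have f2 : \int[P]_w (g (X w))%:E \is a fin_num by exact: integrable_fin_num.
move: h; rewrite e1 e2 -(fineK f1) -(fineK f2) -EFinD -EFinB => -[].
move: (fine _) (fine _) => x y xy; congr EFin; lra.
Qed.

Lemma rest_truncE u (z : R[i]) :
  normc (z - trunc u z)%R = (if normc z <= u then 0 else normc z)%R.
Proof. by rewrite /trunc; case: ifP => _; rewrite ?subrr ?normc0 ?subr0. Qed.

Lemma measurable_rest u : measurable_fun setT (fun z : R[i] => normc (z - trunc u z)%R).
Proof.
under eq_fun do rewrite rest_truncE.
apply: measurable_fun_ifT => //; [exact: measurable_normc_le|exact: measurable_normc].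
Qed.

(** Truncation at a level of the modulus commutes with the change of sign. *)
Lemma symmetric_trunc_mean (X : {RV P >-> R[i]}) u : symmetric_rv X -> (0 <= u)%R ->
  \int[P]_w (complex.Re (trunc u (X w)))%:E = 0 /\
  \int[P]_w (complex.Im (trunc u (X w)))%:E = 0.
Proof.
move=> symX u0; split.
  apply: (integral_symmetric_odd (g := fun z => complex.Re (trunc u z)) (C := u)) => //.
  - exact: measurable_Re_trunc.
  - by move=> z; rewrite (le_trans (abs_Re_le _))// normc_trunc_le.
  - by move=> z; rewrite /trunc normcN; case: ifP => _ /=; rewrite ?oppr0//; case: z.
apply: (integral_symmetric_odd (g := fun z => complex.Im (trunc u z)) (C := u)) => //.
- exact: measurable_Im_trunc.
- by move=> z; rewrite (le_trans (abs_Im_le _))// normc_trunc_le.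
- by move=> z; rewrite /trunc normcN; case: ifP => _ /=; rewrite ?oppr0//; case: z.
Qed.

(** Only the terms from a on are controlled in the mean; the finitely many others are
    finite. *)
Lemma ae_weighted_sums (g : nat -> T -> R) (e : nat -> R) (a : nat) (B : R) :
  (forall t, measurable_fun setT (g t)) -> (forall t w, (0 <= g t w)%R) ->
  (forall t, 0 <= e t)%R ->
  (forall t, (a <= t)%N -> \int[P]_w (g t w)%:E <= (e t)%:E) ->
  (forall n, \sum_(a <= t < n) e t <= B)%R ->
  {ae P, forall w, exists B : R, forall n, (\sum_(1 <= t < n) g t w <= B)%R}.
Proof.
move=> mg g0 e0 ge eB.
pose f t w := (if (a <= t)%N then g t w else 0)%R.
have f0 t w : (0 <= f t w)%R by rewrite /f; case: ifP.
have sumf (h : nat -> R) n : (\sum_(0 <= t < n) (if (a <= t)%N then h t else 0) =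
    \sum_(a <= t < n) h t)%R.
  have [an|/ltnW na] := leqP a n; last first.
    rewrite [RHS]big_geq// big_nat big1// => t /andP[_ tn].
    by rewrite leqNgt (leq_trans tn na).
  rewrite (@big_cat_nat _ _ _ a)//= big_nat big1 ?add0r; last first.
    by move=> t /andP[_ ta]; rewrite leqNgt ta.
  by apply: eq_big_nat => t /andP[-> _].
have := @ae_bounded_sums _ _ _ P f B _ f0 _.
have mf t : measurable_fun setT (f t) by rewrite /f; case: (a <= t)%N.
move=> /(_ mf) H.
apply: filterS (H _) => [w [C hC]|n].
  exists (\sum_(1 <= t < a) g t w + C)%R => n.
  have [na|an] := leqP n a.
    have C0 : (0 <= C)%R by have := hC 0%N; rewrite big_geq.
    have [n1|n1] := leqP 1 n; last by rewrite big_geq ?addr_ge0 ?sumr_ge0// ltnW.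
    rewrite (le_trans (y := \sum_(1 <= t < a) g t w)%R)// ?lerDl//.
    by rewrite [leRHS](@big_cat_nat _ _ _ n)//= lerDl sumr_ge0.
  have hCn := hC n; rewrite /f sumf in hCn.
  have [a1|a1] := leqP 1 a.
    by rewrite (@big_cat_nat _ _ _ a)//= ?lerD2l// ltnW.
  rewrite (_ : a = 0)%N in hCn *; last by case: (a) a1.
  rewrite [X in (_ <= X + _)%R]big_geq// add0r (le_trans _ hCn)//.
  have n0 : (0 < n)%N by apply: leq_trans an.
  by rewrite [leRHS](@big_cat_nat _ _ _ 1)//= lerDr sumr_ge0.
apply: (@le_trans _ _ (\sum_(0 <= t < n) (if (a <= t)%N then e t else 0)%R%:E)).
  apply: lee_sum => t _; rewrite /f; case: ifPn => [at'|_]; first exact: ge.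
  by rewrite integral0_eq.
by rewrite sumEFin lee_fin sumf.
Qed.

End Laws.

Section Block_sums.
Context {R : realType}.

Lemma block_sums_bound (e s : nat -> R) (B : R) : (forall t, 0 <= e t) ->
  (forall k, (0 < k)%N -> \sum_((D k).+1 <= t < (D k.+1).+1) e t <= s k) ->
  (forall n, \sum_(1 <= k < n) s k <= B) ->
  forall n, \sum_((D 1).+1 <= t < n) e t <= B.
Proof.
move=> e0 es sB n.
have blocks m : (0 < m)%N ->
    \sum_((D 1).+1 <= t < (D m).+1) e t <= \sum_(1 <= k < m) s k.
  elim: m => // -[|m] IH _; first by rewrite !big_geq.
  rewrite (@big_cat_nat _ _ _ (D m.+1).+1)//= ?ltnS ?D_mono//.
  by rewrite [leRHS]big_nat_recr//= lerD ?IH ?es.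
have [k k0 nk] := D_unbounded n.
have [n1|n1] := leqP (D 1).+1 n; last first.
  by rewrite big_geq ?(ltnW n1)//; have := sB 0%N; rewrite big_geq.
apply: le_trans (sB k); apply: le_trans (blocks k k0).
by rewrite [leRHS](@big_cat_nat _ _ _ n)//= ?(leq_trans nk)// lerDl sumr_ge0.
Qed.

Lemma sum_geometric n : \sum_(0 <= k < n) (1 / 2 : R) ^+ k <= 2.
Proof.
have := @sum_half_powers R n; under eq_bigr do rewrite exprS.
by rewrite -mulr_sumr; lra.
Qed.

End Block_sums.

(** * Noise of finite variance *)

Section Finite_variance.
Context {R : realType} {d : measure_display} {T : measurableType d}.
Variable P : probability T R.
Variable eps : nat -> {RV P >-> R[i]}.

Definition ae_bounded_waves : Prop :=
  {ae P, forall w, exists B : R, forall n theta,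
    normc (wave (fun t => eps t w) 0 n theta) <= B}.

Let m2 t := fine (second_moment (eps t)).

Lemma second_moment_ge0 t : (0 <= second_moment (eps t))%E.
Proof.
rewrite /second_moment unlock; apply: integral_ge0 => w _.
by rewrite lee_fin sqr_ge0.
Qed.

(** The sums of [tau] are exactly the block variances that [ae_partial_sums_bounded]
    asks for, multiplied by 2 ^ k. *)
Lemma sqr_tau k :
  tau eps k ^+ 2 = 2 ^+ k * \sum_((D k).+1 <= t < (D k.+1).+1) m2 t / t%:R ^+ 2.
Proof.
rewrite /tau exprMn sqr_sqrtr; last first.
  by apply: sumr_ge0 => t _; rewrite divr_ge0 ?fine_ge0 ?second_moment_ge0 ?exprn_ge0.
congr (_ * _); last by rewrite big_add1.
by rewrite -[LHS]powR_mulrn ?powR_ge0// -powRrM -mulrA mulVf ?mulr1 ?powR_mulrn// pnatr_eq0.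
Qed.

Lemma tau_ge0 k : 0 <= tau eps k.
Proof. by rewrite /tau mulr_ge0 ?powR_ge0 ?sqrtr_ge0. Qed.

(** Truncation at the level at which the variance bounds of the large values and
    of the Chernoff exponent balance; the mesh term 1 / 2 ^ k keeps the level
    positive. *)
Lemma tau_summable_bounded : independent_symmetric_L2 eps ->
  (exists B : R, forall n, \sum_(1 <= k < n) tau eps k <= B) -> ae_bounded_waves.
Proof.
move=> [indep hsym] [B hB].
(* with l k * u t / t = 1 / 2, the errors 2 ^ k / l k become 2 * sigma k *)
pose sigma k : R := tau eps k + (1 / 2) ^+ k.
have half0 k : 0 < (1 / 2 : R) ^+ k by rewrite exprn_gt0//; lra.
have sigma0 k : 0 < sigma k by rewrite ltr_wpDl ?tau_ge0.
have tau_sigma k : tau eps k ^+ 2 <= sigma k ^+ 2.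
  by rewrite ler_pXn2r ?nnegrE ?tau_ge0 ?(ltW (sigma0 _))// lerDl ltW.
have pow0 k : 0 < (2 ^+ k : R) by rewrite exprn_gt0.
have m20 t : 0 <= m2 t by rewrite fine_ge0// second_moment_ge0.
have m2E t : (0 < t)%N -> (\int[P]_w (normc (eps t w) ^+ 2)%:E = (m2 t)%:E)%E.
  move=> t0; have [_ fin] := hsym _ t0.
  rewrite /m2 fineK ?ge0_fin_numE ?second_moment_ge0//.
  by rewrite /second_moment unlock.
pose u t : R := t%:R * sigma (block_index t) / 2 ^+ block_index t.
have u_ge0 t : 0 <= u t by rewrite divr_ge0 ?mulr_ge0 ?(ltW (sigma0 _)) ?(ltW (pow0 _)).
pose v t : R := m2 t / t%:R ^+ 2.
pose l k : R := 2 ^+ k / (2 * sigma k).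
have l0 k : 0 < l k by rewrite divr_gt0// mulr_gt0.
have v0 t : 0 <= v t by rewrite divr_ge0 ?exprn_ge0.
have meps t : measurable_fun setT (eps t) by exact: measurable_funPT.
apply: (ae_partial_sums_bounded indep (u := u) (m := fun=> 0) (v := v) (l := l) (C := 1 / 4)) => //.
- move=> k t k0 kt tk.
  have t0 : (0 < t)%N by apply: leq_ltn_trans kt.
  have tr : 0 < t%:R :> R by rewrite ltr0n.
  have [symt _] := hsym _ t0.
  have [re0 im0] := symmetric_trunc_mean symt (u_ge0 t).
  split => //.
  + rewrite /u (block_indexE kt tk) /l.
    have s0 := sigma0 k; have p0 := pow0 k.
    have -> : 2 ^+ k / (2 * sigma k) * (t%:R * sigma k / 2 ^+ k / t%:R) = 1 / 2.
      by field; rewrite !gt_eqF.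
    by [].
  + by rewrite re0 abse0 mulr0.
  + by rewrite im0 abse0 mulr0.
  + rewrite /v mulrC divfK; last by rewrite expf_neq0// gt_eqF.
    rewrite -m2E//; apply: ge0_le_integral => //.
    * by move=> w _; rewrite lee_fin sqr_ge0.
    * apply/measurable_EFinP/measurable_funX.
      exact: (measurableT_comp (measurable_normc_trunc _) (meps t)).
    * apply/measurable_EFinP/measurable_funX.
      exact: (measurableT_comp measurable_normc (meps t)).
    * move=> w _; rewrite lee_fin ler_pXn2r ?nnegrE ?normc_ge0// /trunc.
      by case: ifP => // _; rewrite normc0 normc_ge0.
- move=> k k0; have s0 := sigma0 k; have p0 := pow0 k.
  have := tau_sigma k; rewrite sqr_tau -/(v _) => h.
  rewrite /l.
  have -> : (2 ^+ k / (2 * sigma k)) ^+ 2 * \sum_((D k).+1 <= t < (D k.+1).+1) v t =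
    (2 ^+ k * \sum_((D k).+1 <= t < (D k.+1).+1) v t) * (2 ^+ k / (4 * sigma k ^+ 2)).
    by field; rewrite gt_eqF.
  apply: (@le_trans _ _ (sigma k ^+ 2 * (2 ^+ k / (4 * sigma k ^+ 2)))).
    by rewrite ler_wpM2r// divr_ge0 ?ltW// mulr_gt0// exprn_gt0.
  have -> : sigma k ^+ 2 * (2 ^+ k / (4 * sigma k ^+ 2)) = 1 / 4 * 2 ^+ k.
    by field; rewrite gt_eqF.
  exact: lexx.
- exists (2 * (tau eps 0 + B + 2)) => n.
  apply: (@le_trans _ _ (2 * (\sum_(0 <= k < n) tau eps k + \sum_(0 <= k < n) (1 / 2) ^+ k))).
    rewrite -big_split /= mulr_sumr; apply: ler_sum => k _.
    have s0 := sigma0 k; have p0 := pow0 k.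
    have -> : 2 ^+ k / l k = 2 * sigma k by rewrite /l; field; rewrite !gt_eqF.
    by [].
  rewrite ler_wpM2l// lerD ?sum_geometric//.
  case: n => [|n]; first by rewrite big_geq// addr_ge0 ?tau_ge0//; have := hB 0%N; rewrite big_geq.
  by rewrite big_ltn// lerD2l.
- by exists 0 => n; rewrite big1.
(* beyond the level u, a value is at most its square over u *)
pose e t : R := m2 t / (t%:R * u t).
have e0 t : 0 <= e t by rewrite divr_ge0// mulr_ge0.
apply: (@ae_weighted_sums _ _ _ P
   (fun t w => normc (eps t w - trunc (u t) (eps t w)) / t%:R) e (D 1).+1 (B + 2)) => //.
- move=> t; apply: measurable_funM => //.
  exact: (measurableT_comp (measurable_rest _) (meps t)).
- by move=> t w; rewrite divr_ge0 ?normc_ge0.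
- move=> t Dt; have t0 : (0 < t)%N by apply: leq_trans Dt.
  have tr : 0 < t%:R :> R by rewrite ltr0n.
  have u0 : 0 < u t by rewrite divr_gt0 ?mulr_gt0.
  have c0 : 0 <= (t%:R * u t)^-1 by rewrite invr_ge0 mulr_ge0// ltW.
  rewrite /e mulrC EFinM -m2E// -ge0_integralZl_EFin//; last 2 first.
  + by move=> w _; rewrite lee_fin sqr_ge0.
  + apply/measurable_EFinP/measurable_funX.
    exact: (measurableT_comp measurable_normc (meps t)).
  apply: ge0_le_integral => //.
  + by move=> w _; rewrite lee_fin divr_ge0 ?normc_ge0.
  + apply/measurable_EFinP/measurable_funM => //.
    exact: (measurableT_comp (measurable_rest _) (meps t)).
  + apply/measurable_EFinP/measurable_funM => //; apply/measurable_funX.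
    exact: (measurableT_comp measurable_normc (meps t)).
  + move=> w _; rewrite -EFinM lee_fin rest_truncE; case: ifPn => [_|].
      by rewrite mul0r mulr_ge0// sqr_ge0.
    rewrite -ltNge => ux; set x := normc _ in ux *.
    rewrite invfM mulrC -mulrA ler_pM2l ?invr_gt0//.
    rewrite mulrC ler_pdivlMr// expr2 ler_wpM2l// ltW//.
    exact: lt_trans ux.
apply: (block_sums_bound (s := sigma)) => //; last first.
  move=> n; rewrite big_split /= lerD// (le_trans _ (sum_geometric n))//.
  case: n => [|n]; first by rewrite !big_geq.
  by rewrite [leRHS]big_ltn// lerDr ltW.
move=> k k0; have s0 := sigma0 k; have p0 := pow0 k.
apply: (@le_trans _ _ (tau eps k ^+ 2 / sigma k)).
  rewrite sqr_tau [X in _ <= X]mulrAC mulr_sumr le_eqVlt; apply/orP; left; apply/eqP.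
  apply: eq_big_nat => t /andP[kt tk].
  have tr : 0 < t%:R :> R by rewrite ltr0n (leq_trans _ kt).
  by rewrite /e /u (@block_indexE k t)//; field; rewrite !gt_eqF.
by rewrite ler_pdivrMr// -expr2.
Qed.

Lemma noise4_bounded : noise4 eps -> ae_bounded_waves.
Proof.
move=> [h4 hs]; apply: tau_summable_bounded => //.
exists (fine (\sum_(1 <= k <oo) (tau eps k)%:E)%E) => n.
rewrite -lee_fin fineK; last first.
  rewrite ge0_fin_numE//; apply: nneseries_ge0 => k _ _.
  by rewrite lee_fin tau_ge0.
rewrite -sumEFin; apply: nneseries_lim_ge => k _ _.
by rewrite lee_fin tau_ge0.
Qed.

End Finite_variance.

Section Polynomial_variance.
Context {R : realType} {d : measure_display} {T : measurableType d}.
Variable P : probability T R.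
Variable eps : nat -> {RV P >-> R[i]}.
Let m2 t := fine (second_moment (eps t)).

Lemma ln2_gt0 : 0 < ln 2 :> R.
Proof. by rewrite ln_gt0// ltr1n. Qed.

(** The terms [t ^ (- 1 - delta)] are compared with the decrements of
    [t ^ (- delta)]. *)
Lemma block_power_sum (delta : R) k : 0 < delta ->
  \sum_((D k).+1 <= t < (D k.+1).+1) expR (- delta * ln t%:R) / t%:R <=
    expR (- delta * ln (D k)%:R) / delta.
Proof.
move=> d0; pose p (t : nat) : R := expR (- delta * ln t%:R).
rewrite big_add1 /=.
apply: (@le_trans _ _ (- (p (D k.+1) / delta) - - (p (D k) / delta))); last first.
  by rewrite opprK addrC gerBl divr_ge0 ?expR_ge0// ltW.
apply: (sum_le_telescope (Phi := fun t => - (p t / delta))); last exact: D_mono.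
move=> t Dt; have t0 : (0 < t)%N by apply: leq_trans Dt; exact: D_gt0.
have tr : 0 < t%:R :> R by rewrite ltr0n.
have t1 : 0 < t.+1%:R :> R by rewrite ltr0n.
have h := @ln_nat_step R t t0.
have h2 : p t.+1 * (1 + delta / t.+1%:R) <= p t.
  apply: (@le_trans _ _ (p t.+1 * expR (delta / t.+1%:R))).
    by rewrite ler_wpM2l ?expR_ge0// expR_ge1Dx.
  rewrite /p -expRD ler_expR; have := ler_wpM2l (ltW d0) h; rewrite mulrBr !mulNr.
  move: (delta * ln _) (delta * ln _) (delta / _) => a b c; lra.
rewrite -/(p t.+1) opprK addrC -mulrBl ler_pdivlMr//.
have -> : p t.+1 / t.+1%:R * delta = p t.+1 * (delta / t.+1%:R).
  by rewrite -mulrA [_^-1 * _]mulrC.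
move: h2; rewrite mulrDr mulr1; move: (p t.+1 * (delta / t.+1%:R)) => z; lra.
Qed.

(** From the cubic term of the exponential series; a cube is what it takes to absorb
    the factor 2 ^ k of [sqr_tau] and to leave the square of a summable sequence. *)
Lemma expRN_le_cube (y : R) : 0 < y -> expR (- y) <= 6 / y ^+ 3.
Proof.
move=> y0; rewrite expRN -[6]invrK -invfM lef_pV2 ?posrE ?expR_gt0//; last first.
  by rewrite mulr_gt0 ?invr_gt0 ?exprn_gt0.
have := @expR_ge1Dxn R y 2 (ltW y0).
have -> : (3`!)%:R = 6 :> R by [].
rewrite [_^-1 * _]mulrC; move: (y ^+ 3 / 6) => z; lra.
Qed.

(** With delta = 1 - nu, the variance of the block k is of order D k ^ (- delta), which
    decreases faster than any power of 2 ^ k, so [tau] is summable. *)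
Lemma noise3_bounded : noise3 eps -> ae_bounded_waves eps.
Proof.
move=> [hL2 [nu nu1 hO]]; apply: tau_summable_bounded => //.
have [C C0 [t0 _ hC]] : exists2 C : R, 0 < C &
    \forall t \near \oo, `|m2 t| <= C * `|t%:R `^ nu|.
  by have /eqO_exP[C C0 h] := hO; exists C.
have m20 t : 0 <= m2 t by rewrite fine_ge0// second_moment_ge0.
pose delta : R := 1 - nu; have d0 : 0 < delta by rewrite subr_gt0.
pose c : R := delta * ln 2; have c0 : 0 < c by rewrite mulr_gt0// ln2_gt0.
pose K : R := C / delta * (6 / c ^+ 3).
have K0 : 0 <= K by rewrite mulr_ge0 ?divr_ge0 ?exprn_ge0 ?ltW.
have half0 k : 0 <= (1 / 2 : R) ^+ k by rewrite exprn_ge0// divr_ge0.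
have far k : (t0 <= k)%N -> tau eps k <= Num.sqrt K * (1 / 2) ^+ k.
  move=> tk; rewrite -(ler_pXn2r (n := 2)) ?nnegrE ?tau_ge0 ?mulr_ge0 ?sqrtr_ge0 ?half0//.
  rewrite sqr_tau exprMn sqr_sqrtr//.
  have kD : (k <= D k)%N.
    by rewrite /D (leq_trans (ltnW (ltn_expl k (ltnSn 1))))// ltnW// ltn_expl.
  have h1 : \sum_((D k).+1 <= t < (D k.+1).+1) m2 t / t%:R ^+ 2 <=
      C * (expR (- delta * ln (D k)%:R) / delta).
    apply: le_trans (ler_wpM2l (ltW C0) (block_power_sum k d0)).
    rewrite mulr_sumr big_nat [leRHS]big_nat; apply: ler_sum => t /andP[kt _].
    have tr : 0 < t%:R :> R by rewrite ltr0n (leq_trans _ kt).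
    have := hC t (leq_trans tk (leq_trans kD (ltnW kt))).
    rewrite ger0_norm ?m20// ger0_norm ?powR_ge0// => hm.
    rewrite ler_pdivrMr ?exprn_gt0// (le_trans hm)// -mulrA ler_pM2l//.
    rewrite /powR gt_eqF// expr2 mulrA divfK ?gt_eqF//.
    rewrite -[X in _ <= _ * X]lnK ?posrE// -expRD ler_expR /delta; lra.
  have lnD : ln (D k)%:R = ln 2 * 2 ^+ k :> R.
    by rewrite /D natrX lnXn// -[in RHS]natrX mulr_natr.
  have h2 : expR (- delta * ln (D k)%:R) <= 6 / (c * 2 ^+ k) ^+ 3.
    rewrite lnD mulNr mulrA -/c; apply: expRN_le_cube.
    by rewrite mulr_gt0// exprn_gt0.
  apply: (@le_trans _ _ (2 ^+ k * (C * (6 / (c * 2 ^+ k) ^+ 3 / delta)))).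
    rewrite ler_wpM2l ?exprn_ge0// (le_trans h1)// ler_wpM2l ?(ltW C0)//.
    by rewrite ler_wpM2r// invr_ge0 ltW.
  rewrite le_eqVlt; apply/orP; left; apply/eqP.
  have -> : (1 / 2 : R) ^+ k = (2 ^+ k)^-1 by rewrite mul1r exprVn.
  rewrite /K; have : (2 ^+ k : R) != 0 by rewrite expf_neq0.
  move: (2 ^+ k : R) => z z0; field; rewrite z0 !gt_eqF//.
exists (\sum_(0 <= k < t0) tau eps k + Num.sqrt K * 2) => n.
have pw k : tau eps k <= (if (k < t0)%N then tau eps k else 0) + Num.sqrt K * (1 / 2) ^+ k.
  have s0 : 0 <= Num.sqrt K * (1 / 2) ^+ k by rewrite mulr_ge0 ?sqrtr_ge0.
  by case: ifPn => [_|]; rewrite ?lerDl// -leqNgt add0r => /far.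
apply: (@le_trans _ _ (\sum_(0 <= k < n) tau eps k)).
  have [n1|n1] := leqP 1 n.
    by rewrite [leRHS](@big_cat_nat _ _ _ 1)//= lerDr sumr_ge0// => k _; exact: tau_ge0.
  by rewrite big_geq ?sumr_ge0 ?(ltnW n1)// => k _; exact: tau_ge0.
apply: (le_trans (ler_sum _ (fun k _ => pw k))).
rewrite big_split /= lerD//; last first.
  by rewrite -mulr_sumr ler_wpM2l ?sqrtr_ge0// sum_geometric.
rewrite -big_mkcond /=.
rewrite (@big_cat_nat _ _ _ (minn n t0) 0 n)//= ?geq_minl//.
rewrite [X in _ + X]big1_seq ?addr0; last first.
  move=> k /andP[kt]; rewrite mem_index_iota => /andP[nk kn].
  by move: nk; rewrite geq_min leqNgt kn /= leqNgt kt.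
rewrite big_mkcond /= [leRHS](@big_cat_nat _ _ _ (minn n t0))//= ?geq_minr//.
rewrite ler_wpDr//; first by apply: sumr_ge0 => k _; exact: tau_ge0.
by apply: ler_sum => k _; case: ifP => // _; exact: tau_ge0.
Qed.

End Polynomial_variance.

(** * Identically distributed noise *)

Section Pointwise_sums.
Context {R : realType}.

(** On the block k this is t / 16 ^ k. With the Chernoff exponent 4 ^ k / 2 the
    truncated variables are admissible, and the errors 2 ^ k / 4 ^ k of the blocks are
    summable. *)
Definition trunc_level (t : nat) : R := t%:R / (2 ^+ block_index t) ^+ 4.

Lemma pow_block_index_gt0 t : 0 < (2 ^+ block_index t) ^+ 4 :> R.
Proof. by rewrite !exprn_gt0. Qed.

Lemma trunc_level_ge0 t : 0 <= trunc_level t.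
Proof. by rewrite divr_ge0 ?(ltW (pow_block_index_gt0 _)). Qed.

(** As 256 ^ k is at most a multiple of t, the level at t is at least of order the
    square root of t. *)
Lemma above_level_le (x : R) t : (D 0 < t)%N -> trunc_level t < x -> t%:R <= 2 ^+ 16 * x ^+ 2.
Proof.
move=> t2; rewrite /trunc_level ltr_pdivrMr ?pow_block_index_gt0// => h.
have tr : 0 < t%:R :> R by rewrite ltr0n (leq_ltn_trans _ t2).
have k2 : ((2 ^+ block_index t) ^+ 4) ^+ 2 <= 2 ^+ 16 * t%:R :> R.
  have := expn_block_index_le t2; rewrite -(ler_nat R) natrM !natrX.
  suff -> : ((2 ^+ block_index t) ^+ 4) ^+ 2 = (2 ^+ 8) ^+ block_index t :> R by [].
  by rewrite -!exprM; congr (_ ^+ _); lia.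
have h2 : t%:R ^+ 2 <= x ^+ 2 * ((2 ^+ block_index t) ^+ 4) ^+ 2.
  by rewrite -exprMn ler_pXn2r ?nnegrE ?(ltW h) ?(ltW tr)// (le_trans (ltW tr))// ltW.
have : t%:R * t%:R <= 2 ^+ 16 * x ^+ 2 * t%:R.
  by have := le_trans h2 (ler_wpM2l (sqr_ge0 x) k2); rewrite -expr2 mulrCA mulrA.
by rewrite ler_pM2r.
Qed.

Lemma sum_above_level (x : R) n : 0 <= x ->
  \sum_((D 1).+1 <= t < n) (if x <= trunc_level t then 0 else x) / t%:R <=
    x * (2 * ln (2 ^+ 16 * x ^+ 2 + 1)).
Proof.
move=> x0; pose y2 := 2 ^+ 16 * x ^+ 2.
have y20 : 0 <= y2 by rewrite mulr_ge0 ?sqr_ge0 ?exprn_ge0.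
have := @sum_inv_window R 1 y2 n ltr01; rewrite lerDr ln1 subr0 => /(_ y20) h.
apply: le_trans (ler_wpM2l x0 h); rewrite mulr_sumr.
apply: (@le_trans _ _ (\sum_((D 1).+1 <= t < n) x * (if (1 <= t%:R :> R) && (t%:R <= y2) then t%:R^-1 else 0))).
  rewrite big_nat [leRHS]big_nat; apply: ler_sum => t /andP[t4 _].
  have t2 : (D 0 < t)%N by rewrite (leq_trans _ t4)// ltnS D_mono.
  case: (leP x (trunc_level t)) => [_|xl].
    by rewrite mul0r mulr_ge0//; case: ifP.
  by rewrite (above_level_le t2 xl) andbT ler1n (leq_trans _ t4).
have [n1|n1] := leqP (D 1).+1 n; last first.
  rewrite big_geq; last exact: ltnW.
  by apply: sumr_ge0 => t _; rewrite mulr_ge0//; case: ifP.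
rewrite [leRHS](@big_cat_nat _ _ _ (D 1).+1)//= lerDr.
by apply: sumr_ge0 => t _; rewrite mulr_ge0//; case: ifP.
Qed.

Lemma half_le_ln2 : 1 / 2 <= ln 2 :> R.
Proof.
rewrite -[X in X <= _]expRK ler_ln ?posrE ?expR_gt0//.
by apply: le_trans (expR_quad (lexx _)) _; lra.
Qed.

Definition loge (x : R) : R := ln (x + expR 1).

Lemma loge_ge1 x : 0 <= x -> 1 <= loge x.
Proof.
move=> x0; rewrite -[X in X <= _]expRK ler_ln ?posrE ?expR_gt0//.
  by rewrite lerDr.
by rewrite ltr_wpDl// expR_gt0.
Qed.

(** A value x above the level at t is at least of order the square root of t, and 2 ^ k
    is at most of order log t, hence of order log x. *)
Lemma pow_block_index_le_loge (x : R) t : (D 0 < t)%N -> trunc_level t < x ->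
  (2 ^+ block_index t) ^+ 4 <= (20 * loge x) ^+ 4.
Proof.
move=> t2 xl; have x0 : 0 < x by apply: le_lt_trans xl; exact: trunc_level_ge0.
have hx := above_level_le t2 xl.
have l1 := loge_ge1 (ltW x0).
rewrite ler_pXn2r ?nnegrE ?exprn_ge0//; last by rewrite mulr_ge0//; lra.
have [kt _] := block_index_bounds t2.
have : ln (D (block_index t))%:R <= ln (2 ^+ 16 * x ^+ 2) :> R.
  apply: ler_ln_pos; first by rewrite ltr0n D_gt0.
  by rewrite (le_trans _ hx)// ler_nat ltnW.
have -> : ln (D (block_index t))%:R = ln 2 * 2 ^+ block_index t :> R.
  by rewrite /D natrX lnXn// -[in RHS]natrX mulr_natr.
rewrite lnM ?posrE ?exprn_gt0// !lnXn// => h.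
have lx : ln x <= loge x.
  by apply: ler_ln_pos => //; rewrite lerDl expR_ge0.
have l2 := half_le_ln2.
have : ln 2 * 2 ^+ block_index t <= ln 2 * (20 * loge x).
  apply: (le_trans h).
  have : 1 / 2 * loge x <= ln 2 * loge x by rewrite ler_wpM2r//; lra.
  have : ln 2 * 1 <= ln 2 * loge x by rewrite ler_wpM2l//; lra.
  rewrite -[ln 2 *+ 16]mulr_natl -[ln x *+ 2]mulr_natl.
  rewrite [ln 2 * (20 * _)]mulrCA.
  by move: l1 lx {hx h xl x0}; move: (ln 2 * loge x) (ln x) (loge x) (ln 2) => p q r s; lra.
by rewrite ler_pM2l// ln2_gt0.
Qed.

(** The values between the level and t: the indices t that x sees form a window
    [x, L x] with L a power of log x, so that only a double logarithm appears. *)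
Lemma sum_window_level (x : R) n : 0 <= x ->
  \sum_((D 1).+1 <= t < n) (if (x <= trunc_level t) || (t%:R < x) then 0 else x) / t%:R <=
    x * (2 * ln ((20 * loge x) ^+ 4 + 1)).
Proof.
move=> x0; pose L := (20 * loge x) ^+ 4; pose y1 := Num.max x 1.
have l1 := loge_ge1 x0.
have L1 : 1 <= L by rewrite exprn_ege1//; lra.
have y11 : 1 <= y1 by rewrite le_max lexx orbT.
have xy1 : x <= y1 by rewrite le_max lexx.
have y10 : 0 < y1 by lra.
have y12 : y1 <= L * y1 + 1.
  by rewrite (le_trans (y := L * y1))// ?ler_peMl//; lra.
have h := @sum_inv_window R y1 (L * y1) n y10 y12.
have h2 : ln (L * y1 + 1) - ln y1 <= ln (L + 1).
  rewrite lerBlDr -lnM ?posrE//; last by lra.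
  apply: ler_ln_pos; first by rewrite ltr_wpDl// mulr_ge0//; lra.
  rewrite mulrDl mul1r; lra.
apply: (@le_trans _ _ (x * (2 * (ln (L * y1 + 1) - ln y1)))); last first.
  by rewrite ler_wpM2l// ler_wpM2l.
apply: le_trans (ler_wpM2l x0 h); rewrite mulr_sumr.
apply: (@le_trans _ _ (\sum_((D 1).+1 <= t < n) x * (if (y1 <= t%:R) && (t%:R <= L * y1) then t%:R^-1 else 0))).
  rewrite big_nat [leRHS]big_nat; apply: ler_sum => t /andP[t4 _].
  have t2 : (D 0 < t)%N by rewrite (leq_trans _ t4)// ltnS D_mono.
  have t1 : 1 <= t%:R :> R by rewrite ler1n (leq_trans _ t4).
  case: (leP x (trunc_level t)) => [_|xl] /=.
    by rewrite mul0r mulr_ge0//; case: ifP.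
  case: (ltP t%:R x) => [_|xt].
    by rewrite mul0r mulr_ge0//; case: ifP.
  rewrite ifT//; apply/andP; split; first by rewrite /y1 ge_max xt t1.
  move: (xl); rewrite {1}/trunc_level ltr_pdivrMr ?pow_block_index_gt0// => /ltW h3.
  rewrite (le_trans h3)// mulrC; apply: ler_pM => //.
    exact: pow_block_index_le_loge.
have [n1|n1] := leqP (D 1).+1 n; last first.
  rewrite big_geq; last exact: ltnW.
  by apply: sumr_ge0 => t _; rewrite mulr_ge0//; case: ifP; rewrite ?invr_ge0.
rewrite [leRHS](@big_cat_nat _ _ _ (D 1).+1)//= lerDr.
by apply: sumr_ge0 => t _; rewrite mulr_ge0//; case: ifP; rewrite ?invr_ge0.
Qed.

(** Here and in the next lemma the bound is put in terms of the integrand of the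
    moment condition. *)
Lemma above_level_weight_le (x : R) : 0 <= x ->
  x * (2 * ln (2 ^+ 16 * x ^+ 2 + 1)) <= 34 * ln 2 * x + 4 * Num.max (x * ln x) 0.
Proof.
move=> x0; pose p : R := 2 ^+ 16.
have p1 : 1 <= p by rewrite exprn_ege1// ler1n.
have p0 : 0 < p by lra.
have lnp : ln (2 * p) = 17 * ln 2.
  by rewrite /p -exprS lnXn// mulr_natl.
have [x1|x1] := leP x 1.
  have h : ln (p * x ^+ 2 + 1) <= 17 * ln 2.
    rewrite -lnp; apply: ler_ln_pos.
      by rewrite ltr_wpDl// mulr_ge0 ?sqr_ge0 ?(ltW p0).
    have x2 : x ^+ 2 <= 1 by rewrite exprn_ile1.
    by have := ler_wpM2l (ltW p0) x2; lra.
  have : 0 <= Num.max (x * ln x) 0 by rewrite le_max lexx orbT.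
  have := ler_wpM2l x0 h; rewrite -/p.
  move: (ln (p * x ^+ 2 + 1)) => a; lra.
have xp : 0 < x by lra.
have x2 : 1 <= x ^+ 2 by rewrite exprn_ege1// ltW.
have h : ln (p * x ^+ 2 + 1) <= 17 * ln 2 + 2 * ln x.
  rewrite -lnp [2 * ln x]mulr_natl -lnXn// -lnM ?posrE ?mulr_gt0 ?exprn_gt0//.
  apply: ler_ln_pos; first by rewrite ltr_wpDl// mulr_ge0 ?sqr_ge0 ?(ltW p0).
  by have := ler_wpM2l (ltW p0) x2; lra.
have hm : x * ln x <= Num.max (x * ln x) 0 by rewrite le_max lexx.
have := ler_wpM2l x0 h; rewrite -/p; lra.
Qed.

Lemma window_weight_le (x : R) : 0 <= x ->
  x * (2 * ln ((20 * loge x) ^+ 4 + 1)) <=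
    (2 * ln 2 + 8 * ln 20) * x + 8 * (x * ln (loge x)).
Proof.
move=> x0; have l1 := loge_ge1 x0; have l0 : 0 < loge x by lra.
have L1 : 1 <= (20 * loge x) ^+ 4 by rewrite exprn_ege1//; lra.
have h : ln ((20 * loge x) ^+ 4 + 1) <= ln 2 + 4 * (ln 20 + ln (loge x)).
  have -> : ln 20 + ln (loge x) = ln (20 * loge x) by rewrite lnM ?posrE.
  have L0 : 0 < 20 * loge x by rewrite mulr_gt0.
  rewrite [4 * _]mulr_natl -lnXn// -lnM ?posrE ?exprn_gt0//.
  by apply: ler_ln_pos; lra.
have := ler_wpM2l x0 h; lra.
Qed.

End Pointwise_sums.

Section Identically_distributed_noise.
Context {R : realType} {d : measure_display} {T : measurableType d}.
Variable P : probability T R.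
Variable eps : nat -> {RV P >-> R[i]}.
Local Open Scope ereal_scope.

Let meps t : measurable_fun setT (eps t). Proof. exact: measurable_funPT. Qed.

Lemma iid_sum_integral_le (g : nat -> R[i] -> R) (G : R[i] -> R) a n :
  identically_distributed eps -> (0 < a)%N ->
  (forall t, measurable_fun setT (g t)) -> (forall t z, (0 <= g t z)%R) ->
  measurable_fun setT G ->
  (forall z, (\sum_(a <= t < n) g t z <= G z)%R) ->
  \sum_(a <= t < n) \int[P]_w (g t (eps t w))%:E <= \int[P]_w (G (eps 1%N w))%:E.
Proof.
move=> law a0 mg g0 mG gG.
have mge t : measurable_fun setT (fun w => (g t (eps 1%N w))%:E).
  by apply/measurable_EFinP; exact: (measurableT_comp (mg t) (meps _)).
apply: (@le_trans _ _ (\sum_(a <= t < n) \int[P]_w (g t (eps 1%N w))%:E)).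
  rewrite big_nat [leRHS]big_nat; apply: lee_sum => t /andP[at' _].
  by rewrite (@integral_same_law _ _ _ P (eps t) (eps 1%N))//; apply: law => //; apply: leq_trans at'.
rewrite -ge0_integral_sum//; last by move=> t w _; rewrite lee_fin.
apply: ge0_le_integral => //.
- by move=> w _; apply: sume_ge0 => t _; rewrite lee_fin.
- exact: emeasurable_sum.
- by apply/measurable_EFinP; exact: (measurableT_comp mG (meps _)).
- by move=> w _; rewrite sumEFin lee_fin.
Qed.

Lemma measurable_level_rest t :
  measurable_fun setT (fun z : R[i] => normc (z - trunc (trunc_level t) z) / t%:R)%R.
Proof. by apply: measurable_funM => //; exact: measurable_rest. Qed.

(** The variance on a block: once the factor [16 ^ k] is put into the variable,
    the truncation at [t / 16 ^ k] makes the series of [x ^ 2 / t ^ 2] start at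
    [t = 16 ^ k x], whence it is at most [2 x / 16 ^ k]. *)
Lemma iid_truncated_bounded (EX : R) (m : nat -> R) : iid eps ->
  \int[P]_w (normc (eps 1%N w))%:E <= EX%:E ->
  (forall t, (0 <= m t)%R) ->
  (forall t, (D 1 < t)%N ->
    `|\int[P]_w (complex.Re (trunc (trunc_level t) (eps t w)))%:E| <= (t%:R * m t)%:E /\
    `|\int[P]_w (complex.Im (trunc (trunc_level t) (eps t w)))%:E| <= (t%:R * m t)%:E) ->
  (exists B : R, forall n, \sum_(1 <= t < n) m t <= B)%R ->
  {ae P, forall w, exists B : R, forall n,
    (\sum_(1 <= t < n) normc (eps t w - trunc (trunc_level t) (eps t w)) / t%:R <= B)%R} ->
  ae_bounded_waves eps.
Proof.
move=> [indep law] hEX m0 hm sm rest.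
pose g t (z : R[i]) : R := (normc (trunc (trunc_level t) z) ^+ 2 / t%:R ^+ 2)%R.
have g0 t z : (0 <= g t z)%R by rewrite divr_ge0 ?exprn_ge0 ?normc_ge0.
have mg t : measurable_fun setT (g t).
  by apply: measurable_funM => //; apply: measurable_funX; exact: measurable_normc_trunc.
have gb t z : (g t z <= trunc_level t ^+ 2 / t%:R ^+ 2 :> R)%R.
  rewrite ler_wpM2r ?invr_ge0 ?exprn_ge0//.
  by rewrite ler_pXn2r ?nnegrE ?normc_ge0 ?trunc_level_ge0// normc_trunc_le// trunc_level_ge0.
have ig t : P.-integrable setT (EFin \o (fun w => g t (eps t w))).
  apply: (@bounded_integrable _ _ _ _ _ (trunc_level t ^+ 2 / t%:R ^+ 2)%R).
    exact: (measurableT_comp (mg t) (meps t)).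
  by move=> w; rewrite ger0_norm.
pose v t : R := fine (\int[P]_w (g t (eps t w))%:E).
have vE t : (v t)%:E = \int[P]_w (g t (eps t w))%:E.
  by rewrite fineK//; exact: (integrable_fin_num measurableT (ig t)).
have v0 t : (0 <= v t)%R by rewrite -lee_fin vE; apply: integral_ge0 => w _; rewrite lee_fin.
pose l k : R := ((2 ^+ k) ^+ 2 / 2)%R.
have p0 k : (0 < 2 ^+ k :> R)%R by rewrite exprn_gt0.
have p1 k : (1 <= 2 ^+ k :> R)%R by rewrite exprn_ege1// ler1n.
have l0 k : (0 < l k)%R by rewrite divr_gt0 ?exprn_gt0.
have EX0 : (0 <= EX)%R.
  by rewrite -lee_fin (le_trans _ hEX)// integral_ge0// => w _; rewrite lee_fin normc_ge0.
have hv k : (0 < k)%N -> ((2 ^+ k) ^+ 4 *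
    \sum_((D k).+1 <= t < (D k.+1).+1) v t <= 2 * EX)%R.
  move=> k0; have q0 : (0 < (2 ^+ k) ^+ 4 :> R)%R by rewrite exprn_gt0.
  pose g' t z : R := ((2 ^+ k) ^+ 4 * (if normc z <= t%:R / (2 ^+ k) ^+ 4 then normc z ^+ 2 / t%:R ^+ 2 else 0))%R.
  have gg' t z : ((D k).+1 <= t < (D k.+1).+1)%N -> ((2 ^+ k) ^+ 4 * g t z)%R = g' t z.
    move=> /andP[kt tk]; rewrite /g /g' /trunc /trunc_level (block_indexE kt tk).
    by case: ifP => //; rewrite normc0 expr0n mul0r.
  have := @iid_sum_integral_le (fun t z => if ((D k).+1 <= t < (D k.+1).+1)%N then (2 ^+ k) ^+ 4 * g t z else 0)%R
     (fun z => 2 * normc z)%R (D k).+1 (D k.+1).+1 law erefl.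
  move=> /(_ _ _ _ _); rewrite -lee_fin.
  have -> : ((2 ^+ k) ^+ 4 * \sum_((D k).+1 <= t < (D k.+1).+1) v t)%:E =
     \sum_((D k).+1 <= t < (D k.+1).+1) \int[P]_w
       (if ((D k).+1 <= t < (D k.+1).+1)%N then (2 ^+ k) ^+ 4 * g t (eps t w) else 0)%:E.
    rewrite mulr_sumr -sumEFin; apply: eq_big_nat => t ->.
    rewrite EFinM vE -ge0_integralZl_EFin ?(ltW q0)//.
    - by move=> w _; rewrite lee_fin.
    - by apply/measurable_EFinP; exact: (measurableT_comp (mg t) (meps t)).
  move=> h; apply: le_trans (h _ _ _ _) _.
  - by move=> t; case: ((D k).+1 <= t < (D k.+1).+1)%N => //; exact: measurable_funM.
  - by move=> t z; case: ifP => // _; rewrite mulr_ge0// ltW.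
  - by apply: measurable_funM => //; exact: measurable_normc.
  - move=> z; rewrite mulrC.
    have := @sum_inv_square_tail R ((2 ^+ k) ^+ 4 * normc z)%R (D k).+1 (D k.+1).+1.
    rewrite mulr_ge0 ?(ltW q0) ?normc_ge0// => /(_ erefl erefl) h2.
    apply: le_trans (ler_wpM2l (normc_ge0 z) h2); rewrite mulr_sumr le_eqVlt; apply/orP; left.
    apply/eqP; apply: eq_big_nat => t tk; rewrite tk gg'// /g'.
    rewrite ler_pdivlMr// [(normc z * _)%R in X in X = _]mulrC.
    by case: ifP => _; rewrite ?mulr0// expr2; ring.
  - under eq_integral do rewrite EFinM.
    rewrite ge0_integralZl_EFin//; first by rewrite EFinM lee_wpmul2l.
    + by move=> w _; rewrite lee_fin normc_ge0.
    + by apply/measurable_EFinP; exact: (measurableT_comp measurable_normc (meps _)).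
apply: (ae_partial_sums_bounded indep (u := trunc_level) (m := m) (v := v) (l := l) (C := (EX / 2)%R)) => //.
- by rewrite divr_ge0.
- move=> k t k0 kt tk.
  have t1 : (D 1 < t)%N by rewrite (leq_ltn_trans _ kt)// D_mono.
  have tr : (0 < t%:R :> R)%R by rewrite ltr0n (leq_ltn_trans _ kt).
  have [hre him] := hm _ t1; split => //; first exact: trunc_level_ge0.
    rewrite /l /trunc_level (block_indexE kt tk); move: (p0 k) (p1 k); move: (2 ^+ k : R)%R => p p0' p1'.
    have -> : (p ^+ 2 / 2 * (t%:R / p ^+ 4 / t%:R) = 1 / 2 / p ^+ 2)%R.
      by field; rewrite !gt_eqF.
    by rewrite ler_pdivrMr ?exprn_gt0// ler_peMr ?divr_ge0// exprn_ege1.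
  rewrite EFinM vE -ge0_integralZl_EFin ?exprn_ge0//; last 2 first.
  + by move=> w _; rewrite lee_fin.
  + by apply/measurable_EFinP; exact: (measurableT_comp (mg t) (meps t)).
  under [leRHS]eq_integral do rewrite -EFinM /g mulrC divfK ?expf_neq0 ?gt_eqF//.
  exact: lexx.
- move=> k k0; have := hv k k0; rewrite /l; have := p1 k; move: (2 ^+ k : R)%R => p p1'.
  move: (\sum_(_ <= t < _) v t)%R => S hS.
  have -> : ((p ^+ 2 / 2) ^+ 2 * S = p ^+ 4 * S / 4)%R by field.
  have : (EX * 1 <= EX * p)%R by rewrite ler_wpM2l.
  move: hS; move: (p ^+ 4 * S)%R => z; lra.
- exists 4%R => n; apply: (@le_trans _ _ (2 * \sum_(0 <= k < n) (1 / 2) ^+ k)%R).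
    rewrite mulr_sumr; apply: ler_sum => k _; rewrite /l.
    have -> : ((1 / 2 : R) ^+ k = (2 ^+ k)^-1)%R by rewrite mul1r exprVn.
    have := p0 k; move: (2 ^+ k : R)%R => p p0'.
    have -> : (p / (p ^+ 2 / 2) = 2 / p)%R by field; rewrite gt_eqF.
    exact: lexx.
  by have := @sum_geometric R n; lra.
Qed.

(** The integral of a function without sign is a difference of two integrals; it is
    below infinity for the positive part as soon as the negative part is integrable. *)
Lemma integral_pos_part_lty (f : T -> R) (C : R) : measurable_fun setT f ->
  (forall w, (- C <= f w)%R) -> \int[P]_w (f w)%:E < +oo ->
  \int[P]_w (Num.max (f w) 0)%R%:E < +oo.
Proof.
move=> mf fC; rewrite integralE => h.
have neg : \int[P]_w ((fun w => (f w)%:E)^\- w) <= `|C|%:E.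
  apply: (@le_trans _ _ (\int[P]_w (cst `|C|%:E w))).
    apply: ge0_le_integral => //.
    - by apply: measurable_funeneg; exact/measurable_EFinP.
    - move=> w _ /=; rewrite funenegE -EFin_max lee_fin ge_max normr_ge0 andbT.
      by have := fC w; have := ler_norm C; lra.
  by rewrite integral_cst// [X in _ * X]probability_setT mule1.
have -> : \int[P]_w (Num.max (f w) 0)%R%:E = \int[P]_w ((fun w => (f w)%:E)^\+ w).
  by apply: eq_integral => w _; rewrite funeposE EFin_max.
have neg0 : 0 <= \int[P]_w ((fun w => (f w)%:E)^\- w).
  by apply: integral_ge0 => w _; exact: funeneg_ge0.
have nfin : \int[P]_w ((fun w => (f w)%:E)^\- w) \is a fin_num.
  by rewrite ge0_fin_numE// (le_lt_trans neg)// ltry.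
by move: h; rewrite -(fineK nfin) lteBlDr// addye.
Qed.

(** The mean being zero, the truncated variable and the truncated part have opposite
    means; phi stands for the real or the imaginary part. *)
Lemma zero_mean_trunc_le (X : {RV P >-> R[i]}) (phi : R[i] -> R) (u : R) : (0 <= u)%R ->
  measurable_fun setT phi -> (forall z, (`|phi z| <= normc z)%R) ->
  {morph phi : x y / (x - y)%R} -> measurable_fun setT (fun z => phi (trunc u z)) ->
  P.-integrable setT (EFin \o (fun w => phi (X w))) -> \int[P]_w (phi (X w))%:E = 0 ->
  `|\int[P]_w (phi (trunc u (X w)))%:E| <= \int[P]_w (normc (X w - trunc u (X w)))%:E.
Proof.
move=> u0 mphi phi_le phiB mt iX EX.
have mX : measurable_fun setT X by exact: measurable_funPT.
have it : P.-integrable setT (EFin \o (fun w => phi (trunc u (X w)))).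
  apply: (@bounded_integrable _ _ _ _ _ u); first exact: (measurableT_comp mt mX).
  by move=> w; rewrite (le_trans (phi_le _))// normc_trunc_le.
have E : \int[P]_w (phi (X w - trunc u (X w)))%:E = - \int[P]_w (phi (trunc u (X w)))%:E.
  under eq_integral do rewrite phiB EFinB.
  by rewrite integralB// EX add0e.
have mr : measurable_fun setT (fun w => phi (X w - trunc u (X w))%R).
  under eq_fun do rewrite phiB.
  apply: measurable_funB; first exact: (measurableT_comp mphi mX).
  exact: (measurableT_comp mt mX).
rewrite -abseN -E; apply: le_trans (le_abse_integral _ _ _) _ => //.
  exact/measurable_EFinP.
apply: ge0_le_integral => //.
- by apply: measurableT_comp => //; exact/measurable_EFinP.
- apply/measurable_EFinP; exact: (measurableT_comp (measurable_rest _) mX).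
- by move=> w _; rewrite /= lee_fin.
Qed.

Lemma sums_from_one (e : nat -> R) a B : (forall t, 0 <= e t)%R ->
  (forall n, \sum_(a <= t < n) e t <= B)%R -> forall n,
  (\sum_(1 <= t < n) e t <= \sum_(0 <= t < a) e t + B)%R.
Proof.
move=> e0 eB n; apply: (@le_trans _ _ (\sum_(0 <= t < n) e t)%R).
  have [n1|n1] := leqP 1 n.
    by rewrite [leRHS](@big_cat_nat _ _ _ 1)//= lerDr sumr_ge0.
  by rewrite big_geq ?sumr_ge0// ltnW.
have [an|na] := leqP a n; first by rewrite (@big_cat_nat _ _ _ a)//= lerD2l.
rewrite (le_trans (y := \sum_(0 <= t < a) e t)%R)//.
  by rewrite [leRHS](@big_cat_nat _ _ _ n)//= ?lerDl ?sumr_ge0// ltnW.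
by rewrite lerDl; have := eB 0%N; rewrite big_geq.
Qed.

End Identically_distributed_noise.

Section Iid_cases.
Context {R : realType} {d : measure_display} {T : measurableType d}.
Variable P : probability T R.
Variable eps : nat -> {RV P >-> R[i]}.
Local Open Scope ereal_scope.

Let meps t : measurable_fun setT (eps t). Proof. exact: measurable_funPT. Qed.
Let mnorm t : measurable_fun setT (fun w => normc (eps t w)).
Proof. exact: (measurableT_comp measurable_normc (meps t)). Qed.

Lemma first_moment_same_law t : identically_distributed eps -> (0 < t)%N ->
  \int[P]_w (normc (eps t w))%:E = \int[P]_w (normc (eps 1%N w))%:E.
Proof.
move=> law t0; apply: integral_same_law; last exact: normc_ge0.
- by move=> B mB; exact: law.
- exact: measurable_normc.
Qed.

Lemma lincomb_integral_lty (f g : T -> R) (x y : R) : (0 <= x)%R -> (0 <= y)%R ->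
  measurable_fun setT f -> measurable_fun setT g ->
  (forall w, (0 <= f w)%R) -> (forall w, (0 <= g w)%R) ->
  \int[P]_w (f w)%:E < +oo -> \int[P]_w (g w)%:E < +oo ->
  \int[P]_w (x * f w + y * g w)%:E < +oo.
Proof.
move=> x0 y0 mf mg f0 g0 ff gf; under eq_integral do rewrite EFinD 2!EFinM.
rewrite ge0_integralD//; last 4 first.
- by move=> w _; rewrite -EFinM lee_fin mulr_ge0.
- by apply/measurable_EFinP/measurable_funM.
- by move=> w _; rewrite -EFinM lee_fin mulr_ge0.
- by apply/measurable_EFinP/measurable_funM.
rewrite !ge0_integralZl_EFin//; last 4 first.
- by move=> w _; rewrite lee_fin.
- exact/measurable_EFinP.
- by move=> w _; rewrite lee_fin.
- exact/measurable_EFinP.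
by rewrite lte_add_pinfty// lte_mul_pinfty ?lee_fin.
Qed.

Let rest t w : R := (normc (eps t w - trunc (trunc_level t) (eps t w)) / t%:R)%R.

Let mrest t : measurable_fun setT (rest t).
Proof. exact: (measurableT_comp (@measurable_level_rest _ t) (meps t)). Qed.

Let rest_ge0 t w : (0 <= rest t w)%R.
Proof. by rewrite divr_ge0 ?normc_ge0. Qed.

(** The parts above the level are summable in the mean: exchanging sum and integral,
    the value x contributes x times the sum of 1 / t over [t <= 2 ^ 16 x ^ 2], that is
    x log x. The same sums bound the means of the truncated variables. *)
Lemma noise1_bounded : noise1 eps -> ae_bounded_waves eps.
Proof.
move=> [[indep law] h1].
have [[iRe iIm ERe EIm] Elog] := h1 1%N erefl.
have first_fin : \int[P]_w (normc (eps 1%N w))%:E < +oo.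
  apply: (@le_lt_trans _ _ (\int[P]_w (`|(complex.Re (eps 1%N w))%:E| + `|(complex.Im (eps 1%N w))%:E|))).
    apply: ge0_le_integral => //.
    - by move=> w _; rewrite lee_fin normc_ge0.
    - exact/measurable_EFinP.
    - apply: emeasurable_funD; apply: measurableT_comp => //.
        exact: (measurable_int _ iRe).
      exact: (measurable_int _ iIm).
    - by move=> w _; rewrite -EFinD lee_fin normc_le_ReIm.
  rewrite ge0_integralD//; last 2 first.
  - by apply: measurableT_comp => //; exact: (measurable_int _ iRe).
  - by apply: measurableT_comp => //; exact: (measurable_int _ iIm).
  by rewrite lte_add_pinfty//; [case/integrableP: iRe|case/integrableP: iIm].
pose xlnx w : R := (normc (eps 1%N w) * ln (normc (eps 1%N w)))%R.
have mxlnx : measurable_fun setT xlnx.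
  by apply: measurable_funM => //; exact: (measurableT_comp (@measurable_ln _) (mnorm _)).
have pos_fin : \int[P]_w (Num.max (xlnx w) 0)%R%:E < +oo.
  apply: (@integral_pos_part_lty _ _ _ _ xlnx 1%R) => //; last by rewrite unlock in Elog.
  move=> w; rewrite /xlnx; have := normc_ge0 (eps 1%N w).
  move: (normc _) => x; rewrite le_eqVlt => /predU1P[<-|x0]; first by rewrite mul0r lerN10.
  have := @le_ln1Dx R (x^-1 - 1)%R.
  rewrite ltrBrDr addNr invr_gt0 => /(_ x0); rewrite addrCA subrr addr0 lnV ?posrE// => h.
  have := ler_wpM2l (ltW x0) h; rewrite mulrN mulrBr mulfV ?gt_eqF//; lra.
have EX0 : 0 <= \int[P]_w (normc (eps 1%N w))%:E.
  by apply: integral_ge0 => w _; rewrite lee_fin normc_ge0.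
have EXfin : \int[P]_w (normc (eps 1%N w))%:E \is a fin_num by rewrite ge0_fin_numE.
pose G (z : R[i]) : R := (34 * ln 2 * normc z + 4 * Num.max (normc z * ln (normc z)) 0)%R.
have mG : measurable_fun setT G.
  apply: measurable_funD.
    by apply: measurable_funM => //; exact: measurable_normc.
  apply: measurable_funM => //; apply: measurable_maxr => //.
  apply: measurable_funM; first exact: measurable_normc.
  exact: (measurableT_comp (@measurable_ln _) measurable_normc).
have G0 z : (0 <= G z)%R.
  rewrite /G addr_ge0 ?mulr_ge0 ?normc_ge0 ?ln_ge0 ?ler1n// le_max lexx orbT //.
have Gfin : \int[P]_w (G (eps 1%N w))%:E < +oo.
  apply: (@lincomb_integral_lty (fun w => normc (eps 1%N w)) (fun w => Num.max (xlnx w) 0)%R) => //.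
  - by rewrite mulr_ge0 ?ln_ge0 ?ler1n.
  - exact: measurable_maxr.
  - by move=> w; rewrite normc_ge0.
  - by move=> w; rewrite le_max lexx orbT.
have Gfn : \int[P]_w (G (eps 1%N w))%:E \is a fin_num.
  by rewrite ge0_fin_numE// integral_ge0// => w _; rewrite lee_fin.
have rest_le t w : (0 < t)%N -> (rest t w <= normc (eps t w))%R.
  move=> t0; have tr : (1 <= t%:R :> R)%R by rewrite ler1n.
  rewrite /rest ler_pdivrMr ?(lt_le_trans ltr01)// rest_truncE; case: ifP => _.
    by rewrite mulr_ge0 ?normc_ge0.
  by rewrite ler_peMr ?normc_ge0.
pose e t : R := fine (\int[P]_w (rest t w)%:E).
have Erest0 t : 0 <= \int[P]_w (rest t w)%:E by apply: integral_ge0 => w _; rewrite lee_fin.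
have e0 t : (0 <= e t)%R by rewrite fine_ge0.
have eE t : (0 < t)%N -> (e t)%:E = \int[P]_w (rest t w)%:E.
  move=> t0; rewrite fineK// ge0_fin_numE// (le_lt_trans _ first_fin)//.
  rewrite -(first_moment_same_law law t0); apply: ge0_le_integral => //.
  - by move=> w _; rewrite lee_fin.
  - exact/measurable_EFinP.
  - exact/measurable_EFinP.
  - by move=> w _; rewrite lee_fin rest_le.
have sume n : (\sum_((D 1).+1 <= t < n) e t <= fine (\int[P]_w (G (eps 1%N w))%:E))%R.
  rewrite -lee_fin fineK// -sumEFin.
  rewrite (eq_big_nat _ _ (F2 := fun t => \int[P]_w (rest t w)%:E)); last first.
    by move=> t /andP[t4 _]; rewrite eE// (leq_trans _ t4).
  apply: (@iid_sum_integral_le _ _ _ P eps (fun t z => normc (z - trunc (trunc_level t) z) / t%:R)%R) => //.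
  - by move=> t; exact: measurable_level_rest.
  - by move=> t z; rewrite divr_ge0 ?normc_ge0.
  - move=> z; under eq_bigr do rewrite rest_truncE.
    apply: le_trans (sum_above_level n (normc_ge0 z)) _.
    exact: above_level_weight_le (normc_ge0 z).
apply: (@iid_truncated_bounded _ _ _ P eps (fine (\int[P]_w (normc (eps 1%N w))%:E)) e) => //.
- by rewrite fineK.
- move=> t t4; have t0 : (0 < t)%N by apply: leq_ltn_trans t4.
  have tr : (0 < t%:R :> R)%R by rewrite ltr0n.
  have [[iRet iImt ERet EImt] _] := h1 t t0; rewrite unlock in ERet EImt.
  have -> : (t%:R * e t)%:E = \int[P]_w (normc (eps t w - trunc (trunc_level t) (eps t w)))%:E.
    rewrite EFinM eE// -ge0_integralZl_EFin//; last 2 first.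
    + by move=> w _; rewrite lee_fin.
    + exact/measurable_EFinP.
    by apply: eq_integral => w _; rewrite -EFinM /rest mulrC divfK// gt_eqF.
  split; apply: zero_mean_trunc_le => //; try exact: trunc_level_ge0.
  + exact: measurable_Re.
  + exact: abs_Re_le.
  + by move=> [? ?] [? ?].
  + exact: measurable_Re_trunc.
  + exact: measurable_Im.
  + exact: abs_Im_le.
  + by move=> [? ?] [? ?].
  + exact: measurable_Im_trunc.
- by eexists => n; apply: (sums_from_one e0 sume).
- apply: (ae_weighted_sums (e := e) (a := (D 1).+1)) => //.
  by move=> t t4; rewrite eE// (leq_trans _ t4).
Qed.

(** By symmetry the truncated variables have mean zero, so the truncated parts need
    only be summable almost surely, not in the mean. Values above t occur finitely
    often, because the first moment is finite, and the values between the level and t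
    are summable in the mean by [sum_window_level]. *)
Lemma noise2_bounded : noise2 eps -> ae_bounded_waves eps.
Proof.
move=> [[indep law] h2].
have [sym1 Elog] := h2 1%N erefl; rewrite unlock in Elog.
pose xll (z : R[i]) : R := (normc z * ln (loge (normc z)))%R.
have mxll : measurable_fun setT xll.
  apply: measurable_funM; first exact: measurable_normc.
  apply: (measurableT_comp (@measurable_ln _)); apply: (measurableT_comp (@measurable_ln _)).
  by apply: measurable_funD => //; exact: measurable_normc.
have loge1 z : (1 <= loge (normc z) :> R)%R by apply: loge_ge1; exact: normc_ge0.
have ll0 z : (0 <= ln (loge (normc z)) :> R)%R by rewrite ln_ge0.
have xll0 z : (0 <= xll z)%R by rewrite mulr_ge0 ?normc_ge0.
have mxllX : measurable_fun setT (fun w => xll (eps 1%N w)).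
  exact: (measurableT_comp mxll (meps _)).
have xll_fin : \int[P]_w (xll (eps 1%N w))%:E < +oo by exact: Elog.
have norm_le z : (normc z <= expR (expR 1) + xll z)%R.
  have [|h] := leP (normc z) (expR (expR 1)); first by move=> h; rewrite ler_wpDr.
  rewrite ler_wpDl ?expR_ge0// /xll ler_peMr ?normc_ge0//.
  rewrite -[X in (X <= _)%R]expRK ler_ln ?posrE ?expR_gt0//; last exact: lt_le_trans (loge1 z).
  rewrite -[X in (X <= _)%R]expRK ler_ln ?posrE ?expR_gt0//.
    by rewrite (le_trans (ltW h))// lerDl expR_ge0.
  by rewrite ltr_wpDl ?normc_ge0// expR_gt0.
have first_fin : \int[P]_w (normc (eps 1%N w))%:E < +oo.
  apply: (@le_lt_trans _ _ (\int[P]_w ((expR (expR 1))%:E + (xll (eps 1%N w))%:E))).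
    apply: ge0_le_integral => //.
    - by move=> w _; rewrite lee_fin normc_ge0.
    - exact/measurable_EFinP.
    - by apply: emeasurable_funD => //; exact/measurable_EFinP.
    - by move=> w _; rewrite -EFinD lee_fin.
  rewrite ge0_integralD//; first last.
  - exact/measurable_EFinP.
  - by move=> w _; rewrite lee_fin.
  by rewrite lte_add_pinfty// integral_cst// [X in _ * X]probability_setT mule1 ltry.
have EX0 : 0 <= \int[P]_w (normc (eps 1%N w))%:E.
  by apply: integral_ge0 => w _; rewrite lee_fin normc_ge0.
have EXfin : \int[P]_w (normc (eps 1%N w))%:E \is a fin_num by rewrite ge0_fin_numE.
pose c : R := (2 * ln 2 + 8 * ln 20)%R.
have c0 : (0 <= c)%R by rewrite addr_ge0 ?mulr_ge0 ?ln_ge0 ?ler1n.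
pose G (z : R[i]) : R := (c * normc z + 8 * xll z)%R.
have mG : measurable_fun setT G.
  by apply: measurable_funD; apply: measurable_funM => //; exact: measurable_normc.
have G0 z : (0 <= G z)%R by rewrite addr_ge0 ?mulr_ge0 ?normc_ge0.
have Gfin : \int[P]_w (G (eps 1%N w))%:E < +oo.
  apply: (@lincomb_integral_lty (fun w => normc (eps 1%N w)) (fun w => xll (eps 1%N w))) => //.
  by move=> w; rewrite normc_ge0.
have Gfn : \int[P]_w (G (eps 1%N w))%:E \is a fin_num.
  by rewrite ge0_fin_numE// integral_ge0// => w _; rewrite lee_fin.
pose window t (z : R[i]) : R :=
  ((if (normc z <= trunc_level t)%R || (t%:R < normc z)%R then 0 else normc z) / t%:R)%R.
have window0 t z : (0 <= window t z)%R.
  by rewrite divr_ge0//; case: ifP => // _; exact: normc_ge0.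
have mwindow t : measurable_fun setT (window t).
  apply: measurable_funM => //; apply: measurable_fun_ifT => //; last exact: measurable_normc.
  apply: measurable_or; first exact: measurable_normc_le.
  by apply: measurable_fun_ltr => //; exact: measurable_normc.
pose e t : R := fine (\int[P]_w (window t (eps t w))%:E).
have e0 t : (0 <= e t)%R.
  by rewrite fine_ge0// integral_ge0// => w _; rewrite lee_fin.
have eE t : (0 < t)%N -> (e t)%:E = \int[P]_w (window t (eps t w))%:E.
  move=> t0; have tr : (1 <= t%:R :> R)%R by rewrite ler1n.
  rewrite fineK// ge0_fin_numE; last by apply: integral_ge0 => w _; rewrite lee_fin.
  rewrite (le_lt_trans _ first_fin)//.
  rewrite -(first_moment_same_law law t0); apply: ge0_le_integral => //.
  - by move=> w _; rewrite lee_fin.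
  - by apply/measurable_EFinP; exact: (measurableT_comp (mwindow t) (meps t)).
  - exact/measurable_EFinP.
  - move=> w _; rewrite lee_fin /window ler_pdivrMr ?(lt_le_trans ltr01)//.
    case: ifP => _; first by rewrite mulr_ge0 ?normc_ge0.
    by rewrite ler_peMr ?normc_ge0.
have sume n : (\sum_((D 1).+1 <= t < n) e t <= fine (\int[P]_w (G (eps 1%N w))%:E))%R.
  rewrite -lee_fin fineK// -sumEFin.
  rewrite (eq_big_nat _ _ (F2 := fun t => \int[P]_w (window t (eps t w))%:E)); last first.
    by move=> t /andP[t4 _]; rewrite eE// (leq_trans _ t4).
  apply: iid_sum_integral_le => // z.
  apply: le_trans (sum_window_level n (normc_ge0 z)) _.
  exact: window_weight_le (normc_ge0 z).
have windows : {ae P, forall w, exists B : R, forall n,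
    (\sum_(1 <= t < n) window t (eps t w) <= B)%R}.
  apply: (ae_weighted_sums (e := e) (a := (D 1).+1)) => //.
  - by move=> t; exact: (measurableT_comp (mwindow t) (meps t)).
  - by move=> t t4; rewrite eE// (leq_trans _ t4).
pose F t := [set w | (0 < t)%N /\ (t%:R < normc (eps t w))%R].
have mF t : measurable (F t).
  rewrite /F; case: t => [|t]; first by rewrite (_ : [set _ | _] = set0)//; apply/seteqP; split => // w [].
  rewrite (_ : [set _ | _] = [set w | (t.+1%:R < normc (eps t.+1 w))%R]); last first.
    by apply/seteqP; split => // w [].
  have := measurable_fun_ltr (measurable_cst (t.+1%:R : R) (D := setT)) (mnorm t.+1).
  move=> /(_ measurableT [set true]); rewrite setTI; exact.
have large : {ae P, forall w, exists K, forall k, (K <= k)%N -> ~ F k w}.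
  apply: (borel_cantelli (C := fine (\int[P]_w (normc (eps 1%N w))%:E))) => // n.
  rewrite fineK//.
  pose g t (z : R[i]) : R := (if (t%:R < normc z)%R then 1 else 0)%R.
  have mg t : measurable_fun setT (g t).
    by apply: measurable_fun_ifT => //; apply: measurable_fun_ltr => //; exact: measurable_normc.
  have g0 t z : (0 <= g t z)%R by rewrite /g; case: ifP.
  have := @iid_sum_integral_le _ _ _ P eps g (fun z => normc z) 1 n law erefl mg g0 measurable_normc.
  move=> /(_ (fun z => count_below n (normc_ge0 z))); apply: le_trans.
  case: n => [|n]; first by rewrite !big_geq.
  rewrite big_ltn// [X in P X](_ : F 0%N = set0) ?measure0 ?add0e; last first.
    by apply/seteqP; split => // w [].
  rewrite big_nat [leRHS]big_nat; apply: lee_sum => t /andP[t0 _].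
  have -> : \int[P]_w (g t (eps t w))%:E = \int[P]_w (\1_(F t) w)%:E.
    apply: eq_integral => w _; rewrite indicE /g; case: ifPn => h.
      by rewrite mem_set.
    by rewrite memNset//= => -[_]; exact/negP.
  by rewrite integral_indic// setIT.
apply: (@iid_truncated_bounded _ _ _ P eps (fine (\int[P]_w (normc (eps 1%N w))%:E)) (fun=> 0%R)) => //.
- by rewrite fineK.
- move=> t t4; have t0 : (0 < t)%N by apply: leq_ltn_trans t4.
  have [symt _] := h2 t t0; have [-> ->] := symmetric_trunc_mean symt (trunc_level_ge0 t).
  by rewrite abse0 mulr0.
- by exists 0%R => n; rewrite big1.
apply: filterS2 windows large => w [B hB] [K hK].
exists (\sum_(0 <= t < K.+1) rest t w + B)%R => n; rewrite -/(rest _ _).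
have hW m : (\sum_(K.+1 <= t < m) rest t w <= B)%R.
  have [Km|mK] := leqP K.+1 m; last first.
    by rewrite big_geq ?(ltnW mK)//; have := hB 0%N; rewrite big_geq.
  apply: le_trans (hB m); rewrite [leRHS](@big_cat_nat _ _ _ K.+1)//=.
  rewrite ler_wpDl ?sumr_ge0// big_nat [leRHS]big_nat; apply: ler_sum => t /andP[Kt _].
  have nF := hK t (ltnW Kt).
  rewrite /rest /window rest_truncE (_ : (t%:R < normc (eps t w))%R = false) ?orbF//.
  by apply/negP => h; apply: nF; split => //; exact: leq_trans Kt.
by apply: sums_from_one hW n.
Qed.

End Iid_cases.

(** * Almost sure boundedness and detection *)

Section Almost_sure_boundedness.
Context {R : realType} {d : measure_display} {T : measurableType d}.
Variable P : probability T R.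
Variable eps : nat -> {RV P >-> R[i]}.

Lemma noise_bounded_waves : noise1 eps \/ noise2 eps \/ noise3 eps \/ noise4 eps ->
  ae_bounded_waves eps.
Proof.
move=> [|[|[|]]]; [exact: noise1_bounded|exact: noise2_bounded|
  exact: noise3_bounded|exact: noise4_bounded].
Qed.

(** Abel summation, the weights [a m t] being nonincreasing in t and at most 1; the
    bound depends on neither m nor theta. *)
Lemma Ssum_le_waves (a : nat -> nat -> R) (u : nat -> R[i]) (B : R) m theta :
  admissible_matrix a -> (0 < m)%N ->
  (forall n, normc (wave u 0 n theta) <= B) -> normc (Ssum a u m theta) <= B.
Proof.
move=> [[a1 amono a0 _ _] _] m0 hB.
have /andP[a1pos a1le] := a1 m m0.
have B0 : 0 <= B by apply: le_trans (normc_ge0 _) (hB 0%N).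
apply: (@le_trans _ _ (a m 1%N * B)); last by rewrite ler_piMl.
rewrite /Ssum; under eq_bigr do rewrite -mulrA.
apply: abel_bound => //.
- by move=> t t0 tm; exact: a0.
- by move=> s t s0 st tm; exact: amono.
Qed.

Lemma sup_Linfty_le (g : nat -> R -> R[i]) (B : R) :
  (forall m theta, (0 < m)%N -> normc (g m theta) <= B) -> (sup_Linfty g < +oo)%E.
Proof.
move=> hB; apply: (@le_lt_trans _ _ B%:E); last exact: ltry.
apply: ge_ereal_sup => _ [m m0 <-]; rewrite /Linfty_norm unlock.
rewrite ifT ?lebesgue_setT_gt0//; apply/ess_supP; apply: aeW => x /=.
by rewrite ger0_norm ?normc_ge0// lee_fin hB.
Qed.

Lemma bounded_noise_event_ae (a : nat -> nat -> R) : admissible_matrix a ->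
  ae_bounded_waves eps -> {ae P, forall w, bounded_noise_event a eps w}.
Proof.
move=> a_adm; apply: filterS => w [B hB].
by apply: (@sup_Linfty_le _ B) => m theta m0; apply: Ssum_le_waves.
Qed.

End Almost_sure_boundedness.

(** Completeness turns an event that contains an almost sure one into a measurable
    set. *)
Lemma ae_event_complete {R : realType} {d : measure_display} {T : measurableType d}
  (P : probability T R) (A : set T) : measure_is_complete P ->
  {ae P, forall w, A w} -> measurable A /\ P A = 1%E.
Proof.
move=> cP hA; have mC : measurable (~` A) by exact: cP.
have mA : measurable A by rewrite -[A]setCK; exact: measurableC.
split => //; have := probability_setC P mC; rewrite setCK => ->.
have -> : P (~` A) = 0%E by apply: measure_negligible.
by rewrite sube0.
Qed.

Theorem theorem4p2 (R : realType) (d : measure_display) (T : measurableType d)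
    (P : probability T R) (P_complete : measure_is_complete P)
    (N : nat) (alpha : 'I_N -> R[i]) (lambda : 'I_N -> R)
    (lambda_range : forall n, - pi <= lambda n < pi)
    (lambda_distinct : injective lambda)
    (alpha_neq0 : forall n, alpha n != 0)
    (eps : nat -> {RV P >-> R[i]}) (eps_indep : mutually_independent eps)
    (a : nat -> nat -> R) (a_adm : admissible_matrix a)
    (H h h' : nat -> R) (J : nat -> nat)
    (levels_adm : admissible_levels a H h h' J)
    (noise : noise1 eps \/ noise2 eps \/ noise3 eps \/ noise4 eps) :
  (measurable (bounded_noise_event a eps) /\
   P (bounded_noise_event a eps) = 1%E) /\
  forall w, bounded_noise_event a eps w ->
  exists (M : nat) (arc : nat -> 'I_N -> set R[i]),
  [/\ (0 < M)%N,
      (forall m, (M <= m)%N ->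
        [/\ Nhat a (signal alpha lambda eps w) h h' J m = N,
            injective (arc m),
            range (arc m) = arc_family a (signal alpha lambda eps w) h h' J m &
            forall n, arc m n (expi (lambda n))]) &
      forall (n : 'I_N) (j j' : nat -> nat),
        (forall m, (M <= m)%N ->
          [/\ (0 < j m)%N, (j m <= j' m)%N &
              arc m n = Arc (grid_angle (J m) (j m)) (grid_angle (J m) (j' m))]) ->
        ((expi (2 * pi * ((j m + j' m)%:R / (2 * (J m)%:R))) : R[i]^o) @[m --> \oo]
           --> (expi (lambda n) : R[i]^o)) /\
        ((Sone a m (2 * pi / (J m)%:R) / Sone a m 0 : R[i]^o) @[m --> \oo]
           --> (1 : R[i]^o) ->
         forall jmax : nat -> int,
         (forall m, (M <= m)%N ->
            (j m)%:Z <= jmax m <= (j' m)%:Z /\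
            forall k : int, (j m)%:Z <= k <= (j' m)%:Z ->
              normc (Ssum a (signal alpha lambda eps w) m (grid_angle (J m) k))
              <= normc (Ssum a (signal alpha lambda eps w) m
                          (grid_angle (J m) (jmax m)))) ->
         (Ssum a (signal alpha lambda eps w) m (grid_angle (J m) (jmax m)) /
            (\sum_(1 <= t < m.+1) a m t / t%:R)%:C : R[i]^o) @[m --> \oo]
           --> (alpha n : R[i]^o))].
Proof.
split; first exact: ae_event_complete P_complete
  (bounded_noise_event_ae a_adm (noise_bounded_waves noise)).
move=> w /sup_Linfty_Ssum_bound[C C0 hC].
have noise_part : exists2 C : R, 0 <= C & forall m theta, (0 < m)%N ->
    normc (Ssum a (signal alpha lambda eps w) m theta -
           \sum_(n < N) alpha n * Sone a m (theta - lambda n)) <= C.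
  exists C => // m theta m0.
  by rewrite /signal SsumD Ssum_harmonics addrC addKr hC.
by apply: (superlevel_arcs_detect lambda_range lambda_distinct alpha_neq0 a_adm
  levels_adm noise_part).
Qed.
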